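(* Let $\mathfrak{h}=\mathbb{C}\alpha$ be a one-dimensional complex vector space with the symmetric bilinear form such that $(\alpha,\alpha)=1$, let $M(1,0)$ be the associated Heisenberg vertex operator algebra, and let $\phi$ be the anti-linear involution of $M(1,0)$ determined by $\phi(\alpha(-n_1)\cdots\alpha(-n_k)\mathbf{1})=(-1)^k\alpha(-n_1)\cdots\alpha(-n_k)\mathbf{1}$ for $n_1\ge\cdots\ge n_k\ge1$. Then $(M(1,0),\phi)$ is a unitary vertex operator algebra, and for $\lambda\in\mathfrak{h}$ with $(\alpha,\lambda)\ge0$, $M(1,\lambda)$ is a unitary irreducible $M(1,0)$-module (with respect to $\phi$).
   Context: The Heisenberg algebra is $\hat{\mathfrak{h}}=\mathfrak{h}\otimes\mathbb{C}[t,t^{-1}]\oplus\mathbb{C}K$ with $K$ central and $[\beta(m),\gamma(n)]=m(\beta,\gamma)\delta_{m+n,0}K$, $\beta(n)=\beta\otimes t^n$. For $\lambda\in\mathfrak{h}$, $M(1,\lambda)=U(\hat{\mathfrak{h}})/J_\lambda$, where $J_\lambda$ is the left ideal generated by $\alpha(n)$ ($n\ge1$), $\alpha(0)-(\alpha,\lambda)$ and $K-1$. $M(1,0)$ is a vertex operator algebra with vacuum $\mathbf{1}=1+J_0$, $Y(\alpha(-1)\mathbf{1},z)=\sum_n\alpha(n)z^{-n-1}$ and Virasoro vector $\omega=\frac12\alpha(-1)^2\mathbf{1}$, and each $M(1,\lambda)$ is an irreducible ordinary $M(1,0)$-module. For a vertex operator algebra $V$ (over $\mathbb{C}$, CFT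 type: $V=\bigoplus_{n\ge0}V_n$, $V_0=\mathbb{C}\mathbf{1}$) with $Y(a,z)=\sum_na_nz^{-n-1}$, $Y(\omega,z)=\sum_nL(n)z^{-n-2}$, an anti-linear involution is an anti-linear bijection $\phi:V\to V$ of order $2$ with $\phi(\mathbf{1})=\mathbf{1}$, $\phi(\omega)=\omega$, $\phi(u_nv)=\phi(u)_n\phi(v)$. An ordinary $V$-module $(M,Y_M)$ is unitary (with respect to $\phi$) if there is a positive definite Hermitian form $(\cdot,\cdot)_M$ on $M$, linear in the first and anti-linear in the second variable, with $(Y_M(e^{zL(1)}(-z^{-2})^{L(0)}a,z^{-1})w_1,w_2)_M=(w_1,Y_M(\phi(a),z)w_2)_M$ for all $a\in V$, $w_1,w_2\in M$ (the formal variable $z$ being treated as real). $(V,\phi)$ is a unitary vertex operator algebra if this holds for $M=V$. *)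

(* Defs.v *)
From HB Require Import structures.
From mathcomp Require Import all_boot all_order all_algebra.
From mathcomp Require Import finmap.
From mathcomp Require Import boolp classical_sets fsbigop reals.
From mathcomp Require Import complex.
From mathcomp.multinomials Require Import monalg.

Set Implicit Arguments.
Unset Strict Implicit.
Unset Printing Implicit Defensive.

Import Order.TTheory GRing.Theory Num.Theory.
Import Quotient.Exports.

Local Open Scope ring_scope.
Local Open Scope quotient_scope.

Section Subspaces.
Variables (C : comNzRingType) (V : lmodType C).

Definition subspace (P : V -> Prop) : Prop :=
  P 0 /\ forall k x y, P x -> P y -> P (k *: x + y).

(* [mu] is the family of operators under which an ideal has to be stable. *)
Definition gen_submod (I : Type) (mu : I -> V -> V) (G : V -> Prop) : {pred V} :=
  [pred x | `[< forall P : V -> Prop, subspace P ->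
                  (forall i y, P y -> P (mu i y)) ->
                  (forall g, G g -> P g) -> P x >]].

Section GenTheory.
Variables (I : Type) (mu : I -> V -> V) (G : V -> Prop).
Local Notation S := (gen_submod mu G).

Lemma gen_submodP x : reflect (forall P : V -> Prop, subspace P ->
  (forall i y, P y -> P (mu i y)) -> (forall g, G g -> P g) -> P x) (x \in S).
Proof. exact: asboolP. Qed.

Lemma gen_submod_lin k x y : x \in S -> y \in S -> k *: x + y \in S.
Proof.
move=> /gen_submodP Sx /gen_submodP Sy; apply/gen_submodP => P sP muP GP.
exact: (sP.2 k x y (Sx P sP muP GP) (Sy P sP muP GP)).
Qed.

Lemma gen_submod0 : 0 \in S.
Proof. by apply/gen_submodP => P [P0 _] _ _. Qed.

Lemma gen_submodZ k x : x \in S -> k *: x \in S.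
Proof. by move=> Sx; rewrite -[_ *: _]addr0 gen_submod_lin // gen_submod0. Qed.

Lemma gen_submod_mu i x : x \in S -> mu i x \in S.
Proof.
move=> /gen_submodP Sx; apply/gen_submodP => P sP muP GP.
exact: (muP i x (Sx P sP muP GP)).
Qed.

Lemma gen_submod_gen g : G g -> g \in S.
Proof. by move=> Gg; apply/gen_submodP => P _ _ GP; exact: GP. Qed.

Lemma gen_submod_zmod : zmod_closed S.
Proof.
split=> [|x y Sx Sy]; first exact: gen_submod0.
by rewrite addrC -scaleN1r gen_submod_lin.
Qed.

HB.instance Definition _ := GRing.isZmodClosed.Build V S gen_submod_zmod.

Definition lquot : Type := @Quotient.quot V S.
HB.instance Definition _ := GRing.Zmodule.on lquot.
HB.instance Definition _ := EqQuotient.on lquot.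

Lemma lquot_eqP x y :
  reflect (\pi_lquot x = \pi_lquot y) (x - y \in S).
Proof. by rewrite (Quotient.idealrBE (gen_submod mu G)); exact: eqP. Qed.

Lemma lquot_pi0 : \pi_lquot 0 = 0.
Proof. exact: pi_zeror. Qed.

Lemma lquot_piD x y : \pi_lquot (x + y) = \pi_lquot x + \pi_lquot y.
Proof. exact: pi_addr. Qed.

Definition lquot_scale (k : C) (q : lquot) : lquot := \pi_lquot (k *: repr q).

Lemma lquot_scaleE k x : lquot_scale k (\pi_lquot x) = \pi_lquot (k *: x).
Proof.
rewrite /lquot_scale; apply/lquot_eqP; rewrite -scalerBr.
by apply: gen_submodZ; apply/lquot_eqP; rewrite reprK.
Qed.

Fact lquot_scaleA a b v :
  lquot_scale a (lquot_scale b v) = lquot_scale (a * b) v.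
Proof. by rewrite -[v]reprK !lquot_scaleE scalerA reprK. Qed.
Fact lquot_scale1 : left_id 1 lquot_scale.
Proof. by move=> v; rewrite -[v]reprK lquot_scaleE scale1r. Qed.
Fact lquot_scaleDr : right_distributive lquot_scale +%R.
Proof.
move=> k u v; rewrite -[u]reprK -[v]reprK -lquot_piD !lquot_scaleE.
by rewrite scalerDr lquot_piD.
Qed.
Fact lquot_scaleDl v : {morph lquot_scale^~ v : a b / a + b}.
Proof.
by move=> a b; rewrite -[v]reprK !lquot_scaleE scalerDl lquot_piD.
Qed.
HB.instance Definition _ := GRing.Zmodule_isLmodule.Build C lquot
  lquot_scaleA lquot_scale1 lquot_scaleDr lquot_scaleDl.

Lemma lquot_piZ k x : \pi_lquot (k *: x) = k *: \pi_lquot x.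
Proof. by rewrite -lquot_scaleE. Qed.

End GenTheory.
End Subspaces.

Section EnvelopingAlgebra.
Variables (C : comNzRingType) (g : lmodType C) (br : g -> g -> g).

Local Notation T := {malg C[{fmonom g}]}.
Definition uea_letter (x : g) : T := << fmu x >>.

(* The first family of relations turns the free algebra on the set [g] into
   the tensor algebra of the vector space [g]. *)
Inductive uea_relation : T -> Prop :=
| uea_rel_lin k x y : uea_relation
    (uea_letter (k *: x + y) - (k *: uea_letter x + uea_letter y))
| uea_rel_br x y : uea_relation
    (uea_letter x * uea_letter y - uea_letter y * uea_letter x
     - uea_letter (br x y)).

Definition two_sided_mul (i : T * T) (x : T) : T := i.1 * x * i.2.
Definition uea : Type := lquot two_sided_mul uea_relation.
HB.instance Definition _ := GRing.Lmodule.on uea.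
HB.instance Definition _ := EqQuotient.on uea.

Definition uea_mul (x y : uea) : uea := \pi_uea (repr x * repr y).

Lemma uea_mulE a b : uea_mul (\pi_uea a) (\pi_uea b) = \pi_uea (a * b).
Proof.
have reprE (x : T) : repr (\pi_uea x) - x
    \in gen_submod two_sided_mul uea_relation.
  by apply/lquot_eqP; rewrite reprK.
rewrite /uea_mul; apply/lquot_eqP; set a' := repr _; set b' := repr _.
have -> : a' * b' - a * b
    = 1 *: two_sided_mul (1, b') (a' - a) + two_sided_mul (a, 1) (b' - b).
  by rewrite /two_sided_mul /= scale1r mul1r mulr1 mulrBl mulrBr addrA subrK.
by apply: gen_submod_lin; apply: gen_submod_mu; exact: reprE.
Qed.

Lemma uea_piD a b : \pi_uea (a + b) = \pi_uea a + \pi_uea b.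
Proof. exact: lquot_piD. Qed.

Fact uea_mulA : associative uea_mul.
Proof.
elim/quotW => x; elim/quotW => y; elim/quotW => z.
by rewrite (uea_mulE y z) (uea_mulE x y) !uea_mulE mulrA.
Qed.
Fact uea_mul1l : left_id (\pi_uea 1) uea_mul.
Proof. by elim/quotW => x; rewrite uea_mulE mul1r. Qed.
Fact uea_mul1r : right_id (\pi_uea 1) uea_mul.
Proof. by elim/quotW => x; rewrite uea_mulE mulr1. Qed.
Fact uea_mulDl : left_distributive uea_mul +%R.
Proof.
elim/quotW => x; elim/quotW => y; elim/quotW => z.
by rewrite -uea_piD (uea_mulE x z) (uea_mulE y z) -uea_piD uea_mulE mulrDl.
Qed.
Fact uea_mulDr : right_distributive uea_mul +%R.
Proof.
elim/quotW => x; elim/quotW => y; elim/quotW => z.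
by rewrite -uea_piD (uea_mulE x y) (uea_mulE x z) -uea_piD uea_mulE mulrDr.
Qed.
HB.instance Definition _ := GRing.Zmodule_isPzRing.Build uea
  uea_mulA uea_mul1l uea_mul1r uea_mulDl uea_mulDr.

Definition uea_in (x : g) : uea := \pi_uea (uea_letter x).

End EnvelopingAlgebra.

Section Heisenberg.
Variable C : numClosedFieldType.

(* The line h = C alpha, written in the coordinate given by alpha. *)
Definition cartan : Type := C^o.
HB.instance Definition _ := GRing.Lmodule.on cartan.
Definition alpha : cartan := (1 : C).
Definition cform (x y : cartan) : C := (x : C) * (y : C).

(* h (x) C[t, t^-1] is the space of finitely supported maps int -> h; the
   second component is the coefficient of K. *)
Definition heis : Type := ({malg C[int]} * C^o)%type.
HB.instance Definition _ := GRing.Lmodule.on heis.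

Definition heis_elt (b : cartan) (n : int) : heis := (<< (b : C) *g n >>, 0).
Definition heis_K : heis := (0, 1).
Definition heis_bracket (x y : heis) : heis :=
  (0, \sum_(m <- msupp x.1) m%:~R * cform (x.1)@_m (y.1)@_(- m)).

Definition U_heis : Type := uea heis_bracket.
HB.instance Definition _ := GRing.Lmodule.on U_heis.
HB.instance Definition _ := GRing.PzRing.on U_heis.
HB.instance Definition _ := EqQuotient.on U_heis.

Definition U_alpha (n : int) : U_heis := uea_in heis_bracket (heis_elt alpha n).
Definition U_K : U_heis := uea_in heis_bracket heis_K.

Section FockModule.
Variable lam : cartan.

Inductive fock_relation : U_heis -> Prop :=
| fock_rel_pos n : fock_relation (U_alpha n.+1%:Z)
| fock_rel_zero : fock_relation (U_alpha 0 - cform alpha lam *: (1 : U_heis))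
| fock_rel_K : fock_relation (U_K - (1 : U_heis)).

(* U / J_lam, where J_lam is the left ideal generated by [fock_relation]. *)
Definition fock : Type := lquot (fun a x : U_heis => a * x) fock_relation.
HB.instance Definition _ := GRing.Lmodule.on fock.
HB.instance Definition _ := EqQuotient.on fock.

Definition fock_vac : fock := \pi_fock 1.
Definition fock_act (a : U_heis) (w : fock) : fock := \pi_fock (a * repr w).

Lemma fock_actE a x : fock_act a (\pi_fock x) = \pi_fock (a * x).
Proof.
rewrite /fock_act; apply/lquot_eqP; rewrite -mulrBr.
by apply: gen_submod_mu; apply/lquot_eqP; rewrite reprK.
Qed.

Definition fock_alpha (n : int) : fock -> fock := fock_act (U_alpha n).

End FockModule.

Definition M1 : Type := fock 0.
HB.instance Definition _ := GRing.Lmodule.on M1.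
Definition vacuum : M1 := fock_vac 0.
Definition M1_alpha (n : int) : M1 -> M1 := fock_alpha n.
Definition conformal : M1 := 2^-1 *: M1_alpha (-1) (M1_alpha (-1) vacuum).

End Heisenberg.

Section VertexAlgebras.
Variable C : numClosedFieldType.

(* [Y a n b] is the mode a_n b, where Y(a, z) = sum_n a_n z^(-n-1). *)
Definition vertex_map (V M : Type) : Type := V -> int -> M -> M.

Definition binz (m : int) (j : nat) : C :=
  (\prod_(i < j) (m - i%:Z)%:~R) / j`!%:R.

Section Modes.
Variables (V M : lmodType C) (Y : vertex_map V V) (YM : vertex_map V M).

Definition bilinear_modes : Prop :=
  (forall k a b n w, YM (k *: a + b) n w = k *: YM a n w + YM b n w) /\
  (forall a n k w x, YM a n (k *: w + x) = k *: YM a n w + YM a n x).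

Definition lower_truncated : Prop :=
  forall a w, exists N : int, forall n : int, N <= n -> YM a n w = 0.

(* Coefficient of z0^(-l-1) z1^(-m-1) z2^(-n-1) in the Jacobi identity; under
   [lower_truncated] only finitely many terms of each sum are nonzero. *)
Definition jacobi_identity : Prop :=
  forall (u v : V) (w : M) (l m n : int),
    \sum_(j \in [set: nat])
       binz m j *: YM (Y u (l + j%:Z) v) (m + n - j%:Z) w =
    \sum_(j \in [set: nat])
       ((-1) ^+ j * binz l j) *:
         (YM u (m + l - j%:Z) (YM v (n + j%:Z) w)
          - (-1) ^ l *: YM v (n + l - j%:Z) (YM u (m + j%:Z) w)).

End Modes.

Section Weights.
Variables (V M : lmodType C) (YM : vertex_map V M) (omega : V).

Definition Lop (n : int) : M -> M := YM omega (n + 1).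

Definition weight_space (mu : C) (w : M) : Prop := Lop 0 w = mu *: w.

Definition finite_dimensional (P : M -> Prop) : Prop :=
  exists (d : nat) (e : 'I_d -> M), forall w, P w ->
    exists c : 'I_d -> C, w = \sum_(i < d) c i *: e i.

End Weights.

(* Vertex operator algebra of CFT type.  The homogeneous component V_n is the
   n-eigenspace of L(0), so that directness of the decomposition is automatic. *)
Record is_voa (V : lmodType C) (Y : vertex_map V V) (vac omega : V) : Prop := {
  voa_bilinear : bilinear_modes Y;
  voa_truncated : lower_truncated Y;
  voa_vacuum : forall n b, Y vac n b = if n == -1 then b else 0;
  voa_creation : forall a, Y a (-1) vac = a /\
                   forall n : int, 0 <= n -> Y a n vac = 0;
  voa_jacobi : jacobi_identity Y Y;
  voa_virasoro : exists c : C, forall (m n : int) (b : V),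
    Lop Y omega m (Lop Y omega n b) - Lop Y omega n (Lop Y omega m b) =
      (m - n)%:~R *: Lop Y omega (m + n) b +
      (if m + n == 0 then (m ^+ 3 - m)%:~R / 12%:R * c else 0) *: b;
  voa_derivative : forall a n b,
    Y (Lop Y omega (-1) a) n b = - n%:~R *: Y a (n - 1) b;
  voa_grading : forall b : V, exists (d : nat) (p : nat -> V),
    (forall i, weight_space Y omega i%:R (p i)) /\ b = \sum_(i < d) p i;
  voa_finite : forall i : nat,
    finite_dimensional (weight_space Y omega i%:R);
  voa_vac_neq0 : vac != 0;
  voa_cft : forall b, weight_space Y omega 0 b -> exists k : C, b = k *: vac
}.

Record is_ordinary_module (V M : lmodType C) (Y : vertex_map V V)
    (vac omega : V) (YM : vertex_map V M) : Prop := {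
  mod_bilinear : bilinear_modes YM;
  mod_truncated : lower_truncated YM;
  mod_vacuum : forall n w, YM vac n w = if n == -1 then w else 0;
  mod_jacobi : jacobi_identity Y YM;
  mod_grading : forall w : M, exists (d : nat) (mu : 'I_d -> C) (p : 'I_d -> M),
    (forall i, weight_space YM omega (mu i) (p i)) /\ w = \sum_(i < d) p i;
  mod_finite : forall mu : C, finite_dimensional (weight_space YM omega mu);
  mod_bounded : forall mu : C, exists N : nat, forall n : nat, (N <= n)%N ->
    forall w, weight_space YM omega (mu - n%:R) w -> w = 0
}.

Definition irreducible (V M : lmodType C) (YM : vertex_map V M) : Prop :=
  (exists w : M, w != 0) /\
  forall P : M -> Prop, subspace P ->
    (forall a n w, P w -> P (YM a n w)) ->
    (forall w, P w -> w = 0) \/ (forall w, P w).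

Definition antilinear (V : lmodType C) (phi : V -> V) : Prop :=
  forall k a b, phi (k *: a + b) = Num.conj k *: phi a + phi b.

Record is_antilinear_involution (V : lmodType C) (Y : vertex_map V V)
    (vac omega : V) (phi : V -> V) : Prop := {
  inv_antilinear : antilinear phi;
  inv_involutive : forall a, phi (phi a) = a;
  inv_nontrivial : exists a, phi a <> a;
  inv_vacuum : phi vac = vac;
  inv_conformal : phi omega = omega;
  inv_modes : forall a n b, phi (Y a n b) = Y (phi a) n (phi b)
}.

Record is_positive_hermitian (M : lmodType C) (f : M -> M -> C) : Prop := {
  herm_linear : forall k x y z, f (k *: x + y) z = k * f x z + f y z;
  herm_sym : forall x y, f y x = Num.conj (f x y);
  herm_pos : forall x, x != 0 -> 0 < f x x
}.

(* For a of weight h, e^(z L(1)) (-z^-2)^L(0) a is the finite sum over i <= h of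
   ((-1)^h / i!) z^(i - 2h) L(1)^i a, and Y_M(b, z^-1) = sum_k b_k z^(k+1); this
   compares the coefficients of z^(-n-1) in the invariance condition.  Both
   sides are linear in a, so homogeneous a suffice. *)
Definition invariant_form (V M : lmodType C) (Y : vertex_map V V) (omega : V)
    (phi : V -> V) (YM : vertex_map V M) (f : M -> M -> C) : Prop :=
  forall (h : nat) (a : V), weight_space Y omega h%:R a ->
  forall (n : int) (w1 w2 : M),
    f (\sum_(i < h.+1) ((-1) ^+ h / i`!%:R) *:
         YM (iter i (Lop Y omega 1) a) (2 * h%:Z - i%:Z - n - 2) w1) w2 =
    f w1 (YM (phi a) n w2).

Definition is_unitary_module (V M : lmodType C) (Y : vertex_map V V)
    (vac omega : V) (phi : V -> V) (YM : vertex_map V M) : Prop :=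
  is_ordinary_module Y vac omega YM /\
  exists f : M -> M -> C,
    is_positive_hermitian f /\ invariant_form Y omega phi YM f.

Definition is_unitary_voa (V : lmodType C) (Y : vertex_map V V)
    (vac omega : V) (phi : V -> V) : Prop :=
  [/\ is_voa Y vac omega, is_antilinear_involution Y vac omega phi
    & exists f : V -> V -> C,
        is_positive_hermitian f /\ invariant_form Y omega phi Y f].

End VertexAlgebras.

Section HeisenbergVOA.
Variable C : numClosedFieldType.
Local Notation V := (M1 C).

Definition heisenberg_voa (Y : vertex_map V V) : Prop :=
  is_voa Y (vacuum C) (conformal C) /\
  forall n b, Y (M1_alpha (-1) (vacuum C)) n b = M1_alpha n b.

Definition heisenberg_module (Y : vertex_map V V) (lam : cartan C)
    (YM : vertex_map V (fock lam)) : Prop :=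
  is_ordinary_module Y (vacuum C) (conformal C) YM /\
  forall n w, YM (M1_alpha (-1) (vacuum C)) n w = fock_alpha n w.

(* alpha(-n_1) ... alpha(-n_k) 1 for s = [:: n_1; ...; n_k]. *)
Definition fock_monomial (s : seq nat) : V :=
  foldr (fun n v => M1_alpha (- n%:Z) v) (vacuum C) s.

Definition heisenberg_involution (phi : V -> V) : Prop :=
  antilinear phi /\
  forall s : seq nat, sorted geq s -> all (leq 1) s ->
    phi (fock_monomial s) = (-1) ^+ size s *: fock_monomial s.

End HeisenbergVOA.

(* Main.v *)
Require Import Defs.
From HB Require Import structures.
From mathcomp Require Import all_boot all_order all_algebra.
From mathcomp Require Import finmap.
From mathcomp Require Import boolp classical_sets functions fsbigop reals.
From mathcomp Require Import complex.
From mathcomp.multinomials Require Import monalg.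
From mathcomp Require Import zify ring.

(* All fields come from one construction.  The fields on a Heisenberg module M,
   with alpha_n acting by the n-th product with alpha(z), form a Heisenberg
   module in which the identity field is a vacuum vector of weight 0; so the
   universal property of M(1,0) yields the state-field map Y_M.  The commutator
   formula of alpha(z) with Y_M(v, z) follows by induction on v, and the Jacobi
   identity by induction on u, moving every mode of alpha past Y_M(v, z) and
   regrouping by Vandermonde convolutions.

   The form is pulled back from the polynomial ring, in which alpha(-n) is
   multiplication by a variable and alpha(n) is n times the derivative; the
   pull-back is positive definite because a singular vector of M(1,lambda) is
   a multiple of the vacuum, by the eigenvalues of L(0).  Real (alpha,lambda)
   makes alpha(0) self-adjoint, and invariance for all states is proved by
   induction on monomials, where L(1)^i / i! acts on alpha(-p) by binomial
   coefficients. *)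

Set Implicit Arguments.
Unset Strict Implicit.
Unset Printing Implicit Defensive.

Import Order.TTheory GRing.Theory Num.Theory.
Import Quotient.Exports.

Local Open Scope ring_scope.
Local Open Scope quotient_scope.

(** * Binomial coefficients with integral upper argument *)

(** Everything is stated for modes, so that each identity of formal series becomes an identity
    between binomial sums of finite support. The obstacle is that M(1,lambda) is a quotient of an
    enveloping algebra with no basis at hand: a field cannot simply be defined on monomials by
    normal ordering, and not even the vacuum is known to be nonzero. Hence maps out of M(1,lambda)
    come from its universal property alone, and nonvanishing comes from the polynomial model. The
    universal property has to accept operators that satisfy the Heisenberg relations on a subspace
    only, because n-th products with alpha(z) behave well on fields only. The involution arises in
    the same way, from the operators -alpha(n) on the complex conjugate space. Its sign is forced by
    unitarity: alpha has weight 1 and L(1) alpha = 0, so the adjoint vertex operator replaces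
    alpha(n) by -alpha(-n), and phi(alpha) = -alpha makes alpha(-n) the adjoint of alpha(n), as the
    positive norm n of alpha(-n) 1 requires. *)

HB.lock Definition zbin (C : numClosedFieldType) (l : int) (j : nat) : C :=
  binz C l j.
(** The coefficient of z^j in (1 - z)^l, expanded in powers of z; [zbin l j] is that of (1 +
    z)^l. *)
HB.lock Definition sbin (C : numClosedFieldType) (l : int) (j : nat) : C :=
  (-1) ^+ j * zbin C l j.

Section Binomials.
Variable C : numClosedFieldType.
Implicit Types (l m : int) (i j k n p s t : nat).
Local Notation bin := (zbin C).
Local Notation sbin := (sbin C).

Lemma sbinE l t : sbin l t = (-1) ^+ t * bin l t.
Proof. by rewrite sbin.unlock. Qed.

Lemma fact_neq0 j : j`!%:R != 0 :> C.
Proof. by rewrite pnatr_eq0 -lt0n fact_gt0. Qed.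

Lemma binz0 l : bin l 0 = 1.
Proof. by rewrite zbin.unlock /binz big_ord0 fact0 divr1. Qed.

Lemma binzS l j : j.+1%:R * bin l j.+1 = (l - j%:Z)%:~R * bin l j.
Proof.
rewrite zbin.unlock /binz big_ord_recr /= factS natrM invfM mulrC -!mulrA mulrCA.
by rewrite [_^-1 * j.+1%:R]mulrC mulKf ?pnatr_eq0.
Qed.

Lemma eq_binzS l j x : j.+1%:R * x = (l - j%:Z)%:~R * bin l j -> x = bin l j.+1.
Proof. by rewrite -binzS; apply: mulfI; rewrite pnatr_eq0. Qed.

Lemma binz_Pascal l j : bin (l + 1) j.+1 = bin l j.+1 + bin l j.
Proof.
elim: j => [|j IH].
  apply/esym/eq_binzS; rewrite mulrDr binzS !binz0 subr0 mul1r !mulr1 subr0.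
  by rewrite intrD.
apply/esym/eq_binzS; rewrite IH mulrDr binzS.
have := binzS l j; rewrite !rmorphB rmorphD /= -[j.+2%:R]natr1 -[j.+1%:R]natr1.
rewrite [j.+1%:Z]intS rmorphD /= -!pmulrn.
set x := bin l j.+1; set y := bin l j => E.
apply: subr0_eq; move/(congr1 (+%R^~ (- ((l%:~R - j%:R) * y)))): E.
by rewrite subrr => <-; ring.
Qed.

Lemma binz_nat n k : bin n%:Z k = 'C(n, k)%:R.
Proof.
elim: n k => [|n IH] [|k]; rewrite ?binz0 ?bin0 //.
  rewrite bin0n /=; apply/esym/eq_binzS; rewrite mulr0 zbin.unlock /binz.
  case: k => [|k]; first by rewrite subrr mul0r.
  by rewrite big_ord_recl /= subrr !mul0r mulr0.
have -> : n.+1%:Z = n%:Z + 1 by lia.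
by rewrite binz_Pascal !IH binS natrD.
Qed.

(** After multiplication by p + 1 = t + (p + 1 - t), each half lowers one of the two indices through
    [binzS], and the resulting factors l - t and m - (p - t) add up to l + m - p. *)
Lemma binz_Vandermonde l m p :
  \sum_(t < p.+1) bin l t * bin m (p - t) = bin (l + m) p.
Proof.
elim: p l m => [|p IH] l m; first by rewrite big_ord1 !binz0 mulr1.
apply: (mulfI (_ : p.+1%:R != 0)); first by rewrite pnatr_eq0.
rewrite binzS -IH mulr_sumr.
transitivity (\sum_(t < p.+2) (t%:R * bin l t * bin m (p.+1 - t)
   + bin l t * ((p.+1 - t)%:R * bin m (p.+1 - t)))).
  apply: eq_bigr => -[t /=]; rewrite ltnS => le_t _.
  by rewrite -{1}(subnKC le_t) natrD; ring.
rewrite big_split /= big_ord_recl /= !mul0r add0r.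
rewrite [X in _ + X]big_ord_recr /= subnn mul0r mulr0 addr0 -big_split mulr_sumr.
apply: eq_bigr => -[t /=]; rewrite ltnS => le_t _.
rewrite /bump /= add1n subSS subSn // !binzS.
have -> : l + m - p%:Z = (l - t%:Z) + (m - (p - t)%N%:Z) by lia.
by rewrite [in RHS]rmorphD /=; ring.
Qed.

Lemma binz_fact l j : bin l j * j`!%:R = \prod_(i < j) (l - i%:Z)%:~R.
Proof. by rewrite zbin.unlock /binz divfK ?fact_neq0. Qed.

(** Trinomial revision. Multiplied by i! s!, both sides are the falling factorial of l of length i +
    s, cut after i factors. *)
Lemma binz_mul l i s :
  bin l (i + s) * 'C(i + s, i)%:R = bin l i * bin (l - i%:Z) s.
Proof.
apply: (mulIf (fact_neq0 i)); apply: (mulIf (fact_neq0 s)).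
rewrite -!mulrA -!natrM; have := bin_fact (leq_addr s i); rewrite addKn => ->.
rewrite binz_fact natrM [bin (l - _) s * _]mulrCA [RHS]mulrA 2!binz_fact big_split_ord.
congr (_ * _); apply: eq_bigr => j _ /=.
by congr (_%:~R); lia.
Qed.

Lemma sbin0 l : sbin l 0 = 1.
Proof. by rewrite !sbinE binz0 mulr1. Qed.

Lemma sbin_0 t : sbin 0 t = (t == 0%N)%:R.
Proof. by case: t => [|t]; rewrite ?sbin0 // !sbinE binz_nat bin0n mulr0. Qed.

Lemma sbinS l t : sbin l t.+1 = sbin (l + 1) t.+1 + sbin l t.
Proof. by rewrite !sbinE binz_Pascal exprS; ring. Qed.

Lemma sbin_Vandermonde l m p :
  \sum_(t < p.+1) sbin l t * sbin m (p - t) = sbin (l + m) p.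
Proof.
rewrite [RHS]sbinE -binz_Vandermonde mulr_sumr; apply: eq_bigr => -[t /=].
by rewrite ltnS => le_t _; rewrite !sbinE mulrACA -exprD subnKC.
Qed.

Lemma sbin_mul l i s :
  sbin l (i + s) * bin (i + s)%N%:Z i = sbin l i * sbin (l - i%:Z) s.
Proof. by rewrite !sbinE binz_nat -[LHS]mulrA binz_mul exprD mulrACA. Qed.

Lemma sbin_swap l i t :
  sbin l t * bin (l - t%:Z) i = (-1) ^+ i * (sbin l i * sbin (l - i%:Z) t).
Proof.
have E : bin l t * bin (l - t%:Z) i = bin l i * bin (l - i%:Z) t.
  rewrite -!binz_mul addnC; congr (_ * _%:R).
  by rewrite -(bin_sub (leq_addr t i)) addKn.
rewrite !sbinE -[LHS]mulrA E -[_ * bin l i * _]mulrA signrMK.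
by rewrite mulrCA.
Qed.

Lemma sbin_nat n k : sbin n%:Z k = (-1) ^+ k * 'C(n, k)%:R.
Proof. by rewrite sbinE binz_nat. Qed.

(** The coefficients of (1 - z)^(-n-1), by a double induction on Pascal's rule. *)
Lemma sbin_neg n k : sbin (- n.+1%:Z) k = 'C(n + k, k)%:R.
Proof.
elim: k n => [|k IHk] n; first by rewrite sbin0 bin0.
elim: n => [|n IHn].
  rewrite sbinS (_ : - 1%:Z + 1 = 0) ?sbin_0 /=; last by lia.
  by rewrite IHk !add0n !binn add0r.
rewrite sbinS (_ : - n.+2%:Z + 1 = - n.+1%:Z); last by lia.
by rewrite IHn IHk !addnS !addSn [in RHS]binS natrD.
Qed.

(* The coefficient identity behind the formal delta function:
   with [zb] extending by [0] to negative indices, the two expansions of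
   (z1 - z2)^l differ by a multiple of a derivative of delta(z1 / z2). *)
Definition zb (f : nat -> C) (z : int) : C := if z is Posz j then f j else 0.

Lemma zb_pos f z j : z = j%:Z -> zb f z = f j.
Proof. by move=> ->. Qed.

Lemma zb_neg f z : z < 0 -> zb f z = 0.
Proof. by case: z. Qed.

(** For l >= 0 both expansions are the same polynomial read from its two ends, and they cancel. For
    l = -(r + 1) the sign of m decides which of the two terms on the left can be nonzero. *)
Lemma sbin_delta l m :
  zb (sbin l) (m + l + 1) - (-1) ^ l * zb (sbin l) (- 1 - m) =
  zb (bin m) (- 1 - l).
Proof.
case: l => [n|r].
  rewrite [RHS]zb_neg; last by lia.
  have -> : - 1 - m = n%:Z - (m + n%:Z + 1) by lia.
  case: (m + _ + 1) => k; last first.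
    rewrite zb_neg ?add0r // (@zb_pos _ _ (n + k.+1)%N); last by lia.
    by rewrite sbin_nat bin_small ?mulr0 ?oppr0 //; lia.
  have [le_kn|lt_nk] := leqP k n; last first.
    rewrite [X in _ * X]zb_neg ?mulr0 ?subr0; last by lia.
    by rewrite /= sbin_nat bin_small ?mulr0.
  rewrite (@zb_pos _ (_ - _) (n - k)%N) /=; last by lia.
  rewrite !sbin_nat bin_sub // -exprnP
     -{2}(subnK le_kn) exprD -mulrA.
  by rewrite [_ * (_ ^+ _ * _)]mulrCA signrMK subrr.
have E : Negz r = - r.+1%:Z by lia.
have S : (-1) ^ (Negz r) = (-1) ^+ r.+1 :> C by rewrite E -exprnN -exprVn invrN1.
rewrite S E [RHS](@zb_pos _ _ r); last by lia.
have -> : m + - r.+1%:Z + 1 = m - r%:Z by lia.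
case: m => m.
  rewrite [X in _ * X]zb_neg ?mulr0 ?subr0; last by lia.
  rewrite binz_nat; have [le_rm|lt_mr] := leqP r m.
    rewrite (@zb_pos _ _ (m - r)%N); last by lia.
    by rewrite sbin_neg subnKC // bin_sub.
  by rewrite bin_small // zb_neg //; lia.
rewrite zb_neg ?sub0r; last by lia.
rewrite (@zb_pos _ _ m); last by lia.
rewrite sbin_neg exprS mulN1r mulNr opprK.
have /(congr1 (fun x => (-1) ^+ r * x)) := sbin_neg m r.
rewrite sbinE signrMK (_ : - m.+1%:Z = Negz m) => [->|]; last by lia.
by rewrite addnC -(bin_sub (leq_addr r m)) addKn.
Qed.

(** Coefficient of z^s in (1 - z)^c (1 + z / (1 - z))^p = (1 - z)^(c - p). *)
Lemma sbin_compl_sum c p s :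
  \sum_(q < p.+1) 'C(p, q)%:R * zb (sbin (c - q%:Z)) (s%:Z - q%:Z) =
  sbin (c - p%:Z) s.
Proof.
elim: p c s => [|p IH] c s; first by rewrite big_ord1 bin0 mul1r !subr0.
rewrite big_ord_recl /= bin0 mul1r !subr0.
under eq_bigr => q _ do rewrite /bump /= add1n binS natrD mulrDl.
rewrite big_split /= addrA big_ord_recr /= bin_small // mul0r addr0.
have := IH c s; rewrite big_ord_recl /= bin0 mul1r !subr0.
under eq_bigr => q _ do rewrite /bump /= add1n.
move=> ->.
case: s => [|s].
  rewrite big1 ?addr0 ?sbin0 // => q _; rewrite zb_neg ?mulr0 //; lia.
rewrite (_ : c - p.+1%:Z = c - 1 - p%:Z); last by lia.
rewrite [RHS]sbinS (_ : c - 1 - p%:Z + 1 = c - p%:Z); last by lia.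
congr (_ + _); rewrite -IH; apply: eq_bigr => q _; congr (_ * zb (sbin _) _); lia.
Qed.

(** Coefficient of z^t in (1 - z)^(c - p) (1 - (1 - z))^p = z^p (1 - z)^(c - p). *)
Lemma sbin_difference c p t :
  \sum_(j < p.+1) (-1) ^+ j * 'C(p, j)%:R * sbin (c - p%:Z + j%:Z) t =
  zb (sbin (c - p%:Z)) (t%:Z - p%:Z).
Proof.
elim: p c => [|p IH] c.
  rewrite big_ord1 bin0 !mul1r (@zb_pos _ _ t); last by lia.
  by congr (sbin _ _); rewrite /=; lia.
rewrite big_ord_recl /= bin0 !mul1r.
under eq_bigr => q _ do rewrite /bump /= add1n binS natrD mulrDr mulrDl.
rewrite big_split /= addrA big_ord_recr /= bin_small //. rewrite mulr0 mul0r addr0.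
transitivity (zb (sbin (c - p.+1%:Z)) (t%:Z - p%:Z)
              - zb (sbin (c - p%:Z)) (t%:Z - p%:Z)).
  congr (_ + _).
    have -> : c - p.+1%:Z = c - 1 - p%:Z by lia.
    by rewrite -IH big_ord_recl /= bin0 !mul1r !addr0.
  rewrite -IH -sumrN; apply: eq_bigr => q _.
  by rewrite exprS !mulN1r !mulNr; congr (- (_ * sbin _ _)); lia.
have -> : t%:Z - p%:Z = (t%:Z - p.+1%:Z) + 1 by lia.
case: (t%:Z - p.+1%:Z) => [n|[|n]].
- rewrite !(@zb_pos _ (n%:Z + 1) n.+1) ?addn1 //; [|lia|lia].
  rewrite sbinS (_ : c - p.+1%:Z + 1 = c - p%:Z) /=; last by lia.
  by rewrite addrC addKr.
- by rewrite !(@zb_pos _ (_ + 1) 0) // !sbin0 subrr.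
- by rewrite !zb_neg ?subrr.
Qed.

End Binomials.

(** * Finitely supported sums *)

Section FiniteSums.
Variables (C : numClosedFieldType).

(* The sums over [nat] occurring below have finite support, in the sense of
   [fs] and, for iterated sums, of [fs2]. *)
Definition nsum (V : zmodType) (f : nat -> V) : V := \sum_(j \in [set: nat]) f j.

Definition fs (V : zmodType) (f : nat -> V) : Prop :=
  exists N, forall j, (N <= j)%N -> f j = 0.
Definition fs2 (V : zmodType) (f : nat -> nat -> V) : Prop :=
  exists N, forall i j, (N <= i)%N || (N <= j)%N -> f i j = 0.

Section Zmod.
Variable V : zmodType.
Implicit Types (f g : nat -> V).

Lemma nsumE N f : (forall j, (N <= j)%N -> f j = 0) ->
  nsum f = \sum_(j < N) f j.
Proof.
move=> f0; rewrite /nsum fsbig_ord; apply/esym/fsbig_widen => //.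
by move=> i /= [_ /negP]; rewrite -leqNgt; exact: f0.
Qed.

Lemma eq_nsum f g : (forall j, f j = g j) -> nsum f = nsum g.
Proof. by move=> fg; congr nsum; apply/funext. Qed.

Lemma nsum0 f : (forall j, f j = 0) -> nsum f = 0.
Proof. by move=> f0; rewrite (@nsumE 0) ?big_ord0. Qed.

Lemma nsum1 k f : (forall j, j != k -> f j = 0) -> nsum f = f k.
Proof.
move=> f0; rewrite (@nsumE k.+1) => [|j lt_kj]; last by rewrite f0 // gtn_eqF.
rewrite big_ord_recr /= big1 ?add0r // => i _.
by rewrite f0 // ltn_eqF.
Qed.

Lemma fs2_common f g : fs f -> fs g -> exists N,
  (forall j, (N <= j)%N -> f j = 0) /\ (forall j, (N <= j)%N -> g j = 0).
Proof.
move=> [N fN] [M gM]; exists (maxn N M); split=> j; rewrite geq_max => /andP[Nj Mj].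
  exact: fN.
exact: gM.
Qed.

Lemma nsumD f g : fs f -> fs g -> nsum (fun j => f j + g j) = nsum f + nsum g.
Proof.
move=> ff fg; have [N [fN gN]] := fs2_common ff fg.
rewrite !(@nsumE N) // ?big_split // => j Nj.
by rewrite fN // gN // addr0.
Qed.

Lemma nsumB f g : fs f -> fs g -> nsum (fun j => f j - g j) = nsum f - nsum g.
Proof.
move=> ff fg; have [N [fN gN]] := fs2_common ff fg.
rewrite !(@nsumE N) // ?sumrB // => j Nj.
by rewrite fN // gN // subr0.
Qed.

Lemma fs_shift i f : fs f -> fs (fun j => f (i + j)%N).
Proof.
by move=> [N fN]; exists N => j Nj; apply: fN; rewrite (leq_trans Nj) ?leq_addl.
Qed.

Lemma nsum_shift i f : fs f -> (forall j, (j < i)%N -> f j = 0) ->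
  nsum f = nsum (fun j => f (i + j)%N).
Proof.
move=> [N fN] f0; rewrite (@nsumE (i + N)) => [|j Nj]; last first.
  by apply: fN; apply: leq_trans Nj; apply: leq_addl.
rewrite (@nsumE N) => [|j Nj]; last by apply: fN; rewrite (leq_trans Nj) ?leq_addl.
rewrite big_split_ord /= big1 ?add0r // => j _.
exact: f0.
Qed.

Lemma fs_sum n (f : 'I_n -> nat -> V) : (forall i, fs (f i)) ->
  fs (fun j => \sum_(i < n) f i j).
Proof.
elim: n f => [|n IH] f ff; first by exists 0%N => j _; rewrite big_ord0.
have [N fN] := IH (fun i => f (lift ord0 i)) (fun i => ff _).
have [M fM] := ff ord0; exists (maxn N M) => j; rewrite geq_max => /andP[Nj Mj].
by rewrite big_ord_recl fN // fM // addr0.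
Qed.

Lemma nsum_sum n (f : 'I_n -> nat -> V) : (forall i, fs (f i)) ->
  nsum (fun j => \sum_(i < n) f i j) = \sum_(i < n) nsum (f i).
Proof.
elim: n f => [|n IH] f ff; first by rewrite big_ord0 nsum0 // => j; rewrite big_ord0.
rewrite big_ord_recl /= -IH // -nsumD //; last exact: fs_sum.
by apply: eq_nsum => j; rewrite big_ord_recl.
Qed.

End Zmod.

Lemma raddf_nsum (V W : zmodType) (h : V -> W) (f : nat -> V) : h 0 = 0 -> {morph h : x y /
  x + y} -> fs f ->
  h (nsum f) = nsum (fun j => h (f j)).
Proof.
move=> h0 hD [N fN]; rewrite (nsumE fN) (@nsumE W N) => [|j Nj]; last by rewrite fN.
by elim/big_rec2: _ => // i x y _ <-; rewrite hD.
Qed.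

Section Double.
Variable V : zmodType.
Implicit Types f g : nat -> nat -> V.

Lemma fs2_row f : (exists N, forall i, (N <= i)%N -> forall j, f i j = 0) ->
  (forall i, fs (f i)) -> fs2 f.
Proof.
move=> [N fN] ff.
suff [M fM] : exists M, forall i j, (i < N)%N -> (M <= j)%N -> f i j = 0.
  exists (maxn N M) => i j; rewrite !geq_max.
  have [lt_iN|le_Ni] := ltnP i N; last by move=> _; apply: fN.
  by rewrite /= => /andP[_]; apply: fM.
elim: N {fN} => [|N [M fM]]; first by exists 0%N.
have [M' fM'] := ff N; exists (maxn M M') => i j.
rewrite ltnS leq_eqVlt geq_max => /orP[/eqP-> /andP[_]|lt_iN /andP[Mj _]].
  exact: fM'.
exact: fM.
Qed.

Lemma fs2_tr f : fs2 f -> fs2 (fun i j => f j i).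
Proof. by move=> [N fN]; exists N => i j; rewrite orbC; apply: fN. Qed.

Lemma fs2_col f : (exists N, forall j, (N <= j)%N -> forall i, f i j = 0) ->
  (forall j, fs (f^~ j)) -> fs2 f.
Proof. by move=> fN ff; apply: (@fs2_tr (fun i j => f j i)); apply: fs2_row. Qed.

Lemma fs2_add f : (exists N, forall i j, (N <= i + j)%N -> f i j = 0) -> fs2 f.
Proof.
move=> [N fN]; exists N => i j /orP[] h; apply: fN; apply: leq_trans h _.
  exact: leq_addr.
exact: leq_addl.
Qed.

Lemma fs2D f g : fs2 f -> fs2 g -> fs2 (fun i j => f i j + g i j).
Proof.
move=> [N fN] [M gM]; exists (maxn N M) => i j; rewrite !geq_max => h.
by rewrite fN ?gM ?addr0 //; case/orP: h => /andP[h1 h2]; rewrite ?h1 ?h2 ?orbT.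
Qed.

Lemma fs2_in f i : fs2 f -> fs (f i).
Proof. by move=> [N fN]; exists N => j Nj; apply: fN; rewrite Nj orbT. Qed.

Lemma fs2_out f : fs2 f -> fs (fun i => nsum (f i)).
Proof.
by move=> [N fN]; exists N => i Ni; apply: nsum0 => j; apply: fN; rewrite Ni.
Qed.

Lemma nsum2E N f : (forall i j, (N <= i)%N || (N <= j)%N -> f i j = 0) ->
  nsum (fun i => nsum (f i)) = \sum_(i < N) \sum_(j < N) f i j.
Proof.
move=> fN; rewrite (@nsumE V N) => [|i Ni]; last first.
  by apply: nsum0 => j; apply: fN; rewrite Ni.
by apply: eq_bigr => i _; rewrite (@nsumE V N) // => j Nj; apply: fN; rewrite Nj orbT.
Qed.

Lemma nsum_exchange f : fs2 f ->
  nsum (fun i => nsum (f i)) = nsum (fun j => nsum (f^~ j)).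
Proof.
move=> [N fN]; rewrite (nsum2E fN) exchange_big /=; apply/esym.
by apply: (@nsum2E N (fun i j => f j i)) => i j; rewrite orbC; apply: fN.
Qed.

Lemma nsum2D f g : fs2 f -> fs2 g -> nsum (fun i => nsum (fun j => f i j + g i j)) =
  nsum (fun i => nsum (f i)) + nsum (fun i => nsum (g i)).
Proof.
move=> ff fg; rewrite -nsumD; [|exact: fs2_out|exact: fs2_out].
by apply: eq_nsum => i; rewrite nsumD //; apply: fs2_in.
Qed.

Lemma nsum_diag f : fs2 f ->
  nsum (fun i => nsum (f i)) = nsum (fun p => \sum_(i < p.+1) f i (p - i)%N).
Proof.
move=> [N fN]; rewrite (nsum2E fN) (@nsumE V (N + N)) => [|p Np]; last first.
  apply: big1 => -[i /= lt_ip] _; apply: fN.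
  by have [//|lt_iN] := leqP N i; lia.
(* Both sides become sums over i <= p < 2N with p = i + j; outside the square of side N the summand
   vanishes. *)
transitivity (\sum_(p < N + N) \sum_(i < N | (i <= p)%N) f i (p - i)%N); last first.
  apply: eq_bigr => -[p /= lt_p] _.
  rewrite (big_ord_widen_cond (maxn N p.+1) (fun i => (i <= p)%N) (fun i => f i (p - i)%N))
    ?leq_maxl //.
  rewrite [RHS](big_ord_widen (maxn N p.+1) (fun i => f i (p - i)%N)) ?leq_maxr //.
  rewrite [LHS]big_mkcond [RHS]big_mkcond /=; apply: eq_bigr => i _.
  rewrite ltnS; case: (leqP i p) => //= le_ip; rewrite ?andbF //.
  by case: ltnP => // le_Ni; rewrite fN ?le_Ni.
rewrite [RHS](exchange_big_dep xpredT) //=; apply: eq_bigr => i _.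
transitivity (\sum_(p < N + N | (i <= p)%N && (p < i + N)%N) f i (p - i)%N); last first.
  rewrite [RHS]big_mkcond [LHS]big_mkcond /=; apply: eq_bigr => p _.
  case: (leqP i p) => //= le_ip; case: ltnP => //= le; rewrite fN //.
  by apply/orP; right; lia.
rewrite -(big_ord_widen_cond (N + N) (fun p => (i <= p)%N) (fun p => f i (p - i)%N)); last
  first.
  by rewrite leq_add2r ltnW.
rewrite [RHS]big_mkcond big_split_ord /= [X in _ = X + _]big1 ?add0r.
  by apply: eq_bigr => p _; rewrite leq_addr addKn.
by move=> p _; rewrite leqNgt ltn_ord.
Qed.

End Double.

Section Scale.
Variables V : lmodType C.
Implicit Type f : nat -> V.

Lemma scaler_nsum (k : C) f : fs f -> k *: nsum f = nsum (fun j => k *: f j).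
Proof. by apply: (@raddf_nsum V V ( *:%R k)); [rewrite scaler0|move=> x y; rewrite
  scalerDr]. Qed.

End Scale.
End FiniteSums.

(** * Linear combinations in modules *)

Section LinearExpressions.
Variables (C : numClosedFieldType) (V : lmodType C).

Inductive lexp : Type :=
| LAtom of nat | LZero | LAdd of lexp & lexp | LOpp of lexp | LScale of C & lexp.

Fixpoint leval (env : seq V) (e : lexp) : V :=
  match e with
  | LAtom n => nth 0 env n
  | LZero => 0
  | LAdd a b => leval env a + leval env b
  | LOpp a => - leval env a
  | LScale k a => k *: leval env a
  end.

Fixpoint lcoef (e : lexp) (i : nat) : C :=
  match e with
  | LAtom n => if n == i then 1 else 0
  | LZero => 0
  | LAdd a b => lcoef a i + lcoef b i
  | LOpp a => - lcoef a i
  | LScale k a => k * lcoef a i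
  end.

Lemma leval_coef env e :
  leval env e = \sum_(i < size env) lcoef e i *: nth 0 env i.
Proof.
elim: e => /= [n||a -> b ->|a ->|k a ->].
- have [lt_n|le_n] := ltnP n (size env).
    rewrite (bigD1 (Ordinal lt_n)) //= eqxx scale1r big1 ?addr0 // => i.
    by rewrite -val_eqE /= eq_sym => /negPf ->; rewrite scale0r.
  rewrite nth_default // big1 // => i _; rewrite gtn_eqF ?scale0r //.
  exact: leq_trans le_n.
- by rewrite big1 // => i _; rewrite scale0r.
- by rewrite -big_split; apply: eq_bigr => i _; rewrite scalerDl.
- by rewrite -sumrN; apply: eq_bigr => i _; rewrite scaleNr.
- by rewrite scaler_sumr; apply: eq_bigr => i _; rewrite scalerA.
Qed.

(** Unfolds to a conjunction of scalar equations, one for each atom, each of which is left to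
    [ring]. *)
Fixpoint lcheck (n : nat) (a b : lexp) : Prop :=
  if n is n'.+1 then lcoef a n' = lcoef b n' /\ lcheck n' a b else True.

Lemma lcheckP env a b : lcheck (size env) a b -> leval env a = leval env b.
Proof.
move=> h; rewrite !leval_coef; apply: eq_bigr => -[i /=].
elim: (size env) h => // n IH /= [h hn]; rewrite ltnS leq_eqVlt.
by case/orP => [/eqP-> _|lt_in _]; [rewrite h|apply: IH].
Qed.
End LinearExpressions.

Ltac lmod_index x env :=
  lazymatch env with
  | x :: _ => constr:(0%N)
  | _ :: ?env' => let n := lmod_index x env' in constr:(S n)
  end.
Ltac lmod_mem x env :=
  lazymatch env with
  | nil => constr:(false)
  | x :: _ => constr:(true)
  | _ :: ?env' => lmod_mem x env'
  end.
Ltac lmod_atoms e env :=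
  lazymatch e with
  | @GRing.add _ ?a ?b => let env1 := lmod_atoms a env in lmod_atoms b env1
  | @GRing.opp _ ?a => lmod_atoms a env
  | @GRing.scale _ _ _ ?a => lmod_atoms a env
  | @GRing.zero _ => constr:(env)
  | ?x => lazymatch lmod_mem x env with
          | true => constr:(env) | false => constr:(x :: env) end
  end.
Ltac lmod_reify C e env :=
  lazymatch e with
  | @GRing.add _ ?a ?b =>
      let a' := lmod_reify C a env in
      let b' := lmod_reify C b env in constr:(@LAdd C a' b')
  | @GRing.opp _ ?a => let a' := lmod_reify C a env in constr:(@LOpp C a')
  | @GRing.scale _ _ ?k ?a =>
      let a' := lmod_reify C a env in constr:(@LScale C k a')
  | @GRing.zero _ => constr:(@LZero C)
  | ?x => let n := lmod_index x env in constr:(@LAtom C n)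
  end.
(* Proves equations between linear combinations in an [lmodType C] by
   comparing the coefficients of the atoms with [ring]. *)
Ltac lmod C :=
  lazymatch goal with
  | |- @eq ?T ?x ?y =>
      let env0 := lmod_atoms x (@nil T) in
      let env := lmod_atoms y env0 in
      let a := lmod_reify C x env in
      let b := lmod_reify C y env in
      refine (@lcheckP C _ env a b _); cbn -[sbin zbin]; repeat split; ring
  end.

(** * Fields and their products *)

Section Fields.
Variables (C : numClosedFieldType) (M : lmodType C).
Local Notation bin := (zbin C).
Local Notation sbin := (sbin C).
Implicit Types (a b c : int -> M -> M) (k l m n q : int) (w x y : M).

Record isfield a : Prop := {
  field_lin : forall n (k : C) x y, a n (k *: x + y) = k *: a n x + a n y;
  field_trunc : forall w, exists N : int, forall n, N <= n -> a n w = 0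
}.

Section FieldTheory.
Variable a : int -> M -> M.
Hypothesis fa : isfield a.

Lemma field0 n : a n 0 = 0.
Proof.
have := field_lin fa n 1 0 0; rewrite scaler0 addr0 scale1r => h.
by apply: (addrI (a n 0)); rewrite addr0.
Qed.

Lemma fieldD n : {morph a n : x y / x + y}.
Proof. by move=> x y; rewrite -[x]scale1r (field_lin fa) !scale1r. Qed.

Lemma fieldZ n (k : C) x : a n (k *: x) = k *: a n x.
Proof. by rewrite -[k *: x]addr0 (field_lin fa) field0 addr0. Qed.

Lemma fieldN n x : a n (- x) = - a n x.
Proof. by rewrite -scaleN1r fieldZ scaleN1r. Qed.

Lemma fieldB n x y : a n (x - y) = a n x - a n y.
Proof. by rewrite fieldD fieldN. Qed.

Lemma field_sum n N (f : 'I_N -> M) : a n (\sum_(i < N) f i) = \sum_(i < N) a n (f i).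
Proof. exact: (big_morph _ (fieldD n) (field0 n)). Qed.

Lemma field_nsum n f : fs f -> a n (nsum f) = nsum (fun j => a n (f j)).
Proof. by apply: raddf_nsum; [exact: field0|exact: fieldD]. Qed.

Lemma field_trunc_nat w : exists N : nat, forall n, N%:Z <= n -> a n w = 0.
Proof. by have [N aN] := field_trunc fa w; exists `|N|%N => n le_n; apply: aN; lia. Qed.

Lemma field_fs (z : int) (g : nat -> int) w :
  (forall j, z + j%:Z <= g j) -> fs (fun j => a (g j) w).
Proof.
move=> gz; have [N aN] := field_trunc_nat w; exists (N + `|z|)%N => j le_j.
by apply: aN; have := gz j; lia.
Qed.

Lemma field_fs_in n f : fs f -> fs (fun j => a n (f j)).
Proof. by move=> [N fN]; exists N => j Nj; rewrite fN // field0. Qed.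

Lemma field_trunc_fin T (z : int) (f : nat -> M) : exists Q : int,
  forall t q, (t < T)%N -> Q <= q -> a (q + z - t%:Z) (f t) = 0.
Proof.
elim: T => [|T [Q hQ]]; first by exists 0.
have [N aN] := field_trunc fa (f T).
exists (Num.max Q (N - z + T%:Z)) => t q; rewrite ltnS ge_max leq_eqVlt.
move=> /orP[/eqP-> /andP[_ h]|lt_t /andP[h _]]; last exact: hQ.
by apply: aN; lia.
Qed.

End FieldTheory.

Lemma fsZ (s : nat -> C) (f : nat -> M) : fs f -> fs (fun j => s j *: f j).
Proof. by move=> [N fN]; exists N => j Nj; rewrite fN // scaler0. Qed.

Lemma fsB (f g : nat -> M) : fs f -> fs g -> fs (fun j => f j - g j).
Proof.
move=> ff fg; have [N [fN gN]] := fs2_common ff fg.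
by exists N => j Nj; rewrite fN // gN // subr0.
Qed.

Lemma fs2Z (s : nat -> nat -> C) (f : nat -> nat -> M) :
  fs2 f -> fs2 (fun i j => s i j *: f i j).
Proof. by move=> [N fN]; exists N => i j h; rewrite fN // scaler0. Qed.

(* [prod a b l] is the field a_(l) b, and [Rop a b l m n] is the right-hand side
   of the Jacobi identity for arbitrary fields [a] and [b]. *)
Definition prod a b l q w : M :=
  nsum (fun t => sbin l t *: (a (l - t%:Z) (b (q + t%:Z) w)
                              - (-1) ^ l *: b (q + l - t%:Z) (a t%:Z w))).

Definition Rop a b l m n w : M :=
  nsum (fun j => sbin l j *: (a (m + l - j%:Z) (b (n + j%:Z) w)
                              - (-1) ^ l *: b (n + l - j%:Z) (a (m + j%:Z) w))).

Lemma fs_Rop a b l m n w : isfield a -> isfield b ->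
  fs (fun j => sbin l j *: (a (m + l - j%:Z) (b (n + j%:Z) w)
                              - (-1) ^ l *: b (n + l - j%:Z) (a (m + j%:Z) w))).
Proof.
move=> fa fb; apply: fsZ; apply: fsB; last apply: fsZ.
  have [N bN] := field_fs fb w (fun j => lexx (n + j%:Z)).
  by exists N => j Nj; rewrite bN // field0.
have [N aN] := field_fs fa w (fun j => lexx (m + j%:Z)).
by exists N => j Nj; rewrite aN // field0.
Qed.

Lemma fs_prod a b l q w : isfield a -> isfield b ->
  fs (fun t => sbin l t *: (a (l - t%:Z) (b (q + t%:Z) w)
                              - (-1) ^ l *: b (q + l - t%:Z) (a t%:Z w))).
Proof.
move=> fa fb; have [N h] := fs_Rop l 0 q w fa fb.
by exists N => j /h; rewrite !add0r.
Qed.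

Lemma field_prod a b l : isfield a -> isfield b -> isfield (prod a b l).
Proof.
move=> fa fb; split.
  move=> q k x y; rewrite /prod scaler_nsum; last exact: (fs_prod _ _ _ fa fb).
  rewrite -nsumD; [|apply: fsZ; exact: (fs_prod _ _ _ fa fb)|exact: (fs_prod _ _ _ fa fb)].
  by apply: eq_nsum => t; rewrite !(field_lin fa, field_lin fb); lmod C.
(* For large q the modes of [b] kill w, and only finitely many of the vectors a_t w with t >= 0 are
   nonzero; so one bound on q serves all t. *)
move=> w; have [N bN] := field_trunc_nat fb w; have [T aT] := field_trunc_nat fa w.
have [Q hQ] := field_trunc_fin fb T l (fun t => a t%:Z w).
exists (Num.max Q N%:Z) => q; rewrite ge_max => /andP[hq1 hq2].
apply: nsum0 => t; rewrite bN; last by lia.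
rewrite field0 // sub0r; have [lt_tT|le_Tt] := ltnP t T; first by rewrite hQ // scaler0
  oppr0 scaler0.
by rewrite aT ?lez_nat // field0 // scaler0 oppr0 scaler0.
Qed.

(** The terms with t < i vanish. After the shift by i, trinomial revision pulls out [sbin l i], and
    the sums over antidiagonals are Vandermonde convolutions. This sum arises when a_t moves past
    another field. *)
Lemma nsum_sbin_bin l k (i : nat) (g : nat -> M) : fs g ->
  nsum (fun t : nat => nsum (fun j : nat => (sbin l t * bin t%:Z i * sbin k j) *: g (t +
    j)%N)) =
  sbin l i *: nsum (fun p => sbin (k + l - i%:Z) p *: g (i + p)%N).
Proof.
move=> [N gN].
have fg : fs2 (fun t j : nat => (sbin l t * bin t%:Z i * sbin k j) *: g (t + j)%N).
  by apply: fs2Z; apply: fs2_add; exists N => t j; exact: gN.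
rewrite (nsum_shift (i := i)); last first.
- by move=> t lt_ti; apply: nsum0 => j; rewrite binz_nat bin_small // mulr0 mul0r scale0r.
- exact: fs2_out fg.
rewrite scaler_nsum; last by apply: fsZ; apply: fs_shift; exists N.
rewrite (@nsum_diag _ (fun t j => (sbin l (i + t) * bin (i + t)%N%:Z i * sbin k j) *: g (i
  + t + j)%N)).
  apply: eq_nsum => p; rewrite scalerA -addrA [k + _]addrC -sbin_Vandermonde mulr_sumr
    scaler_suml.
  apply: eq_bigr => -[t /=]; rewrite ltnS => le_tp _.
  by rewrite sbin_mul mulrA -addnA subnKC.
apply: fs2Z; apply: fs2_add; exists N => t j le; apply: gN; lia.
Qed.

Lemma nsum_sbin_swap l k (i : nat) (g : nat -> M) : fs g ->
  nsum (fun t : nat => nsum (fun j : nat => (sbin l t * bin (l - t%:Z) i * sbin k j) *: g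
    (t + j)%N)) =
  ((-1) ^+ i * sbin l i) *: nsum (fun p => sbin (k + l - i%:Z) p *: g p).
Proof.
move=> [N gN].
rewrite nsum_diag; last by apply: fs2Z; apply: fs2_add; exists N => t j; exact: gN.
rewrite scaler_nsum; last by apply: fsZ; exists N.
apply: eq_nsum => p; rewrite scalerA -addrA [k + _]addrC -sbin_Vandermonde mulr_sumr
  scaler_suml.
apply: eq_bigr => -[t /=]; rewrite ltnS => le_tp _.
by rewrite sbin_swap subnKC //; congr (_ *: _); ring.
Qed.

End Fields.

Section IteratedSums.
Variables (C : numClosedFieldType) (M : lmodType C).

Lemma nsum2Z (k : C) (f : nat -> nat -> M) : fs2 f ->
  nsum (fun i => nsum (fun j => k *: f i j)) = k *: nsum (fun i => nsum (f i)).
Proof.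
move=> ff; rewrite scaler_nsum; last exact: fs2_out.
by apply: eq_nsum => i; rewrite scaler_nsum //; apply: fs2_in.
Qed.

Lemma nsum2_sum n (f : 'I_n -> nat -> nat -> M) : (forall i, fs2 (f i)) ->
  nsum (fun i => nsum (fun j => \sum_(k < n) f k i j)) =
  \sum_(k < n) nsum (fun i => nsum (f k i)).
Proof.
move=> ff; rewrite -nsum_sum => [|k]; last exact: fs2_out.
by apply: eq_nsum => i; rewrite -nsum_sum // => k; apply: fs2_in.
Qed.

Lemma m1zD (x y : int) : (-1) ^ (x + y) = (-1) ^ x * (-1) ^ y :> C.
Proof. by rewrite expfzDr // oppr_eq0 oner_eq0. Qed.

Lemma m1z_sq (x : int) : (-1) ^ x * (-1) ^ x = 1 :> C.
Proof. by rewrite -expfzMl mulrNN mulr1 exp1rz. Qed.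

Lemma m1zN (i : nat) : (-1) ^ (- i%:Z) = (-1) ^+ i :> C.
Proof. by rewrite -exprnN -exprVn invrN1. Qed.

End IteratedSums.

(** * Products of fields in the right-hand side of the Jacobi identity *)

Section Iterate.
Variables (C : numClosedFieldType) (M : lmodType C).
Local Notation bin := (zbin C).
Local Notation sbin := (sbin C).
Variables (a b c : int -> M -> M) (e : nat -> int -> M -> M) (J : nat).
Hypotheses (fa : isfield a) (fb : isfield b) (fc : isfield c).
Hypothesis fe : forall i, isfield (e i).
Hypothesis comm : forall (t s : int) x, a t (c s x) - c s (a t x) =
  \sum_(i < J) bin t i *: e i (t + s - i%:Z) x.

(* The product [prod a b l] against [c]: move every mode of [a] past [c], and
   regroup the commutator terms by the Vandermonde convolution. *)
Lemma Rop_prod l k m n w :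
  Rop (prod a b l) c k m n w =
  nsum (fun t : nat => sbin l t *: (a (l - t%:Z) (Rop b c k (m + t%:Z) n w)
              - (-1) ^ l *: Rop b c k (m + l - t%:Z) n (a t%:Z w)))
  - (-1) ^ l *: \sum_(i < J) sbin l i *: Rop b (e i) (k + l - i%:Z) m n w.
Proof.
(* [X] collects the terms in which the mode of [a] ends up leftmost, [Y] those in which it acts on w
   first; [Z1] and [Z2] are the commutators with [c] that the two moves cost. *)
pose X (j t : nat) : M := sbin l t *: a (l - t%:Z) (sbin k j *:
  (b (m + t%:Z + k - j%:Z) (c (n + j%:Z) w)
   - (-1) ^ k *: c (n + k - j%:Z) (b (m + t%:Z + j%:Z) w))).
pose Y (j t : nat) : M := (- (-1) ^ l * sbin l t) *: (sbin k j *: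
  (b (m + l - t%:Z + k - j%:Z) (c (n + j%:Z) (a t%:Z w))
   - (-1) ^ k *: c (n + k - j%:Z) (b (m + l - t%:Z + j%:Z) (a t%:Z w)))).
pose A (i s : nat) : M := b (m + k + l - s%:Z) (e i (n - i%:Z + s%:Z) w).
pose B (i s : nat) : M := e i (l + n + k - i%:Z - s%:Z) (b (m + s%:Z) w).
pose Z1 (i j t : nat) : M := (sbin l t * bin t%:Z i * sbin k j) *: A i (t + j)%N.
pose Z2 (i j t : nat) : M :=
  (sbin l t * bin (l - t%:Z) i * sbin k j) *: B i (t + j)%N.
have supA i : fs (A i).
  have [N eN] := field_fs (fe i) w (fun j => lexx (n - i%:Z + j%:Z)).
  by exists N => j Nj; rewrite /A eN // (field0 fb).
have supB i : fs (B i).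
  have [N bN] := field_fs fb w (fun j => lexx (m + j%:Z)).
  by exists N => j Nj; rewrite /B bN // (field0 (fe i)).
have fs2A i : fs2 (fun t j => Z1 i j t).
  have [N AN] := supA i; apply: fs2Z; apply: fs2_add.
  by exists N => t j; apply: AN.
have fs2B i : fs2 (fun t j => Z2 i j t).
  have [N BN] := supB i; apply: fs2Z; apply: fs2_add.
  by exists N => t j; apply: BN.
have fX : fs2 X.
  apply: fs2Z.
  have h1 : fs2 (fun j t => a (l - t%:Z) (b (m + t%:Z + k - j%:Z) (c (n + j%:Z) w))).
    apply: fs2_row.
      have [N cN] := field_fs fc w (fun j => lexx (n + j%:Z)).
      by exists N => j Nj t; rewrite cN // (field0 fb) (field0 fa).
    move=> j; have [|N bN] := @field_fs _ _ _ fb (m + k - j%:Z)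
      (fun t : nat => m + t%:Z + k - j%:Z) (c (n + j%:Z) w); first by move=> t; lia.
    by exists N => t Nt; rewrite bN // (field0 fa).
  have h2 : fs2 (fun j t : nat => a (l - t%:Z) (c (n + k - j%:Z) (b (m + t%:Z + j%:Z) w))).
    have [|N bN] := @field_fs _ _ _ fb m (fun t : nat => m + t%:Z) w; first by [].
    apply: fs2_add; exists N => j t le.
    have -> : m + t%:Z + j%:Z = m + (j + t)%N%:Z by lia.
    by rewrite bN // (field0 fc) (field0 fa).
  have [N1 H1] := h1; have [N2 H2] := h2.
  exists (maxn N1 N2) => j t; rewrite !geq_max => h.
  rewrite (fieldZ fa) (fieldB fa) (fieldZ fa) H1 ?H2 ?scaler0 ?subr0 ?scaler0 //.
    by case/orP: h => /andP[h h']; rewrite ?h ?h' ?orbT.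
  by case/orP: h => /andP[h h']; rewrite ?h ?h' ?orbT.
have fY : fs2 Y.
  apply: fs2Z; apply: fs2_col.
    have [|N aN] := @field_fs _ _ _ fa 0 (fun t : nat => t%:Z) w; first by move=> t; lia.
    exists N => t Nt j.
    by rewrite aN // (field0 fc) !(field0 fb) (field0 fc) scaler0 subr0 scaler0.
  by move=> t; apply: (fs_Rop k (m + l - t%:Z) n (a t%:Z w) fb fc).
have fZ1 : fs2 (fun j t => \sum_(i < J) Z1 i j t).
  elim: J => [|J' [N IH]]; first by exists 0%N => i j _; rewrite big_ord0.
  have [N' h] := fs2A J'; exists (maxn N N') => j t; rewrite !geq_max => h'.
  rewrite big_ord_recr /= IH ?add0r ?h //; case/orP: h' => /andP[h1 h2];
    by rewrite ?h1 ?h2 ?orbT.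
have fZ2 : fs2 (fun j t => \sum_(i < J) Z2 i j t).
  elim: J => [|J' [N IH]]; first by exists 0%N => i j _; rewrite big_ord0.
  have [N' h] := fs2B J'; exists (maxn N N') => j t; rewrite !geq_max => h'.
  rewrite big_ord_recr /= IH ?add0r ?h //; case/orP: h' => /andP[h1 h2];
    by rewrite ?h1 ?h2 ?orbT.
pose Z (j t : nat) : M :=
  (- (-1) ^ l) *: (\sum_(i < J) Z1 i j t) + (-1) ^ k *: \sum_(i < J) Z2 i j t.
have fZ : fs2 Z by apply: fs2D; apply: fs2Z.
have E j : sbin k j *: (prod a b l (m + k - j%:Z) (c (n + j%:Z) w)
              - (-1) ^ k *: c (n + k - j%:Z) (prod a b l (m + j%:Z) w)) =
    nsum (fun t => X j t + (Y j t + Z j t)).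
  rewrite /prod (field_nsum fc); last exact: (fs_prod _ _ _ fa fb).
  have f1 := fs_prod l (m + k - j%:Z) (c (n + j%:Z) w) fa fb.
  have f2 := field_fs_in fc (n + k - j%:Z) (fs_prod l (m + j%:Z) w fa fb).
  rewrite (scaler_nsum _ f2) -(nsumB f1 (fsZ _ f2)) (scaler_nsum _ (fsB f1 (fsZ _ f2))).
  apply: eq_nsum => t; rewrite /X /Y /Z.
  have c1 := comm t%:Z (n + j%:Z) w.
  have c2 := comm (l - t%:Z) (n + k - j%:Z) (b (m + j%:Z + t%:Z) w).
  have {}c1 : (sbin l t * sbin k j) *: b (m + k - j%:Z + l - t%:Z) (a t%:Z (c (n + j%:Z) w)) =
     (sbin l t * sbin k j) *: b (m + k - j%:Z + l - t%:Z) (c (n + j%:Z) (a t%:Z w))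
      + \sum_(i < J) Z1 i j t.
    rewrite -[a t%:Z (c _ _)](subrK (c (n + j%:Z) (a t%:Z w))) c1 (fieldD fb).
    rewrite (field_sum fb) scalerDr addrC scaler_sumr; congr (_ + _).
    apply: eq_bigr => i _; rewrite (fieldZ fb) scalerA /Z1 /A PoszD.
    congr (_ *: b _ (e i _ _)); [ring|lia|lia].
  have {}c2 : (sbin l t * sbin k j) *: c (n + k - j%:Z) (a (l - t%:Z) (b (m + j%:Z + t%:Z) w)) =
     (sbin l t * sbin k j) *: a (l - t%:Z) (c (n + k - j%:Z) (b (m + j%:Z + t%:Z) w))
      - \sum_(i < J) Z2 i j t.
    rewrite -[a (l - _) (c _ _)](subrK (c (n + k - j%:Z) (a (l - t%:Z) (b (m + j%:Z + t%:Z)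
      w)))).
    rewrite c2 scalerDr [RHS]addrAC scaler_sumr -[LHS]add0r; congr (_ + _).
    rewrite -sumrB big1 // => i _; rewrite scalerA /Z2 /B PoszD.
    apply/eqP; rewrite subr_eq0; apply/eqP; congr (_ *: e i _ (b _ _)); [ring|lia|lia].
  rewrite !(fieldB fc, fieldZ fc, fieldB fa, fieldZ fa).
  have -> : m + t%:Z + k - j%:Z = m + k - j%:Z + t%:Z by lia.
  have -> : m + t%:Z + j%:Z = m + j%:Z + t%:Z by lia.
  have -> : m + l - t%:Z + k - j%:Z = m + k - j%:Z + l - t%:Z by lia.
  have -> : m + l - t%:Z + j%:Z = m + j%:Z + l - t%:Z by lia.
  have -> : \sum_(i < J) Z1 i j t = (sbin l t * sbin k j) *: b (m + k - j%:Z + l - t%:Z) (a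
    t%:Z (c (n + j%:Z) w)) - (sbin l t * sbin k j) *: b (m + k - j%:Z + l - t%:Z) (c (n +
      j%:Z) (a t%:Z w)) by rewrite c1 addrC addKr.
  have -> : \sum_(i < J) Z2 i j t = (sbin l t * sbin k j) *: a (l - t%:Z) (c (n + k - j%:Z)
    (b (m + j%:Z + t%:Z) w)) - (sbin l t * sbin k j) *: c (n + k - j%:Z) (a (l - t%:Z) (b
      (m + j%:Z + t%:Z) w)) by rewrite c2 opprB addrC subrK.
  by lmod C.
rewrite {1}/Rop (eq_nsum E) nsum2D //; last exact: fs2D.
rewrite nsum2D // nsum_exchange // [X in _ + (X + _)]nsum_exchange //.
rewrite addrA -nsumD; [|exact/fs2_out/fs2_tr|exact/fs2_out/fs2_tr].
congr (_ + _).
  apply: eq_nsum => t; rewrite /Rop [in RHS]scalerBr; congr (_ + _).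
    rewrite (field_nsum fa) ?scaler_nsum //; last exact: (fs_Rop _ _ _ _ fb fc).
    by apply: (field_fs_in fa); apply: (fs_Rop _ _ _ _ fb fc).
  rewrite -scalerN -scaleNr scalerA scaler_nsum; last exact: (fs_Rop _ _ _ _ fb fc).
  by apply: eq_nsum => j; congr (_ *: _); rewrite mulrC.
rewrite nsum2D; [|exact: fs2Z|exact: fs2Z].
rewrite !nsum2Z // (nsum_exchange fZ1) (nsum_exchange fZ2).
rewrite !nsum2_sum; [|by move=> i; apply: fs2B|by move=> i; apply: fs2A].
rewrite !scaler_sumr -big_split -sumrN; apply: eq_bigr => i _ /=.
rewrite (nsum_sbin_bin l k i (supA i)) (nsum_sbin_swap l k i (supB i)).
have g1 : fs (fun p : nat => sbin (k + l - i%:Z) p *: b (m + (k + l - i%:Z) - p%:Z) (e i (n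
  + p%:Z) w)).
  have [N AN] := supA i; exists N => p Np; rewrite -(_ : A i (i + p)%N = b _ _).
    by rewrite AN ?scaler0 //; lia.
  by rewrite /A PoszD; congr (b _ (e i _ _)); lia.
have g2 : fs (fun p : nat => sbin (k + l - i%:Z) p *: e i (n + (k + l - i%:Z) - p%:Z) (b (m
  + p%:Z) w)).
  have [N BN] := supB i; exists N => p Np; rewrite -(_ : B i p = e i _ _).
    by rewrite BN ?scaler0.
  by rewrite /B; congr (e i _ _); lia.
have -> : Rop b (e i) (k + l - i%:Z) m n w =
    nsum (fun p : nat => sbin (k + l - i%:Z) p *: A i (i + p)%N)
    - (-1) ^ (k + l - i%:Z) *: nsum (fun p : nat => sbin (k + l - i%:Z) p *: B i p).
  have -> : (fun p : nat => sbin (k + l - i%:Z) p *: A i (i + p)%N) =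
    (fun p : nat => sbin (k + l - i%:Z) p *: b (m + (k + l - i%:Z) - p%:Z) (e i (n + p%:Z) w)).
    by apply/funext => p; rewrite /A PoszD; congr (_ *: b _ (e i _ _)); lia.
  have -> : (fun p : nat => sbin (k + l - i%:Z) p *: B i p) =
    (fun p : nat => sbin (k + l - i%:Z) p *: e i (n + (k + l - i%:Z) - p%:Z) (b (m + p%:Z) w)).
    by apply/funext => p; rewrite /B; congr (_ *: e i _ _); lia.
  rewrite scaler_nsum // -nsumB //; last exact: (fsZ (fun=> _) g2).
  by apply: eq_nsum => p; lmod C.
have S : (-1) ^ l * (-1) ^ (k + l - i%:Z) = (-1) ^ k * (-1) ^+ i :> C.
  by rewrite -addrA !m1zD m1zN mulrCA [X in _ * X]mulrA m1z_sq mul1r.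
set P := nsum _; set Q := nsum _.
transitivity ((- (-1) ^ l * sbin l i) *: P +
  ((-1) ^ l * (-1) ^ (k + l - i%:Z) * sbin l i) *: Q); last by lmod C.
by rewrite S; lmod C.
Qed.

End Iterate.

(** * State-field maps and the Jacobi identity *)

Section StateField.
Variables (C : numClosedFieldType).
Local Notation bin := (zbin C).
Local Notation sbin := (sbin C).

(** The data from which all else is derived. Of the Jacobi identity only the iterate formula for
    alpha is demanded ([sf_alpha]); when the modes of alpha generate V from [vac], it determines
    [Y]. *)
Record state_field (V M : lmodType C) (vac : V) (alV : int -> V -> V)
    (alM : int -> M -> M) (Y : V -> int -> M -> M) : Prop := {
  sf_boson : isfield alM;
  sf_heis : forall (m n : int) w, alM m (alM n w) - alM n (alM m w) =
    (if m + n == 0 then m%:~R else 0) *: w;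
  sf_field : forall u, isfield (Y u);
  sf_linear : forall (k : C) u v n w, Y (k *: u + v) n w = k *: Y u n w + Y v n w;
  sf_vac : forall n w, Y vac n w = if n == -1 then w else 0;
  sf_alpha : forall l u n w, Y (alV l u) n w = prod alM (Y u) l n w
}.

Definition generated_by (V : lmodType C) (vac : V) (alV : int -> V -> V) : Prop :=
  forall P : V -> Prop, subspace P -> P vac ->
    (forall n u, P u -> P (alV n u)) -> forall u, P u.

Lemma bin_diag (t : int) (j : nat) : t%:~R * bin (t - 1) j = j.+1%:R * bin t j.+1.
Proof.
apply: (mulIf (fact_neq0 C j)); rewrite -mulrA binz_fact.
have -> : j.+1%:R * bin t j.+1 * j`!%:R = bin t j.+1 * (j.+1)`!%:R.
  by rewrite factS natrM; ring.
rewrite binz_fact big_ord_recl /= subr0.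
by congr (_ * _); apply: eq_bigr => i _; congr (_%:~R); rewrite /bump /=; lia.
Qed.

Section Commutator.
Variables (V M : lmodType C) (vac : V) (alV : int -> V -> V) (alM : int -> M -> M).
Variable Y : V -> int -> M -> M.
Hypothesis sf : state_field vac alV alM Y.
Local Notation fM := (sf_boson sf).
Local Notation fY := (sf_field sf).

Lemma sfD u v n w : Y (u + v) n w = Y u n w + Y v n w.
Proof. by rewrite -[u]scale1r (sf_linear sf) !scale1r. Qed.

Lemma sf0 n w : Y 0 n w = 0.
Proof. by apply: (addrI (Y 0 n w)); rewrite -sfD !addr0. Qed.

Lemma sfZ (k : C) u n w : Y (k *: u) n w = k *: Y u n w.
Proof. by rewrite -[k *: u]addr0 (sf_linear sf) sf0 addr0. Qed.

Lemma sfN u n w : Y (- u) n w = - Y u n w.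
Proof. by rewrite -scaleN1r sfZ scaleN1r. Qed.

Lemma sfB u v n w : Y (u - v) n w = Y u n w - Y v n w.
Proof. by rewrite sfD sfN. Qed.

Lemma sf_nsum f n w : fs f -> Y (nsum f) n w = nsum (fun j => Y (f j) n w).
Proof.
by apply: (@raddf_nsum V M (fun u => Y u n w)); [exact: sf0|move=> u v; exact: sfD].
Qed.

Lemma sf_sum N (f : 'I_N -> V) n w : Y (\sum_(i < N) f i) n w = \sum_(i < N) Y (f i) n w.
Proof.
exact: (@big_morph _ _ (fun u => Y u n w) _ _ _ _ (fun u v => sfD u v n w) (sf0 n w)).
Qed.

Hypothesis fV : isfield alV.
Hypothesis heisV : forall (m n : int) w, alV m (alV n w) - alV n (alV m w) =
    (if m + n == 0 then m%:~R else 0) *: w.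
Hypothesis ann : forall i : nat, alV i%:Z vac = 0.
Hypothesis gen : generated_by vac alV.

(** The commutator formula, truncated at every large J, so that the bounds belonging to different
    states can be raised to a common one. *)
Definition commutes_with (v : V) : Prop := exists J0 : nat, forall J, (J0 <= J)%N ->
  forall (t s : int) x, alM t (Y v s x) - Y v s (alM t x) =
    \sum_(i < J) bin t i *: Y (alV i%:Z v) (t + s - i%:Z) x.

Lemma nsum_zb (g : nat -> C) (z : int) (w : M) (h : nat -> M) :
  (forall j, h j = if z == j%:Z then g j *: w else 0) -> nsum h = zb g z *: w.
Proof.
case: z => z hz /=; last by rewrite scale0r nsum0 // => j; rewrite hz.
rewrite (@nsum1 _ z) ?hz ?eqxx // => j jz; rewrite hz eqz_nat.
by rewrite eq_sym (negPf jz).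
Qed.

(** Moving alpha(t) through the product of alpha(z) and Y(v, z) gives the inductive terms [F] and
    the central terms [G1] and [G2]. By [sbin_delta] the central terms add up to a multiple of one
    mode of [v]; the same multiple arises on the other side when alpha(j) alpha(l) v is reordered to
    alpha(l) alpha(j) v. *)
Lemma commutes_with_alpha l v : commutes_with v -> commutes_with (alV l v).
Proof.
(* J exceeds |l|, so that j = -l, the only index at which alpha(j) and alpha(l) can fail to commute,
   is covered. *)
move=> [J0 IH]; exists (maxn J0 `|l|.+1) => J; rewrite geq_max => /andP[leJ lt_lJ] t s x.
have {}IH := IH J leJ.
rewrite !(sf_alpha sf) {1 2}/prod (field_nsum fM); last exact: (fs_prod _ _ _ fM (fY v)).
rewrite -nsumB; [|exact: (field_fs_in fM _ (fs_prod _ _ _ fM (fY v)))|exact: (fs_prod _ _ _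
  fM (fY v))].
pose D (j : nat) := Y (alV j%:Z v).
pose F (j i : nat) : M := sbin l i *: (alM (l - i%:Z) (D j (t + s - j%:Z + i%:Z) x) -
   (-1) ^ l *: D j (t + s - j%:Z + l - i%:Z) (alM i%:Z x)).
pose G1 (i : nat) : M := (if t + l == i%:Z then sbin l i * t%:~R else 0) *: Y v (s + t + l) x.
pose G2 (i : nat) : M := (if - t == i%:Z then sbin l i * t%:~R else 0) *: Y v (s + t + l) x.
rewrite (@eq_nsum _ _ (fun i => (G1 i - (-1) ^ l *: G2 i) + \sum_(j < J) bin t j *: F j
  i)); last first.
  move=> i.
  have c1 := IH t (s + i%:Z) x.
  have c2 := IH t (s + l - i%:Z) (alM i%:Z x).
  have h1 := sf_heis sf t (l - i%:Z) (Y v (s + i%:Z) x).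
  have h2 := sf_heis sf t i%:Z x.
  have -> : G1 i = sbin l i *: (alM t (alM (l - i%:Z) (Y v (s + i%:Z) x)) - alM (l - i%:Z)
    (alM t (Y v (s + i%:Z) x))).
    rewrite h1 /G1; have [E|nE] := eqVneq (t + l) i%:Z.
      rewrite (_ : t + _ = 0) ?eqxx; last by lia.
      by rewrite (_ : s + t + l = s + i%:Z) ?scalerA //; lia.
    by rewrite (_ : (t + (l - i%:Z) == 0) = false) ?scale0r ?scaler0 //; apply/eqP;
      move/eqP: nE; lia.
  have -> : G2 i = sbin l i *: Y v (s + l - i%:Z) (alM t (alM i%:Z x) - alM i%:Z (alM t x)).
    rewrite h2 /G2 (fieldZ (fY v)); have [E|nE] := eqVneq (- t) i%:Z.
      rewrite (_ : t + i%:Z == 0); last by apply/eqP; lia.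
      by rewrite (_ : s + t + l = s + l - i%:Z) ?scalerA //; lia.
    by rewrite (_ : (t + i%:Z == 0) = false) ?scale0r ?scaler0 //; apply/eqP; move/eqP: nE; lia.
  have -> : \sum_(j < J) bin t j *: F j i = sbin l i *: (alM (l - i%:Z) (alM t (Y v (s +
    i%:Z) x) - Y v (s + i%:Z) (alM t x)) - (-1) ^ l *: (alM t (Y v (s + l - i%:Z) (alM i%:Z
      x)) - Y v (s + l - i%:Z) (alM t (alM i%:Z x)))).
    rewrite c1 c2 (field_sum fM) scaler_sumr -sumrB scaler_sumr; apply: eq_bigr => j _.
    rewrite /F (fieldZ fM) (_ : t + s - j%:Z + i%:Z = t + (s + i%:Z) - j%:Z); last by lia.
    rewrite (_ : t + s - j%:Z + l - i%:Z = t + (s + l - i%:Z) - j%:Z); last by lia.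
    by rewrite /D; lmod C.
  rewrite !(fieldB fM, fieldB (fY v), fieldZ fM); lmod C.
have fF j : fs (F j) by apply: (fs_prod l (t + s - j%:Z) x fM (fY _)).
have fG1 : fs G1.
  exists `|t + l|.+1 => i lt_i; rewrite /G1 (_ : (_ == _) = false) ?scale0r //.
  by apply/eqP => E; lia.
have fG2 : fs G2.
  exists `|t|.+1 => i lt_i; rewrite /G2 (_ : (_ == _) = false) ?scale0r //.
  by apply/eqP => E; lia.
rewrite nsumD; [|exact: (fsB fG1 (fsZ (fun=> _) fG2))|by apply: fs_sum => j; apply: (fsZ
  (fun=> _))].
rewrite nsumB //; last exact: (fsZ (fun=> _) fG2).
rewrite -scaler_nsum // nsum_sum; last by move=> j; apply: (fsZ (fun=> _)).
rewrite (@nsum_zb (fun i => sbin l i * t%:~R) (t + l) (Y v (s + t + l) x)); last first.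
  by move=> j; rewrite /G1; case: ifP; rewrite ?scale0r.
rewrite (@nsum_zb (fun i => sbin l i * t%:~R) (- t) (Y v (s + t + l) x)); last first.
  by move=> j; rewrite /G2; case: ifP; rewrite ?scale0r.
have -> : \sum_(j < J) bin t j *: Y (alV j%:Z (alV l v)) (t + s - j%:Z) x =
  \sum_(j < J) nsum (fun i => bin t j *: F j i) - (l%:~R * zb (bin t) (- l)) *: Y v (s + t
    + l) x.
  transitivity (\sum_(j < J) (nsum (fun i => bin t j *: F j i) -
     bin t j *: ((if l + j%:Z == 0 then l%:~R else 0) *: Y v (t + s - j%:Z) x))).
    apply: eq_bigr => j _; rewrite -scaler_nsum // -scalerBr; congr (_ *: _).
    have -> : nsum (F j) = Y (alV l (alV j%:Z v)) (t + s - j%:Z) x by rewrite (sf_alpha sf).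
    by rewrite -sfZ -sfB -heisV; congr (Y _ _ _); rewrite opprB addrC subrK.
  rewrite sumrB; congr (_ - _); rewrite -(nsumE (f := fun j : nat => bin t j *: ((if l +
    j%:Z == 0 then l%:~R else 0) *: Y v (t + s - j%:Z) x))) => [|j Jj]; last first.
    by rewrite (_ : (_ == _) = false) ?scale0r ?scaler0 //; apply/eqP; lia.
  rewrite mulrC -[_ * _]/(_ * _) (@nsum_zb (fun j => bin t j * l%:~R) (- l) (Y v (s + t +
    l) x)).
    by congr (_ *: _); case: (- l) => //= ?; rewrite mul0r.
  move=> j; have [E|nE] := eqVneq (- l) j%:Z.
    rewrite (_ : l + j%:Z == 0); last by apply/eqP; lia.
    by rewrite scalerA (_ : s + t + l = t + s - j%:Z) //; lia.
  by rewrite (_ : (_ == _) = false) ?scale0r ?scaler0 //; apply/eqP; move/eqP: nE; lia.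
rewrite addrC; congr (_ + _).
have zbM (z : int) : zb (fun i => sbin l i * t%:~R) z = zb (sbin l) z * t%:~R.
  by case: z => //= _; rewrite mul0r.
rewrite !zbM scalerA -scalerBl -scaleNr mulrA -mulrBl; congr (_ *: _).
(* With m = t - 1 the delta identity evaluates the central terms; for l = -(r + 1) there remains t
   C(t - 1, r) = (r + 1) C(t, r + 1). *)
have := sbin_delta C l (t - 1).
have -> : t - 1 + l + 1 = t + l by lia.
have -> : -1 - (t - 1) = - t by lia.
move=> ->; case: l {IH D F G1 G2 fF fG1 fG2 lt_lJ zbM} => [[|r]|r].
- by rewrite /= !mul0r oppr0.
- by rewrite [zb _ (- 1 - _)]zb_neg // [zb _ (- _)]zb_neg // mul0r mulr0 oppr0.
rewrite (@zb_pos _ _ _ r); last by lia.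
rewrite (@zb_pos _ _ _ r.+1); last by lia.
by rewrite mulrC bin_diag NegzE rmorphN /= mulNr opprK.
Qed.

Lemma state_field_comm v : commutes_with v.
Proof.
apply: gen v; last by move=> n u; apply: commutes_with_alpha.
  split.
    exists 0%N => J _ t s x; rewrite big1 ?sf0 ?(field0 fM) ?subrr // => i _.
    by rewrite (field0 fV) sf0 scaler0.
  move=> k u v [N hu] [N' hv]; exists (maxn N N') => J; rewrite geq_max.
  move=> /andP[/hu{}hu /hv{}hv] t s x.
  rewrite !(sf_linear sf) (field_lin fM).
  rewrite (_ : _ - _ = k *: (alM t (Y u s x) - Y u s (alM t x)) + (alM t (Y v s x) - Y v s
    (alM t x))); last by lmod C.
  rewrite hu hv scaler_sumr -big_split; apply: eq_bigr => i _.
  by rewrite (field_lin fV) (sf_linear sf) /=; lmod C.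
exists 0%N => J _ t s x; rewrite big1 => [|i _]; last by rewrite ann sf0 scaler0.
by rewrite !(sf_vac sf); case: ifP; rewrite ?(field0 fM) subrr.
Qed.

End Commutator.
End StateField.

(** * The Jacobi identity for all states *)

Section Jacobi.
Variables (C : numClosedFieldType).
Local Notation bin := (zbin C).
Local Notation sbin := (sbin C).
Variables (V M : lmodType C) (vac : V) (alV : int -> V -> V) (alM : int -> M -> M).
Variables (YV : V -> int -> V -> V) (YM : V -> int -> M -> M).
Hypotheses (sfV : state_field vac alV alV YV) (sfM : state_field vac alV alM YM).
Hypothesis ann : forall i : nat, alV i%:Z vac = 0.
Hypothesis gen : generated_by vac alV.

Local Notation fV := (sf_boson sfV).
Local Notation fM := (sf_boson sfM).

Definition jacobi_at (u : V) : Prop := forall (v : V) (w : M) (l m n : int),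
  nsum (fun i : nat => bin m i *: YM (YV u (l + i%:Z) v) (m + n - i%:Z) w) =
  Rop (YM u) (YM v) l m n w.

Lemma fs_states u v (l : int) (g : nat -> int) (s : nat -> C) w :
  fs (fun i : nat => s i *: YM (YV u (l + i%:Z) v) (g i) w).
Proof.
have [N uN] := field_fs (sf_field sfV u) v (fun j => lexx (l + j%:Z)).
by exists N => i Ni; rewrite uN // (sf0 sfM) scaler0.
Qed.

(** The modes of the identity field vanish except for one, so each sum has at most one nonzero term.
    All of them are multiples of the same mode of [v], and their coefficients satisfy
    [sbin_delta]. *)
Lemma jacobi_vac : jacobi_at vac.
Proof.
move=> v w l m n.
have eqz (x y : int) : x = y -> (x == y) = true by move=> ->; rewrite eqxx.
have neqz (x y : int) : x <> y -> (x == y) = false by move=> h; apply/eqP.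
rewrite (nsum_zb (g := bin m) (z := - 1 - l) (w := YM v (m + n + l + 1) w)); last first.
  move=> j; rewrite (sf_vac sfV); have [E|nE] := eqVneq (l + j%:Z) (- 1).
    rewrite [in RHS]eqz; last by lia.
    by rewrite (_ : m + n - j%:Z = m + n + l + 1) //; lia.
  by rewrite (sf0 sfM) scaler0 neqz //; move/eqP: nE; lia.
rewrite -sbin_delta scalerBl -scalerA /Rop.
pose F1 (j : nat) : M := (if m + l + 1 == j%:Z then sbin l j else 0) *: YM v (m + n + l + 1) w.
pose F2 (j : nat) : M := (if - 1 - m == j%:Z then sbin l j else 0) *: YM v (m + n + l + 1) w.
have fF1 : fs F1.
  by exists (absz (m + l + 1)%R).+1 => j lt_j; rewrite /F1 neqz ?scale0r //; lia.
have fF2 : fs F2.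
  by exists (absz (- 1 - m)%R).+1 => j lt_j; rewrite /F2 neqz ?scale0r //; lia.
rewrite (@eq_nsum _ _ (fun j => F1 j - (-1) ^ l *: F2 j)).
  rewrite (nsumB fF1 (fsZ (fun=> _) fF2)) -(scaler_nsum _ fF2).
  congr (_ - _ *: _); apply/esym/nsum_zb => j.
    by rewrite /F1; case: ifP; rewrite ?scale0r.
  by rewrite /F2; case: ifP; rewrite ?scale0r.
move=> j; rewrite !(sf_vac sfM) scalerBr /F1 /F2; congr (_ - _).
  have [E|nE] := eqVneq (m + l - j%:Z) (- 1).
    by rewrite eqz; [congr (_ *: YM v _ w); lia|lia].
  by rewrite neqz ?scale0r ?scaler0 //; move/eqP: nE; lia.
rewrite scalerA mulrC -scalerA; congr (_ *: _).
have [E|nE] := eqVneq (m + j%:Z) (- 1).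
  by rewrite eqz; [congr (_ *: YM v _ w); lia|lia].
by rewrite (field0 (sf_field sfM v)) neqz ?scale0r ?scaler0 //; move/eqP: nE; lia.
Qed.

Lemma jacobi_lin (k : C) u1 u2 : jacobi_at u1 -> jacobi_at u2 -> jacobi_at (k *: u1 + u2).
Proof.
move=> J1 J2 v w l m n.
have -> : Rop (YM (k *: u1 + u2)) (YM v) l m n w =
    k *: Rop (YM u1) (YM v) l m n w + Rop (YM u2) (YM v) l m n w.
  have f1 := fs_Rop l m n w (sf_field sfM u1) (sf_field sfM v).
  have f2 := fs_Rop l m n w (sf_field sfM u2) (sf_field sfM v).
  rewrite /Rop (scaler_nsum _ f1) -(nsumD (fsZ (fun=> k) f1) f2).
  apply: eq_nsum => j; rewrite !(sf_linear sfM) (field_lin (sf_field sfM v)); lmod C.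
rewrite -J1 -J2 scaler_nsum; last exact: fs_states.
rewrite -nsumD; [|apply: (fsZ (fun=> k)); exact: fs_states|exact: fs_states].
by apply: eq_nsum => j; rewrite (sf_linear sfV) (sf_linear sfM); lmod C.
Qed.

(** With t + s as new summation index, [sbin_mul] turns the product of the two [sbin] into one that
    depends on t through an ordinary binomial only; the sum over t is then a Vandermonde
    convolution. *)
Lemma trinomial_revision (m l : int) (p : nat) (H : nat -> M) : fs H ->
  \sum_(t < p.+1) nsum (fun s : nat =>
    (bin m (p - t) * (sbin l t * sbin (l - t%:Z) s)) *: H (t + s)%N) =
  nsum (fun s : nat => (sbin l s * bin (m + s%:Z) p) *: H s).
Proof.
move=> fH.
transitivity (\sum_(t < p.+1) nsum (fun s : nat =>
    (bin m (p - t) * (sbin l s * bin s%:Z t)) *: H s)).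
  apply: eq_bigr => t _; rewrite [RHS](nsum_shift (i := t)).
  - by apply: eq_nsum => s; rewrite sbin_mul.
  - exact: fsZ.
  - by move=> s lt_st; rewrite binz_nat bin_small // !mulr0 scale0r.
rewrite -nsum_sum => [|t]; last exact: fsZ.
apply: eq_nsum => s; rewrite -scaler_suml addrC -binz_Vandermonde mulr_sumr.
by congr (_ *: _); apply: eq_bigr => t _; ring.
Qed.

Lemma trinomial_revision_swap (m l : int) (p : nat) (H : nat -> M) : fs H ->
  \sum_(t < p.+1) nsum (fun s : nat =>
    (bin m (p - t) * ((-1) ^+ t * (sbin l t * sbin (l - t%:Z) s))) *: H s) =
  nsum (fun s : nat => (sbin l s * bin (m + l - s%:Z) p) *: H s).
Proof.
move=> fH; rewrite -nsum_sum => [|t]; last exact: fsZ.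
apply: eq_nsum => s; rewrite -scaler_suml -addrA [m + _]addrC -binz_Vandermonde mulr_sumr.
by congr (_ *: _); apply: eq_bigr => t _; rewrite -sbin_swap; ring.
Qed.

(** [Rop_prod] reduces the right-hand side to expressions in Y(u, z), where the induction hypothesis
    applies twice: to [v] for the main terms, and to the states alpha(i) v for the commutator terms.
    This is why [jacobi_at] quantifies over [v]. *)
Lemma jacobi_alpha l u : jacobi_at u -> jacobi_at (alV l u).
Proof.
move=> IH v w k m n.
have [J0 comm] := state_field_comm sfM fV (sf_heis sfV) ann gen v.
have [J1 aN] := field_trunc_nat fV v.
(* Beyond J also alpha(j) v = 0, so that the finite commutator sum is the full sum over t in the
   iterate formula. *)
pose J := maxn J0 J1.
have {}comm := comm J (leq_maxl _ _).
have aJ (j : nat) : (J <= j)%N -> alV j%:Z v = 0.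
  by rewrite geq_max => /andP[_ h]; apply: aN.
have -> : YM (alV l u) = prod alM (YM u) l.
  by apply/funext => q; apply/funext => x; apply: (sf_alpha sfM).
rewrite (Rop_prod (e := fun j => YM (alV j%:Z v)) fM (sf_field sfM u) (sf_field sfM v) (fun
  j => sf_field sfM _) comm).
(* [D p] is the field of the state u_(k+p) v. In the iterate formula for alpha(l) u, [S1] comes from
   the terms where alpha acts after u, [S2] from those where it acts on [v] first. *)
pose D (p : nat) := YM (YV u (k + p%:Z) v).
have fD p : isfield (D p) := sf_field sfM _.
have [P DP] : exists P : nat, forall p, (P <= p)%N -> forall q x, D p q x = 0.
  have [P uP] := field_fs (sf_field sfV u) v (fun j => lexx (k + j%:Z)).
  by exists P => p Pp q x; rewrite /D uP // (sf0 sfM).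
pose S1 (i t : nat) : M := (bin m i * sbin l t) *: prod alM (D (i + t)%N) (l - t%:Z) (m + n
  - i%:Z) w.
pose S2 (i t : nat) : M := (bin m i * sbin l t) *: YM (YV u (k + l - t%:Z + i%:Z) (alV t%:Z
  v)) (m + n - i%:Z) w.
have fS1 : fs2 S1.
  apply: fs2Z; apply: fs2_add; exists P => i t le; apply: nsum0 => s.
  by rewrite !(DP _ le) (field0 fM) scaler0 subrr scaler0.
have fS2 : fs2 S2.
  apply: fs2_col.
    by exists J => t Jt i; rewrite /S2 aJ // (field0 (sf_field sfV u)) (sf0 sfM) scaler0.
  by move=> t; apply: fs_states.
have fS2' : fs2 (fun i t => - (-1) ^ l *: S2 i t) by apply: (fs2Z (fun _ _ => _)).
rewrite (@eq_nsum _ _ (fun i => nsum (fun t => S1 i t + - (-1) ^ l *: S2 i t))); last first.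
  move=> i; rewrite (sf_alpha sfV) /prod (sf_nsum sfM); last exact: (fs_prod _ _ _ fV
    (sf_field sfV u)).
  rewrite scaler_nsum; last first.
    have [N fN] := fs_prod l (k + i%:Z) v fV (sf_field sfV u).
    by exists N => t Nt; rewrite fN // (sf0 sfM).
  apply: eq_nsum => t; rewrite (sfZ sfM) (sfB sfM) (sfZ sfM) (sf_alpha sfM) /S1 /S2 /D.
  rewrite (_ : k + (i + t)%N%:Z = k + i%:Z + t%:Z); last by lia.
  rewrite (_ : k + i%:Z + l - t%:Z = k + l - t%:Z + i%:Z); last by lia.
  by lmod C.
rewrite (nsum2D fS1 fS2') (nsum2Z _ fS2) scaleNr; congr (_ - _); last first.
  congr (_ *: _); rewrite nsum_exchange // (nsumE (N := J)) => [|t Jt]; last first.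
    by apply: nsum0 => i; rewrite /S2 aJ // (field0 (sf_field sfV u)) (sf0 sfM) scaler0.
  apply: eq_bigr => t _; rewrite -IH scaler_nsum; last exact: fs_states.
  by apply: eq_nsum => i; rewrite /S2 scalerA mulrC.
pose H1 (p s : nat) : M := alM (l - s%:Z) (D p (m + n - p%:Z + s%:Z) w).
pose H2 (p s : nat) : M := D p (m + n + l - p%:Z - s%:Z) (alM s%:Z w).
have fH1 p : fs (H1 p).
  have [N DN] := field_fs (fD p) w (fun j => lexx (m + n - p%:Z + j%:Z)).
  by exists N => j Nj; rewrite /H1 DN // (field0 fM).
have fH2 p : fs (H2 p).
  have [N wN] := field_trunc_nat fM w.
  by exists N => j Nj; rewrite /H2 wN // (field0 (fD p)).
pose R1 (p s : nat) : M := (sbin l s * bin (m + s%:Z) p) *: H1 p s.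
pose R2 (p s : nat) : M := (sbin l s * bin (m + l - s%:Z) p) *: H2 p s.
have fR1 p : fs (R1 p) by apply: fsZ.
have fR2 p : fs (R2 p) by apply: fsZ.
transitivity (\sum_(p < P) (nsum (R1 p) - (-1) ^ l *: nsum (R2 p))).
  rewrite nsum_exchange // nsum_diag; last exact: fs2_tr.
  rewrite (nsumE (N := P)) => [|p Pp]; last first.
    apply: big1 => -[t /=]; rewrite ltnS => le_tp _; 
    rewrite /S1 [prod _ _ _ _ _]nsum0 ?scaler0 // => s; rewrite subnK // !(DP _ Pp) (field0
      fM) scaler0 subrr scaler0 //.
  apply: eq_bigr => p _; rewrite /R1 /R2 -trinomial_revision // -trinomial_revision_swap //.
  rewrite scaler_sumr -sumrB; apply: eq_bigr => -[t /=]; rewrite ltnS => le_tp _.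
  have fA : fs (fun s => (bin m (p - t) * (sbin l t * sbin (l - t%:Z) s)) *: H1 p (t + s)%N).
    by apply: fsZ; apply: fs_shift.
  have fB : fs (fun s => (bin m (p - t) * ((-1) ^+ t * (sbin l t * sbin (l - t%:Z) s))) *:
    H2 p s).
    exact: fsZ.
  rewrite (scaler_nsum _ fB) -(nsumB fA (fsZ (fun=> _) fB)) /S1 subnK //.
  rewrite scaler_nsum; last exact: (fs_prod _ _ _ fM (fD p)).
  apply: eq_nsum => s; rewrite /H1 /H2 PoszD m1zD m1zN.
  rewrite (_ : l - (t%:Z + s%:Z) = l - t%:Z - s%:Z); last by lia.
  rewrite (_ : m + n - p%:Z + (t%:Z + s%:Z) = m + n - (p - t)%N%:Z + s%:Z); last by lia.
  rewrite (_ : m + n + l - p%:Z - s%:Z = m + n - (p - t)%N%:Z + (l - t%:Z) - s%:Z); last by lia.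
  by lmod C.
have RopE q z : Rop (YM u) (YM v) k q n z = \sum_(p < P) bin q p *: D p (q + n - p%:Z) z.
  by rewrite -IH (nsumE (N := P)) // => p Pp; rewrite -/(D p) DP ?scaler0.
rewrite (@eq_nsum _ _ (fun s => \sum_(p < P) (R1 p s - (-1) ^ l *: R2 p s))).
  rewrite nsum_sum => [|p]; last exact: (fsB (fR1 p) (fsZ (fun=> _) (fR2 p))).
  apply: eq_bigr => p _; rewrite (nsumB (fR1 p) (fsZ (fun=> _) (fR2 p))).
  by rewrite -(scaler_nsum _ (fR2 p)).
move=> s; rewrite !RopE // (field_sum fM) [in LHS]scaler_sumr -sumrB scaler_sumr.
apply: eq_bigr => p _; rewrite /R1 /R2 /H1 /H2 (fieldZ fM).
rewrite (_ : m + s%:Z + n - p%:Z = m + n - p%:Z + s%:Z); last by lia.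
rewrite (_ : m + l - s%:Z + n - p%:Z = m + n + l - p%:Z - s%:Z); last by lia.
by lmod C.
Qed.

Lemma state_field_jacobi u : jacobi_at u.
Proof.
apply: gen u; [split|exact: jacobi_vac|by move=> n u; apply: jacobi_alpha].
  move=> v w l m n; rewrite /Rop !nsum0 // => j.
    by rewrite !(sf0 sfM) (field0 (sf_field sfM v)) scaler0 subrr scaler0.
  by rewrite (sf0 sfV) (sf0 sfM) scaler0.
by move=> k u v; apply: jacobi_lin.
Qed.

Lemma state_field_jacobi_identity : jacobi_identity YV YM.
Proof.
move=> u v w l m n; have := state_field_jacobi u v w l m n.
rewrite /nsum /Rop => E.
transitivity (\sum_(j \in [set: nat]) bin m j *: YM (YV u (l + j%:Z) v) (m + n - j%:Z) w).
  by apply: eq_fsbigr => j _; rewrite zbin.unlock.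
rewrite E; apply: eq_fsbigr => j _.
by rewrite sbinE zbin.unlock.
Qed.

End Jacobi.

(** * The products with a free boson *)

Section BosonProducts.
Variables (C : numClosedFieldType) (M : lmodType C).
Local Notation sbin := (sbin C).
Variables (a : int -> M -> M).
Hypothesis fa : isfield a.
Hypothesis heis : forall (m n : int) w, a m (a n w) - a n (a m w) =
    (if m + n == 0 then m%:~R else 0) *: w.

Lemma sbin_diag (m : int) (t : nat) :
  sbin m t * (m - t%:Z)%:~R = m%:~R * sbin (m - 1) t.
Proof. by rewrite !sbinE -mulrA [zbin _ _ _ * _]mulrC -binzS -bin_diag; ring. Qed.

Section Swap.
Variables (b : int -> M -> M) (m n q : int) (w : M).
Hypothesis fb : isfield b.

Let G (m n : int) (t s : nat) : M := (sbin m t * sbin n s) *: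
  ((a (m - t%:Z) (a (n - s%:Z) (b (q + (t + s)%N%:Z) w))
    - (-1) ^ n *: a (m - t%:Z) (b (q + n + t%:Z - s%:Z) (a s%:Z w)))
   - ((-1) ^ m *: a (n - s%:Z) (b (q + m + s%:Z - t%:Z) (a t%:Z w))
      - ((-1) ^ m * (-1) ^ n) *: b (q + m + n - (t + s)%N%:Z) (a s%:Z (a t%:Z w)))).

Lemma fs2_cross (m' z : int) :
  fs2 (fun t s : nat => a (m' - t%:Z) (b (z + t%:Z - s%:Z) (a s%:Z w))).
Proof.
have [N aN] := field_trunc_nat fa w; apply: fs2_col.
  by exists N => s Ns t; rewrite aN // (field0 fb) (field0 fa).
move=> s; have [|K bK] := @field_fs _ _ _ fb (z - s%:Z) (fun t : nat => z + t%:Z - s%:Z) (a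
  s%:Z w); first by move=> j; lia.
by exists K => t Kt; rewrite bK // (field0 fa).
Qed.

Lemma fs2_swap (m' n' : int) : fs2 (G m' n').
Proof.
have [N1 h1] := @fs2_cross m' (q + n').
have [N2 h2] := fs2_tr (@fs2_cross n' (q + m')).
have [N3 h3] := field_fs fb w (fun j => lexx (q + j%:Z)).
have [N4 h4] : fs2 (fun t s : nat => b (q + m' + n' - (t + s)%N%:Z) (a s%:Z (a t%:Z w))).
  have [N aN] := field_trunc_nat fa w; apply: fs2_row.
    by exists N => t Nt s; rewrite aN // (field0 fa) (field0 fb).
  move=> t; have [K aK] := field_trunc_nat fa (a t%:Z w).
  by exists K => s Ks; rewrite aK // (field0 fb).
exists (maxn (maxn N1 N2) (maxn N3 N4)) => t s; rewrite !geq_max => h.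
rewrite /G h1 ?h2 ?h3 ?h4 ?(field0 fa) ?scaler0 ?subrr ?scaler0 //; move: h; lia.
Qed.

Lemma prod_prodE (m' n' : int) :
  prod a (prod a b n') m' q w = nsum (fun t => nsum (G m' n' t)).
Proof.
apply: eq_nsum => t; rewrite /prod.
have f1 := fs_prod n' (q + t%:Z) w fa fb.
have f2 := fs_prod n' (q + m' - t%:Z) (a t%:Z w) fa fb.
rewrite (field_nsum fa _ f1) (scaler_nsum _ f2).
rewrite -(nsumB (field_fs_in fa _ f1) (fsZ (fun=> _) f2)) scaler_nsum; last first.
  exact: (fsB (field_fs_in fa _ f1) (fsZ (fun=> _) f2)).
apply: eq_nsum => s; rewrite /G (fieldZ fa) (fieldB fa) (fieldZ fa).
rewrite (_ : q + (t + s)%N%:Z = q + t%:Z + s%:Z); last by lia.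
rewrite (_ : q + n' + t%:Z - s%:Z = q + t%:Z + n' - s%:Z); last by lia.
rewrite (_ : q + m' + s%:Z - t%:Z = q + m' - t%:Z + s%:Z); last by lia.
rewrite (_ : q + m' + n' - (t + s)%N%:Z = q + m' - t%:Z + n' - s%:Z); last by lia.
by lmod C.
Qed.

(** Exchanging the two products leaves the brackets of alpha(m - t) and alpha(n - s), which need t +
    s = m + n. By [sbin_diag] and Vandermonde their coefficients add up to m times the coefficient
    of z^(m+n) in (1 - z)^(m+n-1), which is zero for m + n > 0; for m + n < 0 there is no such
    pair. *)
Lemma boson_products : prod a (prod a b n) m q w - prod a (prod a b m) n q w =
  (if m + n == 0 then m%:~R else 0) *: b q w.
Proof.
rewrite !prod_prodE [X in _ - X]nsum_exchange; last exact: fs2_swap.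
have fG1 := fs2_swap m n; have fG2 := fs2_tr (fs2_swap n m).
rewrite -nsumB; [|exact: fs2_out|exact: fs2_out].
pose H (t s : nat) : M := (sbin m t * sbin n s *
   (if m + n == (t + s)%N%:Z then (m - t%:Z)%:~R else 0)) *: b (q + m + n) w.
have fH : fs2 H.
  apply: fs2_add; exists (absz (m + n)%R).+1 => t s le.
  by rewrite /H ifF ?mulr0 ?scale0r //; apply/eqP => E; lia.
rewrite (@eq_nsum _ _ (fun t => nsum (H t))); last first.
  move=> t; rewrite -nsumB; [|exact: fs2_in fG1|exact: fs2_in fG2].
  apply: eq_nsum => s.
  have := heis (m - t%:Z) (n - s%:Z) (b (q + (t + s)%N%:Z) w).
  have := heis s%:Z t%:Z w; rewrite [X in X *: w](_ : _ = 0); last first.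
    by case: ifP => // /eqP E; rewrite (_ : s = 0%N) //; lia.
  rewrite scale0r => /eqP; rewrite subr_eq0 => /eqP E1 E2.
  have -> : H t s = (sbin m t * sbin n s) *: (a (m - t%:Z) (a (n - s%:Z) (b (q + (t +
    s)%N%:Z) w)) - a (n - s%:Z) (a (m - t%:Z) (b (q + (t + s)%N%:Z) w))).
    rewrite E2 /H scalerA; have [E|nE] := eqVneq (m + n) (t + s)%N%:Z.
      rewrite (_ : m - t%:Z + _ == 0); last by apply/eqP; lia.
      by rewrite (_ : q + m + n = q + (t + s)%N%:Z) //; lia.
    by rewrite (_ : (m - t%:Z + _ == 0) = false) ?mulr0 ?scale0r //; apply/eqP; move/eqP:
      nE; lia.
  rewrite /G E1 [(s + t)%N]addnC (_ : q + n + m - (t + s)%N%:Z = q + m + n - (t + s)%N%:Z);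
    last by lia.
  by lmod C.
rewrite nsum_diag //.
rewrite (@nsum_zb _ _ (fun p => m%:~R * sbin (m + n - 1) p) (m + n) (b (q + m + n) w));
  last first.
  move=> p; case: eqP => [E|nE].
    rewrite addrAC -sbin_Vandermonde mulr_sumr scaler_suml; apply: eq_bigr => -[t /=].
    rewrite ltnS => le_tp _; rewrite /H subnKC // E eqxx.
    by congr (_ *: _); rewrite [RHS]mulrA -sbin_diag; ring.
  apply: big1 => -[t /=]; rewrite ltnS => le_tp _; rewrite /H subnKC //.
  by rewrite ifF ?mulr0 ?scale0r //; apply/eqP.
case: eqP => [E|nE].
  by rewrite E /= sbin0 mulr1 -addrA E addr0.
case E : (m + n) nE => [[|p]|p] // _; last by rewrite !scale0r.
rewrite /= (_ : p.+1%:Z - 1 = p%:Z); last by lia.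
by rewrite sbin_nat bin_small // !mulr0 !scale0r.
Qed.

End Swap.
End BosonProducts.

(** * Creation, translation and the Virasoro algebra *)

Section Virasoro.
Variables (C : numClosedFieldType).
Local Notation bin := (zbin C).
Local Notation sbin := (sbin C).
Variables (V M : lmodType C) (vac : V) (alV : int -> V -> V) (alM : int -> M -> M).
Variables (YV : V -> int -> V -> V) (YM : V -> int -> M -> M).
Hypotheses (sfV : state_field vac alV alV YV) (sfM : state_field vac alV alM YM).
Hypothesis ann : forall i : nat, alV i%:Z vac = 0.
Hypothesis gen : generated_by vac alV.

Local Notation fV := (sf_boson sfV).
Local Notation fM := (sf_boson sfM).
Local Notation om := (2^-1 *: alV (-1) (alV (-1) vac)).

Lemma creation_alpha l u n :
  (forall m : int, 0 <= m -> YV u m vac = 0) ->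
  YV (alV l u) n vac = nsum (fun t : nat => sbin l t *: alV (l - t%:Z) (YV u (n + t%:Z) vac)).
Proof.
move=> u0; rewrite (sf_alpha sfV); apply: eq_nsum => t; congr (_ *: _).
by rewrite ann (field0 (sf_field sfV u)) scaler0 subr0.
Qed.

Lemma creation u : YV u (-1) vac = u /\ forall n : int, 0 <= n -> YV u n vac = 0.
Proof.
pattern u; apply: gen u; [split| |] => /=.
- by split=> [|n _]; rewrite (sf0 sfV).
- move=> k u v [u1 u0] [v1 v0]; split=> [|n n0]; rewrite (sf_linear sfV).
    by rewrite u1 v1.
  by rewrite u0 // v0 // scaler0 addr0.
- split=> [|n n0]; rewrite (sf_vac sfV) ?eqxx //.
  by case: eqP n0 => // ->.
move=> l u [u1 u0]; split=> [|n n0]; rewrite creation_alpha //; last first.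
  by apply: nsum0 => t; rewrite u0 ?(field0 fV) ?scaler0 //; lia.
rewrite (@nsum1 _ 0) ?sbin0 ?scale1r ?subr0 ?addr0 ?u1 // => -[|t] // _.
by rewrite u0 ?(field0 fV) ?scaler0.
Qed.

Lemma translation_alpha l u : YV (alV l u) (-2) vac =
  alV l (YV u (-2) vac) - l%:~R *: alV (l - 1) u.
Proof.
have [u1 u0] := creation u; rewrite creation_alpha //.
rewrite (nsumE (N := 2)) => [|j lt_j]; last by rewrite u0 ?(field0 fV) ?scaler0 //; lia.
rewrite big_ord_recl big_ord1 /= sbin0 scale1r subr0 addr0; congr (_ + _).
rewrite (_ : -2 + 1%N%:Z = -1) // u1 sbinE expr1 -scaleNr; congr (_ *: _).
by rewrite mulN1r; congr (- _); rewrite zbin.unlock /binz big_ord1 subr0 divr1.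
Qed.

(** In the product of index -1 with the identity field exactly one term survives: from the first
    half if n < 0, from the second if n >= 0. *)
Lemma alpha_state n w : YM (alV (-1) vac) n w = alM n w.
Proof.
rewrite (sf_alpha sfM) /prod.
case: n => n.
  rewrite (@nsum1 _ n) => [|t tn].
    rewrite !(sf_vac sfM) (_ : (_ + _ == -1) = false); last by apply/eqP; lia.
    rewrite (_ : n%:Z + -1 - n%:Z == -1); last by apply/eqP; lia.
    by rewrite (field0 fM) sub0r (_ : -1 = - 1%:Z) // sbin_neg add0n binn m1zN expr1
      !scaleN1r opprK scale1r.
  rewrite !(sf_vac sfM) (_ : (_ + _ == -1) = false); last by apply/eqP; lia.
  rewrite (_ : (n%:Z + -1 - t%:Z == -1) = false); last by apply/eqP; move/eqP: tn; lia.
  by rewrite (field0 fM) scaler0 subrr scaler0.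
rewrite (@nsum1 _ n) => [|t tn].
  rewrite !(sf_vac sfM) (_ : Negz n + n%:Z == -1); last by apply/eqP; lia.
  rewrite (_ : (Negz n + -1 - n%:Z == -1) = false); last by apply/eqP; lia.
  rewrite scaler0 subr0 (_ : sbin (-1) n = 1); last first.
    by rewrite (_ : -1 = - 1%:Z) // sbin_neg add0n binn.
  by rewrite scale1r; congr (alM _ _); lia.
rewrite !(sf_vac sfM) (_ : (Negz n + t%:Z == -1) = false); last by apply/eqP; move/eqP: tn; lia.
rewrite (_ : (Negz n + -1 - t%:Z == -1) = false); last by apply/eqP; lia.
by rewrite (field0 fM) scaler0 subrr scaler0.
Qed.

(** The two contractions of alpha(1) with alpha(-1)^2 cancel the factor 1/2 in omega. Hence a single
    term is left in the commutator formula of alpha(t) and L(n). *)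
Lemma alpha_omega (i : nat) : alV i%:Z om = (if i == 1%N then 1 else 0) *: alV (-1) vac.
Proof.
have E j : alV j%:Z (alV (-1) vac) = (if j == 1%N then 1 else 0) *: vac.
  have /eqP := sf_heis sfV j%:Z (-1) vac; rewrite ann (field0 fV) subr0 => /eqP ->.
  by case: j => [|[|j]].
have /eqP := sf_heis sfV i%:Z (-1) (alV (-1) vac); rewrite subr_eq E (fieldZ fV) => /eqP h.
rewrite (fieldZ fV) h; case: i {h} => [|[|i]] /=; rewrite ?scale0r ?addr0 ?scaler0 //.
rewrite !scale1r -mulr2n -scaler_nat scalerA mulVf ?scale1r //.
by rewrite pnatr_eq0.
Qed.

Local Notation L n := (YM om (n + 1)).

Lemma alpha_L (t n : int) w : alM t (L n w) - L n (alM t w) = t%:~R *: alM (t + n) w.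
Proof.
have [J0 comm] := state_field_comm sfM fV (sf_heis sfV) ann gen om.
rewrite (comm (maxn J0 2)) ?leq_maxl // -(nsumE (f := fun i : nat => bin t i *: YM (alV
  i%:Z om) (t + (n + 1) - i%:Z) w)).
  rewrite (@nsum1 _ 1) => [|j j1]; last by rewrite alpha_omega (negPf j1) scale0r (sf0 sfM)
    scaler0.
  rewrite alpha_omega /= scale1r alpha_state; congr (_ *: alM _ _); last by lia.
  by rewrite zbin.unlock /binz big_ord1 subr0 divr1.
move=> j; rewrite geq_max => /andP[_ j1]; rewrite alpha_omega gtn_eqF // scale0r.
by rewrite (sf0 sfM) scaler0.
Qed.

Lemma L_alpha (t n : int) w : L n (alM t w) = alM t (L n w) - t%:~R *: alM (t + n) w.
Proof. by rewrite -alpha_L subKr. Qed.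

(** On a singular vector only the first term of L(0) = alpha(0)^2 / 2 + sum over n > 0 of alpha(-n)
    alpha(n) is nonzero. *)
Lemma L0_highest w : (forall i : nat, alM i.+1%:Z w = 0) ->
  L 0 w = 2^-1 *: alM 0 (alM 0 w).
Proof.
move=> hw; rewrite (sfZ sfM) (sf_alpha sfM) /prod; congr (_ *: _).
rewrite (@nsum1 _ 0) => [|[|j]] //.
  rewrite sbin0 scale1r !alpha_state subr0 addr0 (hw 0%N) (field0 fM) sub0r.
  by rewrite (_ : -1 = - 1%:Z) // m1zN expr1 scaleN1r opprK.
move=> _; rewrite !alpha_state (_ : 0 + 1 + j.+1%:Z = j.+2%:Z); last by lia.
by rewrite !hw !(field0 fM) scaler0 subrr scaler0.
Qed.

(** The Jacobi identity with v = [vac], l = -2 and m = 0: the left side has one term, and on the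
    right the identity field selects one summand, with coefficient [sbin (-2) j] = j + 1. *)
Lemma translation_state u n w : YM (YV u (-2) vac) n w = - n%:~R *: YM u (n - 1) w.
Proof.
have := state_field_jacobi sfV sfM ann gen u vac w (-2) 0 n.
rewrite (@nsum1 _ 0) => [|[|j] // _]; last by rewrite (binz_nat _ 0) bin0n scale0r.
rewrite binz0 scale1r add0r subr0 addr0 => ->; rewrite /Rop.
have s2 (j : nat) : sbin (-2) j = j.+1%:R.
  by rewrite (_ : -2 = - 2%:Z) // sbin_neg add1n binSn.
have S : (-1) ^ (-2) = 1 :> C by rewrite (_ : -2 = - 2%:Z) // m1zN sqrrN expr1n.
case: n => [n|n].
  rewrite (@eq_nsum _ _ (fun j : nat => if j.+1 == n then - (n%:Z)%:~R *: YM u (n%:Z - 1) w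
    else 0)).
    case: n => [|n]; first by rewrite nsum0 // oppr0 scale0r.
    by rewrite (@nsum1 _ n) ?eqxx // => j /negPf; rewrite eqSS => ->.
  move=> j; rewrite !(sf_vac sfM) s2 S scale1r.
  rewrite (_ : (_ + j%:Z == -1) = false) ?(field0 (sf_field sfM u)); last by apply/eqP; lia.
  have [E|nE] := eqVneq j.+1 n.
    rewrite (_ : n%:Z + -2 - j%:Z == -1); last by apply/eqP; lia.
    by rewrite sub0r scalerN -scaleNr add0r -E; congr (_ *: YM u _ w); lia.
  rewrite (_ : (n%:Z + _ - _ == -1) = false) ?subr0 ?scaler0 //.
  by apply/eqP; move/eqP: nE; lia.
rewrite (@nsum1 _ n) => [|j jn].
  rewrite !(sf_vac sfM) (_ : Negz n + n%:Z == -1); last by apply/eqP; lia.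
  rewrite (_ : (Negz n + -2 - n%:Z == -1) = false); last by apply/eqP; lia.
  rewrite scaler0 subr0 s2 NegzE rmorphN /= opprK; congr (_ *: YM u _ w); lia.
rewrite !(sf_vac sfM) (_ : (Negz n + j%:Z == -1) = false); last by apply/eqP; move/eqP: jn; lia.
rewrite (_ : (Negz n + -2 - j%:Z == -1) = false); last by apply/eqP; lia.
by rewrite (field0 (sf_field sfM u)) scaler0 subrr scaler0.
Qed.

End Virasoro.

Section VirasoroState.
Variables (C : numClosedFieldType).
Local Notation bin := (zbin C).
Local Notation sbin := (sbin C).
Variables (V M : lmodType C) (vac : V) (alV : int -> V -> V) (alM : int -> M -> M).
Variables (YV : V -> int -> V -> V) (YM : V -> int -> M -> M).
Hypotheses (sfV : state_field vac alV alV YV) (sfM : state_field vac alV alM YM).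
Hypothesis ann : forall i : nat, alV i%:Z vac = 0.
Hypothesis gen : generated_by vac alV.

Local Notation fV := (sf_boson sfV).
Local Notation om := (2^-1 *: alV (-1) (alV (-1) vac)).
Local Notation L n := (YV om (n + 1)).

Lemma L_vac (n : int) : -1 <= n -> L n vac = 0.
Proof. by move=> n1; apply: (creation sfV ann gen om).2; lia. Qed.

(** Both sides vanish on [vac] and obey the same recursion under alpha(l), given by [L_alpha] and
    [translation_alpha]. *)
Lemma L_translation u : L (-1) u = YV u (-2) vac.
Proof.
pattern u; apply: gen u; [split| |] => /=.
- by rewrite (field0 (sf_field sfV om)) (sf0 sfV).
- by move=> k u v; rewrite (sf_linear sfV) (field_lin (sf_field sfV om)) => -> ->.
- by rewrite L_vac // (sf_vac sfV).
by move=> l u IH; rewrite (L_alpha sfV sfV ann gen) IH (translation_alpha sfV ann gen).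
Qed.

Lemma L_derivative u n w : YM (L (-1) u) n w = - n%:~R *: YM u (n - 1) w.
Proof. by rewrite L_translation (translation_state sfV sfM ann gen). Qed.

Lemma L_omega (n : nat) : L n%:Z om =
  if n == 0%N then 2 *: om else if n == 2%N then 2^-1 *: vac else 0.
Proof.
rewrite (fieldZ (sf_field sfV om)) !(L_alpha sfV sfV ann gen) L_vac // (field0 fV) sub0r.
rewrite rmorphN /= scaleN1r opprK scaleN1r opprK.
have heis m k w : alV m (alV k w) = alV k (alV m w) + (if m + k == 0 then m%:~R else 0) *: w.
  by rewrite -(sf_heis sfV) addrC subrK.
case: n => [|[|[|n]]] /=.
- rewrite (_ : -1 + 0 = -1) // -mulr2n -scaler_nat !scalerA.
  by congr (_ *: _); ring.
- by rewrite (_ : -1 + 1 = 0%N%:Z) // ann (field0 fV) add0r heis ann (field0 fV) /= scale0r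
  addr0 scaler0.
- by rewrite (_ : -1 + 2%:Z = 1%N%:Z) // ann (field0 fV) add0r heis ann (field0 fV) add0r
  scale1r.
rewrite (_ : -1 + n.+3%:Z = n.+2%:Z); last by lia.
by rewrite ann (field0 fV) add0r heis ann (field0 fV) add0r /= scale0r scaler0.
Qed.

(** The Jacobi identity with l = 0. Since omega_(i) = L(i - 1), the terms come from L(-1) omega,
    L(0) omega = 2 omega and L(2) omega = [vac] / 2; the last one says that the central charge, the
    factor 1 in the statement, is 1. *)
Lemma L_bracket (m n : int) w : 
  YM om (m + 1) (YM om (n + 1) w) - YM om (n + 1) (YM om (m + 1) w) =
  (m - n)%:~R *: YM om (m + n + 1) w +
  (if m + n == 0 then (m ^+ 3 - m)%:~R / 12%:R * 1 else 0) *: w.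
Proof.
have := state_field_jacobi sfV sfM ann gen om om w 0 (m + 1) (n + 1).
rewrite [Rop _ _ _ _ _ _](@nsum1 _ 0) => [|j j0]; last by rewrite sbin_0 (negPf j0) scale0r.
rewrite sbin0 scale1r !addr0 expr0z scale1r => <-.
have om_ (i : nat) : YV om (0 + i.+1%:Z) om = L i%:Z om by congr (YV _ _ _); lia.
rewrite (nsumE (N := 4)) => [|[//|j] lt_j]; last first.
  rewrite om_ L_omega; case: j lt_j => [|[|[|j]]] //= _.
  by rewrite (sf0 sfM) scaler0.
rewrite !big_ord_recl big_ord0 !lift0 /= !om_ !L_omega /= (sf0 sfM) scaler0 add0r addr0.
rewrite (_ : YV om 0 om = L (-1) om) // L_derivative !(sfZ sfM) (sf_vac sfM).
rewrite binz0 scale1r (_ : m + 1 + (n + 1) - 1 = m + n + 1); last by lia.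
rewrite (_ : (m + 1 + (n + 1) - 3%N%:Z == -1) = (m + n == 0)); last first.
  by apply/eqP/eqP; lia.
have b1 : bin (m + 1) 1 = m%:~R + 1.
  by rewrite zbin.unlock /binz big_ord1 subr0 divr1 rmorphD.
have h2 : 2 != 0 :> C by rewrite pnatr_eq0.
have h6 : 6 != 0 :> C by rewrite pnatr_eq0.
have h12 : 12 != 0 :> C by rewrite pnatr_eq0.
have b3 : bin (m + 1) 3 = 6^-1 * ((m%:~R + 1) * m%:~R * (m%:~R - 1)).
  have e3 := binzS C (m + 1) 2; have e2 := binzS C (m + 1) 1.
  rewrite b1 (_ : m + 1 - 1%N%:Z = m) in e2; last by lia.
  rewrite (_ : m + 1 - 2%N%:Z = m - 1) in e3; last by lia.
  apply: (mulfI h6); rewrite mulrA mulfV // mul1r.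
  transitivity (2 * (3 * bin (m + 1) 3)); first by ring.
  by rewrite e3 mulrCA e2 rmorphB /=; ring.
set X := YM _ _ w; rewrite b1 b3.
have -> : (m - n)%:~R *: (2^-1 *: X) = (- (m + 1 + (n + 1))%:~R + (m%:~R + 1) * 2) *: (2^-1
  *: X).
  by congr (_ *: _); rewrite !rmorphD rmorphN /=; ring.
case: ifP => _; last by rewrite scale0r; lmod C.
rewrite (_ : (m ^+ 3 - m)%:~R / 12%:R * 1 = 6^-1 * ((m%:~R + 1) * m%:~R * (m%:~R - 1)) *
  2^-1 :> C).
  by lmod C.
by rewrite mulr1 rmorphB rmorphXn /=; field.
Qed.

End VirasoroState.

(** * The universal property of the Fock modules *)

Section LinearExtension.
Variables (C : numClosedFieldType) (K : choiceType).

Lemma malgU_scale (k : C) (m : K) : k *: << m >> = << k *g m >> :> {malg C[K]}.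
Proof. by apply/malgP => k'; rewrite mcoeffZ !mcoeffU mulr_natr. Qed.

Lemma malg_ind (P : {malg C[K]} -> Prop) : subspace P ->
  (forall k, P << k >>) -> forall t, P t.
Proof.
move=> [P0 PD] PU t; rewrite [t]monalgE; elim/big_rec: _ => // k x _ Px.
rewrite (_ : << _ *g k >> = t@_k *: << k >>); first exact: PD.
by rewrite malgU_scale.
Qed.

Section Ext.
Variables (W : lmodType C) (f : K -> W).

Definition mlin (t : {malg C[K]}) : W := \sum_(k <- msupp t) t@_k *: f k.

Lemma mlinEw (d : {fset K}) t : (msupp t `<=` d)%fset ->
  mlin t = \sum_(k <- d) t@_k *: f k.
Proof.
move=> sub; rewrite /mlin (big_fset_incl _ sub) //= => k _ k_notin.
by rewrite (mcoeff_outdom k_notin) scale0r.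
Qed.

Lemma mlin_lin (k : C) x y : mlin (k *: x + y) = k *: mlin x + mlin y.
Proof.
pose d := (msupp (k *: x + y) `|` (msupp x `|` msupp y))%fset.
rewrite !(@mlinEw d) /d; first last.
- by rewrite fsubsetUl.
- by rewrite fsubsetU // fsubsetUl orbT.
- by rewrite fsubsetU // fsubsetUr orbT.
rewrite scaler_sumr -big_split; apply: eq_bigr => i _ /=.
by rewrite mcoeffD mcoeffZ scalerDl scalerA.
Qed.

Lemma mlin0 : mlin 0 = 0.
Proof. by rewrite /mlin msupp0 big_seq_fset0. Qed.

Lemma mlinD x y : mlin (x + y) = mlin x + mlin y.
Proof. by rewrite -[x]scale1r mlin_lin !scale1r. Qed.

Lemma mlinZ k x : mlin (k *: x) = k *: mlin x.
Proof. by rewrite -[k *: x]addr0 mlin_lin mlin0 addr0. Qed.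

Lemma mlinU (c : C) k : mlin << c *g k >> = c *: f k.
Proof.
rewrite (@mlinEw [fset k]%fset) ?msuppU_le // big_seq_fset1.
by rewrite mcoeffUU.
Qed.

End Ext.

End LinearExtension.

Section FockUniversal.
Variables (C : numClosedFieldType) (W : lmodType C).
Variables (A : int -> W -> W) (S : W -> Prop).
Local Notation T := {malg C[{fmonom (heis C)}]}.

Hypothesis S_sub : subspace S.
Hypothesis A_S : forall n w, S w -> S (A n w).
Hypothesis A_lin : forall n (k : C) w x, S w -> S x ->
  A n (k *: w + x) = k *: A n w + A n x.
Hypothesis A_heis : forall (m n : int) w, S w -> A m (A n w) - A n (A m w) =
    (if m + n == 0 then m%:~R else 0) *: w.

(** K acts as the identity. The hypotheses on [A] are restricted to a subspace [S] because W will be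
    the space of all families int -> M -> M, on which the products with alpha(z) are linear and
    satisfy the Heisenberg relations for fields only. *)
Definition heis_act (x : heis C) (w : W) : W :=
  mlin (fun n => A n w) x.1 + (x.2 : C) *: w.

Definition tensor_act (t : T) (w : W) : W :=
  mlin (fun m : {fmonom (heis C)} => foldr heis_act w m) t.

Lemma A0 n : A n 0 = 0.
Proof.
have := A_lin n 1 S_sub.1 S_sub.1; rewrite scaler0 addr0 scale1r => h.
by apply: (addrI (A n 0)); rewrite addr0.
Qed.

Lemma S_lin (k : C) x y : S x -> S y -> S (k *: x + y).
Proof. exact: S_sub.2. Qed.

Lemma mlin_S (K : choiceType) (f : K -> W) t : (forall k, S (f k)) -> S (mlin f t).
Proof.
move=> Sf; rewrite /mlin; elim/big_rec: _ => [|k x _ Sx]; first by case: S_sub.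
exact: S_lin.
Qed.

Lemma mlin_morph (K : choiceType) (f : K -> W) (h : W -> W) t : (forall k, S (f k)) ->
  h 0 = 0 -> (forall k x y, S x -> S y -> h (k *: x + y) = k *: h x + h y) ->
  h (mlin f t) = mlin (fun k => h (f k)) t.
Proof.
move=> Sf h0 hlin; rewrite /mlin.
suff: S (\sum_(k <- msupp t) t@_k *: f k) /\ h (\sum_(k <- msupp t) t@_k *: f k) = \sum_(k
  <- msupp t) t@_k *: h (f k) by case.
elim/big_rec2: _ => [|k x y _ [Sx <-]]; first by split=> //; case: S_sub.
by split; [exact: S_lin|exact: hlin].
Qed.

Lemma heis_act_S x w : S w -> S (heis_act x w).
Proof.
move=> Sw; rewrite /heis_act addrC; apply: S_lin => //.
by apply: mlin_S => n; apply: A_S.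
Qed.

Lemma heis_act_lin x (k : C) w w' : S w -> S w' ->
  heis_act x (k *: w + w') = k *: heis_act x w + heis_act x w'.
Proof.
move=> Sw Sw'; rewrite /heis_act.
suff -> : mlin (fun n => A n (k *: w + w')) x.1 =
   k *: mlin (fun n => A n w) x.1 + mlin (fun n => A n w') x.1 by lmod C.
rewrite /mlin scaler_sumr -big_split; apply: eq_bigr => n _ /=.
by rewrite A_lin //; lmod C.
Qed.

Lemma heis_act_linl (k : C) x y w :
  heis_act (k *: x + y) w = k *: heis_act x w + heis_act y w.
Proof.
rewrite /heis_act [(k *: x + y).1]/(k *: x.1 + y.1) mlin_lin.
have -> : ((k *: x + y).2 : C) = k * (x.2 : C) + (y.2 : C) by [].
by lmod C.
Qed.

Lemma foldr_S s w : S w -> S (foldr heis_act w s).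
Proof. by move=> Sw; elim: s => //= x s; apply: heis_act_S. Qed.

Lemma foldr_lin s (k : C) w w' : S w -> S w' ->
  foldr heis_act (k *: w + w') s = k *: foldr heis_act w s + foldr heis_act w' s.
Proof.
by move=> Sw Sw'; elim: s => //= x s ->; rewrite heis_act_lin //; apply: foldr_S.
Qed.

Lemma heis_act0 x : heis_act x 0 = 0.
Proof.
have := heis_act_lin x 1 S_sub.1 S_sub.1; rewrite scaler0 addr0 scale1r => h.
by apply: (addrI (heis_act x 0)); rewrite addr0.
Qed.

Lemma tensor_act_S t w : S w -> S (tensor_act t w).
Proof. by move=> Sw; apply: mlin_S => m; apply: foldr_S. Qed.

Lemma tensor_act0 t : tensor_act t 0 = 0.
Proof.
rewrite /tensor_act /mlin big1 // => m _; rewrite (_ : foldr _ _ _ = 0) ?scaler0 //.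
by elim: (m : seq _) => //= x s ->; rewrite heis_act0.
Qed.

Lemma tensor_act_mul t1 t2 w : S w ->
  tensor_act (t1 * t2) w = tensor_act t1 (tensor_act t2 w).
Proof.
move=> Sw; have St2 : S (tensor_act t2 w) by apply: tensor_act_S.
have E m1 : foldr heis_act (tensor_act t2 w) m1 =
    \sum_(m2 <- msupp t2) t2@_m2 *: foldr heis_act w (m1 ++ m2).
  rewrite (mlin_morph (h := fun w => foldr heis_act w m1)).
  - by apply: eq_bigr => m2 _; rewrite foldr_cat.
  - by move=> m2; apply: foldr_S.
  - by elim: m1 => //= x s ->; rewrite heis_act0.
  by move=> k x y; apply: foldr_lin.
rewrite malgME {1}/tensor_act (big_morph _ (mlinD _) (mlin0 _)); apply: eq_bigr => m1 _.
rewrite (big_morph _ (mlinD _) (mlin0 _)) E scaler_sumr; apply: eq_bigr => m2 _.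
by rewrite mlinU scalerA fmM.
Qed.

(** The central components cancel, and both sides are linear in the loop components; for two single
    powers of t the claim is [A_heis]. *)
Lemma heis_act_bracket x y w : S w ->
  heis_act x (heis_act y w) - heis_act y (heis_act x w) =
  heis_act (heis_bracket x y) w.
Proof.
move=> Sw; case: x y => [p i] [q j].
have E : heis_act (heis_bracket (p, i) (q, j)) w =
    (mlin (fun m : int => m%:~R * q@_(- m) : C^o) p : C) *: w.
  rewrite /heis_act /= mlin0 add0r; congr (_ *: _).
  by apply: eq_bigr => m _; rewrite /cform mulrCA.
rewrite {}E; have -> : heis_act (p, i) (heis_act (q, j) w) - heis_act (q, j) (heis_act (p,
  i) w) =
    mlin (fun m => A m (mlin (fun n => A n w) q)) p - mlin (fun m => A m (mlin (fun n => A
      n w) p)) q.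
  have Sh (t : {malg C[int]}) : S (mlin (fun n => A n w) t) by apply: mlin_S => n; apply: A_S.
  have h (t : {malg C[int]}) (c : C^o) (u : W) : S u -> mlin (fun m => A m (u + (c : C) *:
    w)) t =
      mlin (fun m => A m u) t + (c : C) *: mlin (fun m => A m w) t.
    move=> Su; rewrite /mlin scaler_sumr -big_split; apply: eq_bigr => m _ /=.
    by rewrite [u + _]addrC A_lin //; lmod C.
  rewrite /heis_act /= !h //; pose i1 : C := i; pose j1 : C := j.
  rewrite -/i1 -/j1; clearbody i1 j1.
  set P := mlin _ p; set Q := mlin _ q; set P' := mlin _ p; set Q' := mlin _ q.
  by lmod C.
move: p; apply: malg_ind.
  split; first by rewrite !mlin0 scale0r sub0r;
    rewrite /mlin big1 ?oppr0 // => n _; rewrite A0 scaler0.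
  move=> k x y hx hy; rewrite !mlin_lin scalerDl -scalerA -hx -hy.
  suff -> : mlin (fun m => A m (k *: mlin (fun n => A n w) x + mlin (fun n => A n w) y)) q =
     k *: mlin (fun m => A m (mlin (fun n => A n w) x)) q + mlin (fun m => A m (mlin (fun n
       => A n w) y)) q.
    by lmod C.
  have Sx : S (mlin (fun n => A n w) x) by apply: mlin_S => n; apply: A_S.
  have Sy : S (mlin (fun n => A n w) y) by apply: mlin_S => n; apply: A_S.
  move: (mlin _ x) (mlin _ y) Sx Sy => X Y SX SY.
  rewrite /mlin scaler_sumr -big_split; apply: eq_bigr => m _ /=.
  by rewrite A_lin //; lmod C.
move=> m; rewrite !mlinU !scale1r.
rewrite (mlin_morph (h := A m)) ?A0 //; last by move=> k x y; apply: A_lin.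
  have -> : (m%:~R * q@_(- m)) *: w = mlin (fun n => (if m + n == 0 then m%:~R else 0) *: w) q.
    move: q; apply: malg_ind; first split; first by rewrite mlin0 mcoeff0 mulr0 scale0r.
      by move=> k x y hx hy; rewrite mlin_lin -hx -hy mcoeffD mcoeffZ; lmod C.
    move=> n; rewrite mlinU scale1r mcoeffU mulr_natr; congr (_ *: _).
    by rewrite -addr_eq0 addrC; case: ifP.
  rewrite /mlin -sumrB; apply: eq_bigr => n _.
  by rewrite -A_heis // scalerBr.
by move=> n; apply: A_S.
Qed.

End FockUniversal.

Lemma malg_scaleAr (C : numClosedFieldType) (K : monomType) (k : C)
    (x y : {malg C[K]}) : x * (k *: y) = k *: (x * y).
Proof.
rewrite -[k *: y]mul_malgC -[k *: _]mul_malgC mulrA [RHS]mulrA; congr (_ * y).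
rewrite malgM_def malgM_def fgmulgU fgmulUg; apply: eq_bigr => m _.
by rewrite mulm1 mul1m mulrC.
Qed.

Section FockMap.
Variables (C : numClosedFieldType) (W : lmodType C) (lam : cartan C).
Variables (A : int -> W -> W) (S : W -> Prop) (w0 : W).
Local Notation T := {malg C[{fmonom (heis C)}]}.
Local Notation U := (U_heis C).

Hypothesis S_sub : subspace S.
Hypothesis A_S : forall n w, S w -> S (A n w).
Hypothesis A_lin : forall n (k : C) w x, S w -> S x ->
  A n (k *: w + x) = k *: A n w + A n x.
Hypothesis A_heis : forall (m n : int) w, S w -> A m (A n w) - A n (A m w) =
    (if m + n == 0 then m%:~R else 0) *: w.
Hypothesis S_w0 : S w0.
Hypothesis A_pos : forall n : nat, A n.+1%:Z w0 = 0.
Hypothesis A_zero : A 0 w0 = cform (alpha C) lam *: w0.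

Local Notation tact := (tensor_act A).

Lemma tensor_act_lin k x y w : tact (k *: x + y) w = k *: tact x w + tact y w.
Proof. exact: mlin_lin. Qed.

Lemma tensor_actZ k x w : tact (k *: x) w = k *: tact x w.
Proof. exact: mlinZ. Qed.

Lemma tensor_actD x y w : tact (x + y) w = tact x w + tact y w.
Proof. exact: mlinD. Qed.

Lemma tensor_actB x y w : tact (x - y) w = tact x w - tact y w.
Proof. by rewrite tensor_actD -[- y]scaleN1r tensor_actZ scaleN1r. Qed.

Lemma tensor_actB2 x y z w : tact (x - y - z) w = tact x w - tact y w - tact z w.
Proof. by rewrite tensor_actB tensor_actB. Qed.

Lemma tensor_act_letter x w : tact (uea_letter x) w = heis_act A x w.
Proof. by rewrite /tensor_act mlinU scale1r fmuE. Qed.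

Lemma tensor_act_ideal (t : T) :
  t \in gen_submod (@two_sided_mul C (heis C)) (uea_relation (@heis_bracket C)) ->
  forall w, S w -> tact t w = 0.
Proof.
have tM := tensor_act_mul S_sub A_S A_lin.
have tS := tensor_act_S S_sub A_S.
move=> /gen_submodP /(_ (fun t => forall w, S w -> tact t w = 0)); apply.
- split=> [w _|k x y hx hy w Sw]; first exact: mlin0.
  by rewrite tensor_act_lin hx // hy // scaler0 addr0.
- move=> [a b] y hy w Sw; have Sb : S (tact b w) by apply: tS.
  rewrite /two_sided_mul /= -mulrA tM // [tact (y * b) w]tM // hy //.
  exact: tensor_act0 S_sub A_lin _.
move=> _ [k x y|x y] w Sw.
  etransitivity; first exact: tensor_actB.
  rewrite tensor_act_lin (tensor_act_letter x) (tensor_act_letter y) (tensor_act_letter (k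
    *: x + y)).
  by rewrite heis_act_linl subrr.
have e (x' y' : heis C) :
    tact (uea_letter x' * uea_letter y') w = heis_act A x' (heis_act A y' w).
  by rewrite (tM (uea_letter x') (uea_letter y') w Sw) !tensor_act_letter.
etransitivity; first exact: tensor_actB2.
etransitivity; first exact: (congr2 (fun a b => a - b)
  (congr2 (fun a b => a - b) (e x y) (e y x)) (tensor_act_letter _ _)).
by rewrite (heis_act_bracket S_sub A_S A_lin A_heis) // subrr.
Qed.

Definition uea_act (u : U) (w : W) : W := tact (repr u) w.

Lemma uea_actE t w : S w -> uea_act (\pi_U t) w = tact t w.
Proof.
move=> Sw; apply/eqP; rewrite -subr_eq0 -tensor_actB; apply/eqP.
apply: tensor_act_ideal Sw; apply/(@lquot_eqP _ _ _ (@two_sided_mul C (heis C))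
  (uea_relation (@heis_bracket C))).
exact: (reprK (\pi_U t)).
Qed.

Lemma uea_act_lin k u v w : S w -> uea_act (k *: u + v) w = k *: uea_act u w + uea_act v w.
Proof.
move=> Sw; elim/quotW: u => x; elim/quotW: v => y.
have -> : k *: \pi_U x + \pi_U y = \pi_U (k *: x + y).
  by rewrite [RHS]lquot_piD [\pi_U (k *: x)]lquot_piZ.
by rewrite !uea_actE // tensor_act_lin.
Qed.

Lemma uea_act_mul u v w : S w -> uea_act (u * v) w = uea_act u (uea_act v w).
Proof.
move=> Sw; elim/quotW: u => x; elim/quotW: v => y.
rewrite [_ * _](uea_mulE (@heis_bracket C) x y) !uea_actE ?(tensor_act_mul S_sub A_S A_lin) //.
exact: tensor_act_S.
Qed.

Lemma uea_act_S u w : S w -> S (uea_act u w).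
Proof. exact: tensor_act_S. Qed.

Lemma uea_act1 w : S w -> uea_act 1 w = w.
Proof.
move=> Sw; have -> : 1 = \pi_U 1 by [].
by rewrite uea_actE // /tensor_act mlinU scale1r fm1.
Qed.

Lemma uea_act0 u : uea_act u 0 = 0.
Proof. exact: tensor_act0 S_sub A_lin _. Qed.

Lemma uea_act_alpha n w : S w -> uea_act (U_alpha C n) w = A n w.
Proof.
move=> Sw; rewrite uea_actE // tensor_act_letter /heis_act /= mlinU scale0r addr0.
by rewrite scale1r.
Qed.

Lemma uea_act_K w : S w -> uea_act (U_K C) w = w.
Proof.
move=> Sw; rewrite uea_actE // tensor_act_letter /heis_act /= mlin0 add0r.
by rewrite scale1r.
Qed.

Lemma uea_act_ideal (u : U) :
  u \in gen_submod (fun a x : U => a * x) (@fock_relation C lam) -> uea_act u w0 = 0.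
Proof.
have uB x y : uea_act (x - y) w0 = uea_act x w0 - uea_act y w0.
  by rewrite [x - y]addrC -[- y]scaleN1r uea_act_lin // scaleN1r addrC.
move=> /gen_submodP /(_ (fun u => uea_act u w0 = 0)); apply.
- split=> [|k x y hx hy]; last by rewrite uea_act_lin // hx hy scaler0 addr0.
  by rewrite -(subrr 0) uB subrr.
- by move=> a y hy; rewrite uea_act_mul // hy uea_act0.
move=> _ [n||]; first by rewrite uea_act_alpha.
  have -> : U_alpha C 0 - cform (alpha C) lam *: (1 : U) = (- cform (alpha C) lam) *: (1 :
    U) + U_alpha C 0.
    by rewrite scaleNr addrC.
  rewrite (uea_act_lin _ _ _ S_w0) (uea_act1 S_w0) (uea_act_alpha _ S_w0).
  by rewrite A_zero scaleNr addNr.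
by rewrite uB uea_act_K // uea_act1 // subrr.
Qed.

(** The action of words kills the relations of U on [S], and the generators of J_lam kill [w0],
    hence so does the left ideal. The clause [S (f x)] is what makes every Y(v, z) a field. *)
Lemma fock_universal : exists f : fock lam -> W,
  [/\ f (fock_vac lam) = w0,
      forall k x y, f (k *: x + y) = k *: f x + f y,
      forall n x, f (fock_alpha n x) = A n (f x)
    & forall x, S (f x)].
Proof.
pose f (x : fock lam) := uea_act (repr x) w0.
have fE u : f (\pi_(fock lam) u) = uea_act u w0.
  apply/eqP; rewrite -subr_eq0; apply/eqP.
  have -> : f (\pi_(fock lam) u) - uea_act u w0 = uea_act (repr (\pi_(fock lam) u) - u) w0.
    by rewrite [_ - u]addrC -[- u]scaleN1r uea_act_lin // scaleN1r addrC.
  apply: uea_act_ideal; apply/(@lquot_eqP _ _ _ (fun a x : U => a * x) (@fock_relation C lam)).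
  exact: (reprK (\pi_(fock lam) u)).
exists f; split.
- by rewrite fE uea_act1.
- move=> k x y; elim/quotW: x => u; elim/quotW: y => v.
  have -> : k *: \pi_(fock lam) u + \pi_(fock lam) v = \pi_(fock lam) (k *: u + v).
    by rewrite [RHS]lquot_piD [\pi_(fock lam) (k *: u)]lquot_piZ.
  by rewrite !fE uea_act_lin.
- move=> n x; elim/quotW: x => u.
  rewrite /fock_alpha fock_actE !fE uea_act_mul // uea_act_alpha //.
  exact: uea_act_S.
by move=> x; apply: uea_act_S.
Qed.

End FockMap.

(** * M(1,lambda) as a module over the Heisenberg algebra *)

Section FockStructure.
Variables (C : numClosedFieldType).
Local Notation T := {malg C[{fmonom (heis C)}]}.
Local Notation U := (U_heis C).
Local Notation letter := (uea_in (@heis_bracket C)).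

Lemma U_piL (k : C) (x y : T) : \pi_U (k *: x + y) = k *: \pi_U x + \pi_U y.
Proof. by rewrite lquot_piD lquot_piZ. Qed.

Lemma U_mulr_lin (k : C) (a u v : U) : a * (k *: u + v) = k *: (a * u) + a * v.
Proof.
elim/quotW: a => x; elim/quotW: u => y; elim/quotW: v => z.
have M := uea_mulE (@heis_bracket C).
have E : x * (k *: y + z) = k *: (x * y) + x * z by rewrite mulrDr malg_scaleAr.
etransitivity; first exact: (congr1 (fun v => \pi_U x * v) (esym (U_piL k y z))).
etransitivity; first exact: M.
etransitivity; first exact: (congr1 (fun t => \pi_U t) E).
etransitivity; first exact: U_piL.
exact: (congr2 (fun u v => k *: u + v) (esym (M x y)) (esym (M x z))).
Qed.

Lemma U_mull_lin (k : C) (u v a : U) : (k *: u + v) * a = k *: (u * a) + v * a.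
Proof.
elim/quotW: a => x; elim/quotW: u => y; elim/quotW: v => z.
have M := uea_mulE (@heis_bracket C).
have E : (k *: y + z) * x = k *: (y * x) + z * x by rewrite mulrDl scalerAl.
etransitivity; first exact: (congr1 (fun v => v * \pi_U x) (esym (U_piL k y z))).
etransitivity; first exact: M.
etransitivity; first exact: (congr1 (fun t => \pi_U t) E).
etransitivity; first exact: U_piL.
exact: (congr2 (fun u v => k *: u + v) (esym (M y x)) (esym (M z x))).
Qed.

Lemma uea_relationE (t t' : T) :
  uea_relation (@heis_bracket C) (t - t') -> \pi_U t = \pi_U t'.
Proof.
move=> h; have S : (t - t') \in gen_submod (@two_sided_mul C (heis C)) (uea_relation
  (@heis_bracket C)).
  exact: gen_submod_gen h.
exact: (elimT (@lquot_eqP _ _ _ (@two_sided_mul C (heis C)) (uea_relation (@heis_bracket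
  C)) t t') S).
Qed.

Lemma letter_lin (k : C) x y : letter (k *: x + y) = k *: letter x + letter y.
Proof.
etransitivity; last exact: U_piL.
exact: (uea_relationE (uea_rel_lin _ k x y)).
Qed.

Lemma letter_bracket x y :
  letter x * letter y = letter y * letter x + letter (heis_bracket x y).
Proof.
have M := uea_mulE (@heis_bracket C).
etransitivity; first exact: (M (uea_letter x) (uea_letter y)).
etransitivity; last exact: (congr1 (fun u => u + letter (heis_bracket x y))
  (esym (M (uea_letter y) (uea_letter x)))).
etransitivity; last exact: uea_piD.
apply: uea_relationE; have E (p q r : T) : p - (q + r) = p - q - r by rewrite opprD addrA.
rewrite E; exact: uea_rel_br.
Qed.

Variable lam : cartan C.
Local Notation F := (fock lam).

Lemma F_piL (k : C) (u v : U) : \pi_F (k *: u + v) = k *: \pi_F u + \pi_F v.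
Proof. by rewrite lquot_piD lquot_piZ. Qed.

Lemma fock_act_lin (a : U) (k : C) (x y : F) :
  fock_act a (k *: x + y) = k *: fock_act a x + fock_act a y.
Proof.
elim/quotW: x => u; elim/quotW: y => v; have M := fock_actE lam.
etransitivity; first exact: (congr1 (fock_act a) (esym (F_piL k u v))).
etransitivity; first exact: M.
etransitivity; first exact: (congr1 (fun t => \pi_F t) (U_mulr_lin k a u v)).
etransitivity; first exact: F_piL.
exact: (congr2 (fun x y => k *: x + y) (esym (M a u)) (esym (M a v))).
Qed.

Lemma fock_act_linl (k : C) (a b : U) (x : F) :
  fock_act (k *: a + b) x = k *: fock_act a x + fock_act b x.
Proof.
elim/quotW: x => u; have M := fock_actE lam.
etransitivity; first exact: M.
etransitivity; first exact: (congr1 (fun t => \pi_F t) (U_mull_lin k a b u)).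
etransitivity; first exact: F_piL.
exact: (congr2 (fun x y => k *: x + y) (esym (M a u)) (esym (M b u))).
Qed.

Lemma fock_act_mul (a b : U) (x : F) : fock_act (a * b) x = fock_act a (fock_act b x).
Proof.
elim/quotW: x => u.
etransitivity; first exact: (fock_actE lam (a * b) u).
etransitivity; last exact: (congr1 (fock_act a) (esym (fock_actE lam b u))).
etransitivity; last exact: (esym (fock_actE lam a (b * u))).
exact: (congr1 (fun v => \pi_F v) (esym (mulrA a b u))).
Qed.

Lemma fock_act1 (x : F) : fock_act 1 x = x.
Proof. by elim/quotW: x => u; rewrite fock_actE mul1r. Qed.

Lemma fock_act0 (a : U) : fock_act a (0 : F) = 0.
Proof.
have := fock_act_lin a 1 0 0; rewrite scaler0 addr0 scale1r => h.
by apply: (addrI (fock_act a 0)); rewrite addr0.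
Qed.

Lemma fock_letter_ind (P : F -> Prop) : subspace P -> P (fock_vac lam) ->
  (forall x w, P w -> P (fock_act (letter x) w)) -> forall w, P w.
Proof.
move=> [P0 PD] Pv Pl; elim/quotW => u; elim/quotW: u => t.
have -> : \pi_F (\pi_U t) = fock_act (\pi_U t) (fock_vac lam) by rewrite fock_actE mulr1.
move: t; apply: malg_ind; first split.
- suff -> : fock_act (\pi_U 0) (fock_vac lam) = 0 by [].
  by rewrite lquot_pi0 -[0](subrr (1 : U)) addrC -scaleN1r fock_act_linl scaleN1r addNr.
- move=> k x y hx hy; apply: (eq_ind_r P (PD k _ _ hx hy)).
  etransitivity; last exact: fock_act_linl.
  exact: (congr1 (fun u => fock_act u _) (U_piL k x y)).
move=> [s]; elim: s => [|x s IH].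
  suff -> : << FMonom [::] >> = 1 :> T by rewrite fock_act1.
  by congr << _ >>; apply/val_inj; rewrite /= fm1.
have -> : << FMonom (x :: s) >> = uea_letter x * << FMonom s >> :> T.
  by rewrite malgM_def fgmulUU mulr1; congr << _ >>; apply/val_inj; rewrite /= fmM fmuE.
apply: (eq_ind_r P (Pl x _ IH)); etransitivity; last exact: fock_act_mul.
exact: (congr1 (fun u => fock_act u _) (esym (uea_mulE _ _ _))).
Qed.

Lemma fock_relationE (u : U) : fock_relation lam u -> \pi_F u = 0.
Proof.
move=> ru; rewrite -(lquot_pi0 (fun a x : U => a * x) (@fock_relation C lam)).
apply/(@lquot_eqP _ _ _ (fun a x : U => a * x) (@fock_relation C lam)).
by rewrite subr0; apply: gen_submod_gen.
Qed.

(** The relation K = 1 is imposed on the vacuum; it spreads to the whole module because K is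
    central. *)
Lemma fock_act_K (w : F) : fock_act (U_K C) w = w.
Proof.
pattern w; apply: fock_letter_ind w => /=; first split.
- exact: fock_act0.
- by move=> k x y hx hy; rewrite fock_act_lin hx hy.
- rewrite fock_actE mulr1 -[U_K C](subrK (1 : U)) lquot_piD fock_relationE ?add0r //.
  by constructor.
move=> x w IH; rewrite -fock_act_mul letter_bracket.
have -> : heis_bracket (heis_K C) x = 0.
  by rewrite /heis_bracket /= msupp0 big_seq_fset0.
have -> : letter 0 = 0.
  have := letter_lin 1 0 0; rewrite scaler0 addr0 scale1r => h.
  by apply: (addrI (letter 0)); rewrite addr0.
by rewrite addr0 fock_act_mul IH.
Qed.

(** An arbitrary letter is a multiple of K, which acts as a scalar, plus a linear combination of the
    alpha(n). *)
Lemma fock_generated : generated_by (fock_vac lam) (@fock_alpha C lam).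
Proof.
move=> P [P0 PD] Pv Pa; apply: fock_letter_ind => // -[p j] w Pw.
have -> : (p, j) = (j : C) *: heis_K C + (p, 0) :> heis C.
  apply/eqP; rewrite -pair_eqE /=; apply/andP; split; apply/eqP.
    by rewrite /= scaler0 add0r.
  by rewrite /= addr0 /GRing.scale /= mulr1.
rewrite letter_lin fock_act_linl fock_act_K; apply: (PD) => //.
move: p; apply: malg_ind; first split.
- have -> : letter (0, 0) = 0.
    have := letter_lin 1 0 0; rewrite scaler0 addr0 scale1r => h.
    by apply: (addrI (letter 0)); rewrite addr0.
  by rewrite -[0](subrr (1 : U)) addrC -scaleN1r fock_act_linl scaleN1r addNr.
- move=> k x y hx hy.
  have -> : (k *: x + y, 0) = k *: (x, 0) + (y, 0) :> heis C.
    by apply/eqP; rewrite -pair_eqE /= scaler0 addr0 !eqxx.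
  apply: (eq_ind_r P (PD k _ _ hx hy)).
  etransitivity; last exact: fock_act_linl.
  exact: (congr1 (fun u => fock_act u w) (letter_lin k _ _)).
by move=> n; apply: Pa.
Qed.

Lemma fock_alpha_lin n (k : C) (x y : F) :
  fock_alpha n (k *: x + y) = k *: fock_alpha n x + fock_alpha n y.
Proof. exact: fock_act_lin. Qed.

Lemma fock_alpha_heis (m n : int) (w : F) :
  fock_alpha m (fock_alpha n w) - fock_alpha n (fock_alpha m w) =
  (if m + n == 0 then m%:~R else 0) *: w.
Proof.
rewrite /fock_alpha.
have -> : fock_act (U_alpha C m) (fock_act (U_alpha C n) w) =
    fock_act (U_alpha C n * U_alpha C m +
      letter (heis_bracket (heis_elt (alpha C) m) (heis_elt (alpha C) n))) w.
  by rewrite -fock_act_mul; congr fock_act; exact: letter_bracket.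
rewrite -fock_act_mul.
set k : C := if _ then _ else _.
have -> : heis_bracket (heis_elt (alpha C) m) (heis_elt (alpha C) n) = k *: heis_K C + 0.
  rewrite addr0 /heis_bracket /heis_elt /=; apply/eqP; rewrite -pair_eqE /= scaler0 eqxx /=.
  rewrite msuppU oner_eq0 big_seq_fset1 mcoeffUU mcoeffU /cform mul1r.
  rewrite /k -addr_eq0 [n + m]addrC /GRing.scale /= mulr1; apply/eqP.
  by case: ifP => _; rewrite ?mulr0 ?mulr1.
have l0 : letter 0 = 0.
  have := letter_lin 1 0 0; rewrite scaler0 addr0 scale1r => h.
  by apply: (addrI (letter 0)); rewrite addr0.
have E : letter (k *: heis_K C + 0) = k *: U_K C.
  by rewrite letter_lin l0 addr0.
rewrite E; set u := U_alpha C n * _.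
have -> : fock_act (u + k *: U_K C) w = k *: w + fock_act u w.
  by rewrite addrC fock_act_linl fock_act_K.
by rewrite addrK.
Qed.

Lemma fock_alpha_vac (n : nat) : fock_alpha n.+1%:Z (fock_vac lam) = 0.
Proof. by rewrite /fock_alpha fock_actE mulr1 fock_relationE //; constructor. Qed.

Lemma fock_alpha0_vac : fock_alpha 0 (fock_vac lam) = cform (alpha C) lam *: fock_vac lam.
Proof.
rewrite /fock_alpha fock_actE mulr1.
rewrite -[U_alpha C 0](subrK (cform (alpha C) lam *: (1 : U))) lquot_piD.
by rewrite fock_relationE ?add0r ?lquot_piZ //; constructor.
Qed.

End FockStructure.

Section FockField.
Variables (C : numClosedFieldType) (lam : cartan C).
Local Notation M := (fock lam).
Local Notation alM := (@fock_alpha C lam).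

Lemma fock_alpha_trunc_aux (w : M) : exists N : nat, forall n : nat, (N <= n)%N -> alM n%:Z
  w = 0.
Proof.
pattern w; apply: fock_generated w => /=; first split.
- by exists 0%N => n _; exact: fock_act0.
- move=> k x y [N1 h1] [N2 h2]; exists (maxn N1 N2) => n; rewrite geq_max => /andP[/h1 e1
  /h2 e2].
  by rewrite fock_alpha_lin e1 e2 scaler0 addr0.
- by exists 1%N => -[|n] // _; exact: fock_alpha_vac.
move=> m w' [N h]; exists (maxn N `|m|.+1) => n; rewrite geq_max => /andP[/h e lt_mn].
have := fock_alpha_heis n%:Z m w'; rewrite e [alM m 0]fock_act0 subr0 => ->.
by rewrite ifF ?scale0r //; apply/eqP; lia.
Qed.

Lemma fock_isfield : isfield alM.
Proof.
split; first exact: fock_alpha_lin.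
move=> w; have [N h] := fock_alpha_trunc_aux w.
by exists N%:Z => -[n|n] // /h.
Qed.

End FockField.

(** * Existence of the state-field map *)

Section StateFieldExists.
Variables (C : numClosedFieldType) (M : lmodType C) (alM : int -> M -> M).
Local Notation sbin := (sbin C).
Local Notation V := (M1 C).
Hypothesis fM : isfield alM.
Hypothesis heisM : forall (m n : int) w, alM m (alM n w) - alM n (alM m w) =
    (if m + n == 0 then m%:~R else 0) *: w.

Definition idf (n : int) (w : M) : M := if n == -1 then w else 0.

Lemma idf_field : isfield idf.
Proof.
split=> [n k x y|w]; rewrite /idf; first by case: ifP => // _; rewrite scaler0 addr0.
by exists 0 => n n0; case: eqP n0 => // ->.
Qed.

(** For l >= 0 the right side of [sbin_delta] is zero, so the two halves of the product cancel. Thus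
    the identity field satisfies the relations of the vacuum of M(1,0). *)
Lemma prod_idf (l : nat) q w : prod alM idf l q w = 0.
Proof.
rewrite /prod; pose X := alM (q + l%:Z + 1) w.
pose F1 (t : nat) : M := (if - 1 - q == t%:Z then sbin l t else 0) *: X.
pose F2 (t : nat) : M := (if q + l%:Z + 1 == t%:Z then sbin l t else 0) *: X.
have fF1 : fs F1.
  exists (absz (- 1 - q)%R).+1 => j lt_j; rewrite /F1 ifF ?scale0r //; apply/eqP; lia.
have fF2 : fs F2.
  exists (absz (q + l%:Z + 1)%R).+1 => j lt_j; rewrite /F2 ifF ?scale0r //; apply/eqP; lia.
rewrite (@eq_nsum _ _ (fun t => F1 t - (-1) ^ l%:Z *: F2 t)).
  rewrite (nsumB fF1 (fsZ (fun=> _) fF2)) -(scaler_nsum _ fF2).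
  rewrite (@nsum_zb _ _ (sbin l) (- 1 - q) X); last by move=> j; rewrite /F1; case: ifP;
    rewrite ?scale0r.
  rewrite (@nsum_zb _ _ (sbin l) (q + l%:Z + 1) X); last by move=> j; rewrite /F2; case:
    ifP; rewrite ?scale0r.
  have := sbin_delta C l%:Z q; rewrite [RHS]zb_neg => [/eqP|]; last by lia.
  rewrite subr_eq0 => /eqP ->.
  by rewrite scalerA mulrA m1z_sq mul1r subrr.
move=> t; rewrite /idf /F1 /F2 scalerBr; congr (_ - _).
  have [E|nE] := eqVneq (q + t%:Z) (-1).
    have -> : - 1 - q == t%:Z by apply/eqP; lia.
    by congr (_ *: alM _ _); lia.
  by rewrite (field0 fM) scaler0 ifF ?scale0r //; apply/eqP; move/eqP: nE; lia.
rewrite scalerA mulrC -scalerA; congr (_ *: _).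
have [E|nE] := eqVneq (q + l%:Z - t%:Z) (-1).
  have -> : q + l%:Z + 1 == t%:Z by apply/eqP; lia.
  by congr (_ *: alM _ _); lia.
by rewrite scaler0 ifF ?scale0r //; apply/eqP; move/eqP: nE; lia.
Qed.

Lemma state_field_exists : exists Y : V -> int -> M -> M,
  state_field (vacuum C) (@M1_alpha C) alM Y.
Proof.
pose W : lmodType C := (int -> M -> M).
pose A (l : int) (b : W) : W := prod alM b l.
have S_sub : @subspace C W (@isfield C M).
  split; first by split=> [n k x y|w]; [rewrite scaler0 addr0|exists 0].
  move=> k x y fx fy; split=> [n c u v|w].
    have E z : (k *: x + y) n z = k *: x n z + y n z by [].
    rewrite !E.
    by rewrite (field_lin fx) (field_lin fy); lmod C.
  have [N1 h1] := field_trunc fx w; have [N2 h2] := field_trunc fy w.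
  exists (Num.max N1 N2) => n; rewrite ge_max => /andP[/h1 e1 /h2 e2].
  by rewrite -[LHS]/(k *: x n w + y n w) e1 e2 scaler0 addr0.
have A_S (n : int) (b : W) : isfield b -> isfield (A n b) := field_prod n fM.
have A_lin (n : int) (k : C) (b c : W) : isfield b -> isfield c ->
    A n (k *: b + c) = k *: A n b + A n c.
  move=> fb fc; apply/funext => q; apply/funext => w.
  rewrite -[RHS]/(k *: A n b q w + A n c q w) /A /prod.
  have f1 := fs_prod n q w fM fb; have f2 := fs_prod n q w fM fc.
  rewrite (scaler_nsum _ f1) -(nsumD (fsZ (fun=> k) f1) f2); apply: eq_nsum => t.
  rewrite -[(k *: b + c) _ _]/(k *: b (q + t%:Z) w + c (q + t%:Z) w).
  rewrite -[(k *: b + c) (q + n - _) _]/(k *: b (q + n - t%:Z) (alM t%:Z w) + c (q + n -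
    t%:Z) (alM t%:Z w)).
  by rewrite (field_lin fM); lmod C.
have A_heis (m n : int) (b : W) : isfield b ->
    A m (A n b) - A n (A m b) = (if m + n == 0 then m%:~R else 0) *: b.
  move=> fb; apply/funext => q; apply/funext => w.
  exact: (boson_products fM heisM m n q w fb).
have A_pos (n : nat) : A n.+1%:Z idf = 0.
  by apply/funext => q; apply/funext => w; exact: prod_idf.
have A_zero : A 0 idf = cform (alpha C) (0 : cartan C) *: (idf : W).
  rewrite /cform mulr0 scale0r; apply/funext => q; apply/funext => w.
  exact: (prod_idf 0).
have [Y [Yv Yl Ya Yf]] := fock_universal S_sub A_S A_lin A_heis idf_field A_pos A_zero.
exists Y; split=> //.
- by move=> k u v n w; rewrite Yl.
- by move=> n w; rewrite /vacuum Yv.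
- by move=> l u n w; rewrite /M1_alpha Ya.
Qed.

End StateFieldExists.

Lemma M1_ann (C : numClosedFieldType) (i : nat) : M1_alpha i%:Z (vacuum C) = 0.
Proof.
case: i => [|i]; last exact: fock_alpha_vac.
by rewrite /M1_alpha /vacuum fock_alpha0_vac /cform mulr0 scale0r.
Qed.

(** * Highest weight modules over the Heisenberg algebra *)

Section Spans.
Variables (C : numClosedFieldType) (M : lmodType C).

Definition spanned (G : M -> Prop) (w : M) : Prop :=
  forall P : M -> Prop, subspace P -> (forall g, G g -> P g) -> P w.

Lemma spanned_subspace G : subspace (spanned G).
Proof.
split=> [P [P0 _] _ //|k x y hx hy P sP GP].
by apply: sP.2; [apply: hx|apply: hy].
Qed.

Lemma spanned_gen G g : G g -> spanned G g.
Proof. by move=> Gg P _; apply. Qed.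

Lemma subspaceZ (P : M -> Prop) (k : C) w : subspace P -> P w -> P (k *: w).
Proof. by move=> [P0 PD] Pw; rewrite -[k *: w]addr0; apply: PD. Qed.

Variable T : M -> M.
Hypothesis T_lin : forall (k : C) x y, T (k *: x + y) = k *: T x + T y.

Lemma T_sum n (k : 'I_n -> C) (p : 'I_n -> M) :
  T (\sum_(i < n) k i *: p i) = \sum_(i < n) k i *: T (p i).
Proof.
have T0 : T 0 = 0.
  have := T_lin 1 0 0; rewrite scaler0 addr0 scale1r => h.
  by apply: (addrI (T 0)); rewrite addr0.
elim: n k p => [|n IH] k p; first by rewrite !big_ord0.
by rewrite !big_ord_recl T_lin IH.
Qed.

Lemma eigenvectors_independent n (mu : nat -> C) (p : nat -> M) :
  injective mu -> (forall i, T (p i) = mu i *: p i) ->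
  \sum_(i < n) p i = 0 -> forall i, (i < n)%N -> p i = 0.
Proof.
move=> mu_inj; elim: n p => // n IH p Tp sum0 i lt_i.
pose q j := (mu j - mu n) *: p j.
have q0 j : (j < n)%N -> p j = 0.
  move=> lt_j; have : q j = 0.
    apply: (IH q) => // [k|].
      rewrite /q; have := T_lin (mu k - mu n) (p k) 0.
      rewrite addr0 => ->; rewrite Tp; have := T_lin 1 0 0.
      rewrite scaler0 addr0 scale1r => h.
      have -> : T 0 = 0 by apply: (addrI (T 0)); rewrite addr0.
      by rewrite addr0 !scalerA mulrC.
    have : T (\sum_(i < n.+1) 1 *: p i) - mu n *: \sum_(i < n.+1) p i = 0.
      have -> : \sum_(i < n.+1) 1 *: p i = 0.
        by under eq_bigr do rewrite scale1r.
      rewrite sum0 scaler0 subr0; have := T_lin 1 0 0.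
      rewrite scaler0 addr0 scale1r => h.
      by apply: (addrI (T 0)); rewrite addr0.
    rewrite T_sum scaler_sumr -sumrB big_ord_recr /= Tp scale1r subrr addr0 => e.
    rewrite -[RHS]e; apply: eq_bigr => k _.
    by rewrite /q Tp scale1r scalerBl.
  move/eqP; rewrite scaler_eq0 subr_eq0 => /orP[/eqP/mu_inj E|/eqP //].
  by rewrite E ltnn in lt_j.
move: lt_i; rewrite ltnS leq_eqVlt => /orP[/eqP->|/q0 //].
move: sum0; rewrite big_ord_recr /= big1 ?add0r // => j _.
exact: q0.
Qed.

End Spans.

Section HighestWeight.
Variables (C : numClosedFieldType) (M : lmodType C).
Variables (vac : M) (al : int -> M -> M) (c h : C) (L0 : M -> M).
Hypothesis fal : isfield al.
Hypothesis heis : forall (m n : int) w, al m (al n w) - al n (al m w) =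
    (if m + n == 0 then m%:~R else 0) *: w.
Hypothesis gen : generated_by vac al.
Hypothesis al_vac : forall n : nat, al n.+1%:Z vac = 0.
Hypothesis al0_vac : al 0 vac = c *: vac.
Hypothesis L0_lin : forall (k : C) x y, L0 (k *: x + y) = k *: L0 x + L0 y.
Hypothesis L0_al : forall (t : int) w, L0 (al t w) = al t (L0 w) - t%:~R *: al t w.
Hypothesis L0_singular : forall w, (forall n : nat, al n.+1%:Z w = 0) -> 
  al 0 w = c *: w -> L0 w = h *: w.

Lemma al_swap (m n : int) w :
  al m (al n w) = al n (al m w) + (if m + n == 0 then m%:~R else 0) *: w.
Proof. by rewrite -heis addrC subrK. Qed.

(** alpha(0) is central, so its eigenvalue on the generating vector is its eigenvalue everywhere. *)
Lemma al0E w : al 0 w = c *: w.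
Proof.
pattern w; apply: gen w => /=; first split.
- by rewrite (field0 fal) scaler0.
- by move=> k x y hx hy; rewrite (field_lin fal) hx hy; lmod C.
- exact: al0_vac.
by move=> n w hw; rewrite al_swap hw (fieldZ fal); case: ifP; rewrite scale0r addr0.
Qed.

Definition monomial (s : seq nat) : M := foldr (fun n v => al (- n%:Z) v) vac s.

Definition is_monomial (w : M) : Prop :=
  exists s, all (leq 1) s /\ w = monomial s.
Definition is_monomial_of (i : nat) (w : M) : Prop :=
  exists s, [/\ all (leq 1) s, sumn s = i & w = monomial s].

Lemma spanned_al (n : int) :
  (forall g, is_monomial g -> spanned is_monomial (al n g)) ->
  forall w, spanned is_monomial w -> spanned is_monomial (al n w).
Proof.
move=> Gn w hw; pattern w; apply: hw => //=.
have [S0 SD] := spanned_subspace is_monomial; split; first by rewrite (field0 fal).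
by move=> k x y hx hy; rewrite (field_lin fal); apply: SD.
Qed.

Lemma al_pos_monomial (n : nat) s : spanned is_monomial (al n.+1%:Z (monomial s)) \/ ~~ all
  (leq 1) s.
Proof.
elim: s => [|m s IH].
  by left; rewrite /= al_vac; exact: (spanned_subspace _).1.
have [/= /andP[m1 s1]|] := boolP (all (leq 1) (m :: s)); last by right.
left; rewrite al_swap addrC; apply: (spanned_subspace _).2.
  by apply: spanned_gen; exists s.
case: IH => [|/negP//]; apply: spanned_al => _ [s' [s'1 ->]].
by apply: spanned_gen; exists (m :: s') => /=; rewrite m1.
Qed.

(** A positive mode travels to the right through a monomial, where each bracket leaves a shorter
    monomial, and finally kills [vac]; a negative mode extends the monomial. *)
Lemma PBW_span w : spanned is_monomial w.
Proof.
apply: (@gen (spanned is_monomial)); first exact: spanned_subspace.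
  by apply: spanned_gen; exists [::].
move=> n {}w; apply: spanned_al => _ [s [s1 ->]].
case: n => [[|n]|n].
- rewrite al0E; apply: (subspaceZ (P := spanned is_monomial)); first exact: spanned_subspace.
  by apply: spanned_gen; exists s.
- by case: (al_pos_monomial n s) => // /negP.
by apply: spanned_gen; exists (n.+1 :: s).
Qed.

Lemma graded w : exists d (p : nat -> M),
  (forall i, spanned (is_monomial_of i) (p i)) /\ w = \sum_(i < d) p i.
Proof.
pattern w; apply: (PBW_span w) => /=.
  split; first by exists 0%N, (fun=> 0); split; [move=> i; exact: (spanned_subspace
    _).1|rewrite big_ord0].
  move=> k x y [d [p [hp ->]]] [d' [p' [hp' ->]]].
  exists (d + d')%N, (fun i => k *: (if (i < d)%N then p i else 0) + (if (i < d')%N then p'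
    i else 0)).
  split=> [i|]; first by apply: (spanned_subspace _).2; case: ifP => // _; exact:
    (spanned_subspace _).1.
  rewrite big_split /= -scaler_sumr; congr (_ *: _ + _).
    rewrite big_split_ord /= [X in _ + X]big1 ?addr0; last by move=> i _; rewrite ltnNge
      leq_addr.
    by apply: eq_bigr => i _; rewrite ltn_ord.
  rewrite addnC big_split_ord /= [X in _ + X]big1 ?addr0; last by move=> i _; rewrite
    ltnNge leq_addr.
  by apply: eq_bigr => i _; rewrite ltn_ord.
move=> _ [s [s1 ->]].
exists (sumn s).+1, (fun i => if i == sumn s then monomial s else 0); split=> [i|].
  case: eqP => [->|_]; last exact: (spanned_subspace _).1.
  by apply: spanned_gen; exists s.
rewrite (bigD1 ord_max) //= eqxx big1 ?addr0 // => i.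
by rewrite -val_eqE /= => /negPf ->.
Qed.

Lemma L0_vac : L0 vac = h *: vac.
Proof. exact: L0_singular. Qed.

Lemma L0_monomial s : L0 (monomial s) = (h + (sumn s)%:R) *: monomial s.
Proof.
elim: s => [|m s IH] /=; first by rewrite addr0 L0_vac.
rewrite L0_al IH (fieldZ fal) rmorphN /= natrD; lmod C.
Qed.

Lemma L0_spanned i w : spanned (is_monomial_of i) w -> L0 w = (h + i%:R) *: w.
Proof.
move=> hw; pattern w; apply: hw => /= [|_ [s [_ <- ->]]]; last exact: L0_monomial.
split=> [|k x y hx hy]; last by rewrite L0_lin hx hy; lmod C.
have := L0_lin 1 0 0; rewrite !scaler0 addr0 scale1r => e.
by apply: (addrI (L0 0)); rewrite addr0.
Qed.

(** Applying L0 - nu to the graded decomposition of w gives a vanishing sum of eigenvectors with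
    distinct eigenvalues h + i. So (h + i - nu) p_i = 0 for each i, and at most one component is
    nonzero. *)
Lemma L0_eigen nu w : L0 w = nu *: w ->
  w = 0 \/ exists i : nat, nu = h + i%:R /\ spanned (is_monomial_of i) w.
Proof.
move=> Lw; have [d [p [hp def_w]]] := graded w.
have Lp i : L0 (p i) = (h + i%:R) *: p i by apply: L0_spanned.
have h_inj : injective (fun i : nat => h + i%:R).
  by move=> i j /addrI /eqP; rewrite eqr_nat => /eqP.
have z i : (i < d)%N -> (h + i%:R - nu) *: p i = 0.
  apply: (eigenvectors_independent L0_lin h_inj (p := fun i => (h + i%:R - nu) *: p i)).
    move=> j; have := L0_lin (h + j%:R - nu) (p j) 0; rewrite addr0 => ->.
    have := L0_lin 1 0 0; rewrite !scaler0 addr0 scale1r => e.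
    have -> : L0 0 = 0 by apply: (addrI (L0 0)); rewrite addr0.
    by rewrite Lp addr0 !scalerA mulrC.
  have := T_sum L0_lin (fun=> 1) (fun i : 'I_d => p i).
  under eq_bigr do rewrite scale1r.
  rewrite -def_w Lw {1}def_w scaler_sumr => /esym/eqP; rewrite -subr_eq0 -sumrB => /eqP e.
  rewrite -[RHS]e; apply: eq_bigr => j _; rewrite scale1r Lp; lmod C.
have [[i [lt_i ei]]|ne] := pselect (exists i, (i < d)%N /\ h + i%:R = nu).
  right; exists i; split=> //; rewrite def_w (bigD1 (Ordinal lt_i)) //= big1 ?addr0 //.
  move=> j; rewrite -val_eqE /= => nij; have /eqP := z j (ltn_ord j).
  rewrite scaler_eq0 subr_eq0 -ei => /orP[/eqP/h_inj eij|/eqP //].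
  by rewrite eij eqxx in nij.
left; rewrite def_w big1 // => i _; have /eqP := z i (ltn_ord i).
rewrite scaler_eq0 subr_eq0 => /orP[/eqP e|/eqP //].
by case: ne; exists i; rewrite ltn_ord.
Qed.

Lemma spanned0 w : spanned (is_monomial_of 0) w -> exists k : C, w = k *: vac.
Proof.
move=> hw; pattern w; apply: hw => /= [|_ [s [s1 s0 ->]]].
  split; first by exists 0; rewrite scale0r.
  by move=> k x y [a ->] [b ->]; exists (k * a + b); lmod C.
by case: s s1 s0 => [_ _|[|m] s] //; exists 1; rewrite scale1r.
Qed.

Lemma spanned_finite i : finite_dimensional (spanned (is_monomial_of i)).
Proof.
(* A partition of i has at most i parts, each at most i, so the monomials of degree i are indexed by
   a finite type. *)
pose K := {bseq i of 'I_i.+1}.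
pose e (j : 'I_#|{: K}|) : M := monomial (map val (enum_val j : K)).
exists #|{: K}|, e => w hw; pattern w; apply: hw => /= [|_ [s [s1 si ->]]].
  split; first by exists (fun=> 0); rewrite big1 // => j _; rewrite scale0r.
  move=> k x y [a ->] [b ->]; exists (fun j => k * a j + b j).
  by rewrite scaler_sumr -big_split; apply: eq_bigr => j _; rewrite /= scalerDl scalerA.
have le_s : (size s <= i)%N.
  rewrite -si; elim: s s1 {si} => //= m s IH /andP[m1 /IH]; lia.
have sz : (size [seq (inord n : 'I_i.+1) | n <- s] <= i)%N by rewrite size_map.
pose t : K := Bseq sz.
exists (fun j => if j == enum_rank t then 1 else 0).
rewrite (bigD1 (enum_rank t)) //= eqxx scale1r big1 ?addr0.
  rewrite /e enum_rankK /= -map_comp; congr monomial.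
  rewrite -[LHS]map_id; apply/eq_in_map => n n_s /=; rewrite inordK //.
  rewrite ltnS -si; elim: s n_s {s1 si le_s sz t} => //= m s IH.
  by rewrite inE => /orP[/eqP->|/IH]; lia.
by move=> j /negPf ->; rewrite scale0r.
Qed.

Lemma singular_vac w : (forall n : nat, al n.+1%:Z w = 0) -> exists k : C, w = k *: vac.
Proof.
move=> hw; have Lw := L0_singular hw (al0E w).
have [->|[i [ei]]] := L0_eigen Lw; first by exists 0; rewrite scale0r.
have -> : i = 0%N.
  apply/eqP; rewrite -(eqr_nat C); apply/eqP; apply: (addrI h).
  by rewrite -ei addr0.
exact: spanned0.
Qed.

(** Every product of d positive modes kills w. This serves as an induction measure on vectors that
    need not be homogeneous. *)
Fixpoint annihilated (d : nat) (w : M) : Prop :=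
  if d is d'.+1 then forall n : nat, annihilated d' (al n.+1%:Z w) else w = 0.

Lemma annihilated_subspace d : subspace (annihilated d).
Proof.
elim: d => [|d [IH0 IHD]] /=; split=> //.
- by move=> k x y -> ->; rewrite scaler0 addr0.
- by move=> n; rewrite (field0 fal).
by move=> k x y hx hy n; rewrite (field_lin fal); apply: IHD.
Qed.

Lemma annihilatedS d w : annihilated d w -> annihilated d.+1 w.
Proof.
elim: d w => [w -> n|d IH w hw n]; first by rewrite (field0 fal).
exact: IH.
Qed.

Lemma annihilated_leq d d' w : (d <= d')%N -> annihilated d w -> annihilated d' w.
Proof. by move=> /subnK <-; elim: (d' - d)%N => // k IH /IH /annihilatedS. Qed.

Lemma annihilated_neg d (m : nat) w : annihilated d w -> annihilated d.+1 (al (- m%:Z) w).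
Proof.
elim: d w => [w -> n|d IH w hw n]; first by rewrite !(field0 fal).
rewrite al_swap addrC; apply: (annihilated_subspace d.+1).2; first exact: hw.
exact: IH.
Qed.

Lemma annihilated_ex w : exists d, annihilated d w.
Proof.
pattern w; apply: gen w => /=; first split.
- by exists 0%N.
- move=> k x y [d hx] [d' hy]; exists (maxn d d'); apply: (annihilated_subspace _).2.
    by apply: annihilated_leq hx; rewrite leq_maxl.
  by apply: annihilated_leq hy; rewrite leq_maxr.
- by exists 1%N => n; rewrite al_vac.
move=> [[|n]|n] w [d hw].
- by exists d; rewrite al0E; apply: subspaceZ => //; exact: annihilated_subspace.
- by exists d; case: d hw => [->|d hw]; [rewrite /= (field0 fal)|apply: annihilatedS;
  exact: hw].
by exists d.+1; rewrite NegzE; apply: annihilated_neg.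
Qed.

(** From a nonzero vector of [P], positive modes lead within [P] to a nonzero singular vector, which
    is a multiple of [vac]. *)
Lemma submodule_full (P : M -> Prop) : subspace P -> (forall n w, P w -> P (al n w)) ->
  (forall w, P w -> w = 0) \/ (forall w, P w).
Proof.
move=> sP Pal; have [[w [Pw nw]]|no] := pselect (exists w, P w /\ w != 0); last first.
  by left=> w Pw; apply/eqP; apply: contrapT => /negP nw; apply: no; exists w.
right; apply: gen => //.
have [d hd] := annihilated_ex w.
elim: d w Pw nw hd => [w _ /eqP //|d IH w Pw nw hw].
have [[n nn]|all0] := pselect (exists n : nat, al n.+1%:Z w != 0).
  by apply: IH (nn) (hw n); apply: Pal.
have [k def_w] : exists k : C, w = k *: vac.
  apply: singular_vac => n; apply/eqP; apply: contrapT => /negP nn.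
  by apply: all0; exists n.
have k0 : k != 0 by apply: contraNneq nw => k0; rewrite def_w k0 scale0r.
rewrite -[vac](scalerK k0) -def_w; exact: subspaceZ.
Qed.

(** The kernel is stable under the modes, so by induction every positive mode kills a vector of the
    kernel. Such a vector is a multiple of [vac], whose image is nonzero. *)
Lemma intertwiner_injective (F : lmodType C) (B : int -> F -> F) (f : M -> F) :
  (forall (k : C) x y, f (k *: x + y) = k *: f x + f y) ->
  (forall n w, f (al n w) = B n (f w)) -> (forall n, B n 0 = 0) -> f vac != 0 ->
  forall w, f w = 0 -> w = 0.
Proof.
move=> flin fal' B0 fv w; have [d hd] := annihilated_ex w.
elim: d w hd => [w -> //|d IH w hw fw].
have [k def_w] : exists k : C, w = k *: vac.
  by apply: singular_vac => n; apply: IH; rewrite ?fal' ?fw ?B0.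
have : f w = k *: f vac.
  have := flin k vac 0; rewrite addr0 -def_w => ->.
  have := flin 1 0 0; rewrite !scaler0 addr0 scale1r => e.
  have -> : f 0 = 0 by apply: (addrI (f 0)); rewrite addr0.
  by rewrite addr0.
rewrite fw => /esym/eqP; rewrite scaler_eq0 (negPf fv) orbF => /eqP k0.
by rewrite def_w k0 scale0r.
Qed.

End HighestWeight.

(* Locked, since failing conversion problems between monomials take too long. *)
HB.lock Definition cmup (i : nat) (m : {cmonom nat}) : {cmonom nat} := mmul (ucm i) m.
HB.lock Definition cmdn (i : nat) (m : {cmonom nat}) : {cmonom nat} := divcm m (ucm i).

Lemma cmupE i m k : cmup i m k = ((i == k) + m k)%N.
Proof. by rewrite cmup.unlock cmM cmU. Qed.

Lemma cmdnE i m k : cmdn i m k = (m k - (i == k))%N.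
Proof. by rewrite cmdn.unlock divcmE cmU. Qed.

HB.lock Definition pmono (C : numClosedFieldType) (m : {cmonom nat}) :
  {malg C[{cmonom nat}]} := << m >>.

Lemma pmono_ind (C : numClosedFieldType) (P : {malg C[{cmonom nat}]} -> Prop) :
  subspace P -> (forall m, P (pmono C m)) -> forall t, P t.
Proof. by move=> sP Pm; apply: malg_ind => // m; have := Pm m; rewrite pmono.unlock. Qed.

(** * The polynomial model and its Hermitian form *)

Section PolynomialModes.
Variables (C : numClosedFieldType) (c : C).
Local Notation F := {malg C[{cmonom nat}]}.
Implicit Types (m : {cmonom nat}).

(* In the polynomial ring in variables [x_0, x_1, ...] the mode [-(i + 1)] is
   multiplication by [x_i], and the mode [i + 1] is [(i + 1) d/dx_i]. *)
Definition pmode (n : int) m : F :=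
  match n with
  | Posz 0 => c *: (pmono C m)
  | Posz i.+1 => (i.+1 * m i)%:R *: pmono C (cmdn i m)
  | Negz i => pmono C (cmup i m)
  end.

End PolynomialModes.

HB.lock Definition pact (C : numClosedFieldType) (c : C) (n : int)
  (x : {malg C[{cmonom nat}]}) : {malg C[{cmonom nat}]} := mlin (pmode c n) x.

Section PolynomialModel.
Variables (C : numClosedFieldType) (c : C).
Local Notation F := {malg C[{cmonom nat}]}.
Local Notation pact := (pact c).
Implicit Types (m : {cmonom nat}).

Lemma pact_lin n (k : C) x y : pact n (k *: x + y) = k *: pact n x + pact n y.
Proof. by rewrite pact.unlock mlin_lin. Qed.

Lemma pact_0 n : pact n 0 = 0.
Proof. by rewrite pact.unlock mlin0. Qed.

Lemma pactZ n (k : C) x : pact n (k *: x) = k *: pact n x.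
Proof. by rewrite pact.unlock mlinZ. Qed.

Lemma pactU n m : pact n (pmono C m) = pmode c n m.
Proof. by rewrite pact.unlock pmono.unlock mlinU scale1r. Qed.

Lemma pact_pos (i : nat) m :
  pact i.+1%:Z (pmono C m) = (i.+1 * m i)%:R *: pmono C (cmdn i m).
Proof. by rewrite pactU. Qed.

Lemma pact_neg (i : nat) m : pact (Negz i) (pmono C m) = pmono C (cmup i m).
Proof. by rewrite pactU. Qed.

Lemma cm_eq m m' : (forall i, m i = m' i) -> m = m'.
Proof. by move=> h; apply/eqP/cmP. Qed.

Lemma pact0 x : pact 0 x = c *: x.
Proof.
move: x; apply: pmono_ind; last by move=> m; rewrite pactU.
by split=> [|k x y hx hy]; [rewrite pact_0 scaler0|rewrite pact_lin hx hy; lmod C].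
Qed.

Lemma scalerB_shift (V : lmodType C) (a b k : C) (v : V) :
  a = k + b -> a *: v - b *: v = k *: v.
Proof. by move=> ->; rewrite scalerDl addrK. Qed.

Lemma pact_pos_neg (i j : nat) m :
  pact i.+1%:Z (pact (Negz j) (pmono C m)) - pact (Negz j) (pact i.+1%:Z (pmono C m)) =
  (if i.+1%:Z + Negz j == 0 then (i.+1%:Z)%:~R else 0) *: (pmono C m).
Proof.
rewrite pact_neg !pact_pos pactZ pact_neg cmupE.
have [->|nij] := eqVneq i j; last first.
  rewrite add0n (_ : (_ == 0) = false); last by apply/eqP; move/eqP: nij; lia.
  (* If x_i does not occur in m, the division in [cmdn i] truncates, but then the coefficient [m i]
     is zero. *)
  rewrite scale0r; case: (posnP (m i)) => [->|m_i]; first by rewrite muln0 !scale0r subrr.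
  have -> : cmdn i (cmup j m) = (cmup j (cmdn i m)).
    apply: cm_eq => k; rewrite cmdnE !cmupE cmdnE.
    by have [<-|_] := eqVneq i k; have [E|_] := eqVneq j k; rewrite ?E ?eqxx in nij *; lia.
  by rewrite subrr.
rewrite (_ : _ + _ == 0); last by apply/eqP; lia.
have -> : cmdn j (cmup j m) = m.
  by apply: cm_eq => k; rewrite cmdnE cmupE addKn.
case: (posnP (m j)) => [->|m_j]; first by rewrite addn0 muln1 muln0 scale0r subr0.
have -> : (cmup j (cmdn j m)) = m.
  apply: cm_eq => k; rewrite cmupE cmdnE.
  by have [<-|_] := eqVneq j k; rewrite /= ?add0n ?subn0 // subnKC.
apply: scalerB_shift.
rewrite add1n mulnS natrD //.
Qed.

Lemma pact_heis (n k : int) x : pact n (pact k x) - pact k (pact n x) =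
  (if n + k == 0 then n%:~R else 0) *: x.
Proof.
move: x; apply: pmono_ind.
  split=> [|a x y hx hy]; first by rewrite !pact_0 subrr scaler0.
  rewrite !pact_lin.
  transitivity (a *: (pact n (pact k x) - pact k (pact n x)) + (pact n (pact k y) - pact k
    (pact n y))).
    by lmod C.
  by rewrite hx hy; lmod C.
move=> m; case: n => [[|i]|i].
- by rewrite !pact0 pactZ subrr; case: ifP; rewrite scale0r.
- case: k => [[|j]|j]; last exact: pact_pos_neg.
    rewrite (_ : (_ == 0) = false) ?scale0r; last by apply/eqP; lia.
    by rewrite !pact0 pactZ subrr.
  rewrite (_ : (_ == 0) = false) ?scale0r; last by apply/eqP; lia.
  rewrite !pact_pos !pactZ !pact_pos !scalerA -!natrM !cmdnE.
  have [->|nij] := eqVneq i j; first by rewrite subrr.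
  rewrite !subn0.
  have -> : cmdn i (cmdn j m) = cmdn j (cmdn i m).
    by apply: cm_eq => k; rewrite !cmdnE; lia.
  by rewrite mulnC subrr.
case: k => [[|j]|j].
- rewrite (_ : (_ == 0) = false) ?scale0r; last by apply/eqP; lia.
  by rewrite !pact0 pactZ subrr.
- rewrite -(opprB (pact j.+1%:Z _)) (pact_pos_neg j i m) -scaleNr.
  apply: (congr1 (fun k : C => k *: pmono C m)).
  have -> : (Negz i + j.+1%:Z == 0) = (j.+1%:Z + Negz i == 0) by rewrite addrC.
  case: ifP => [/eqP E|_]; last by rewrite oppr0.
  by rewrite -rmorphN; congr (_%:~R); lia.
rewrite (_ : (_ == 0) = false) ?scale0r; last by apply/eqP; lia.
rewrite !pact_neg.
have -> : cmup i (cmup j m) = cmup j (cmup i m).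
  by apply: cm_eq => k; rewrite !cmupE addnCA.
by rewrite subrr.
Qed.

(** The squared norm of a monomial. Adjointness of alpha(i + 1) and alpha(-i - 1) forces the
    recursion [pnormU], and this product is its solution with value 1 on the empty monomial. *)
Definition pnorm m : nat := \prod_(i <- finsupp m) (i.+1 ^ m i * (m i)`!)%N.

Lemma pnormEw (d : {fset nat}) m : (finsupp m `<=` d)%fset ->
  pnorm m = (\prod_(i <- d) (i.+1 ^ m i * (m i)`!)%N)%N.
Proof.
move=> sub; rewrite /pnorm; apply: big_fset_incl => // i _ i_m.
by rewrite -cmE_eq0 in i_m; rewrite (eqP i_m) expn0 fact0.
Qed.

Lemma pnorm_gt0 m : (0 < pnorm m)%N.
Proof. by apply: prodn_gt0 => i; rewrite muln_gt0 expn_gt0 fact_gt0. Qed.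

Lemma pnormU i m : pnorm (cmup i m) = (i.+1 * (m i).+1 * pnorm m)%N.
Proof.
pose d := (i |` (finsupp m `|` finsupp (cmup i m)))%fset.
rewrite !(@pnormEw d); first last.
- by apply/fsubsetP => k; rewrite !inE => ->; rewrite !orbT.
- by apply/fsubsetP => k; rewrite !inE => ->; rewrite !orbT.
have di : i \in d by rewrite !inE eqxx.
rewrite !(big_fsetD1 i di) /= cmupE eqxx add1n expnS factS.
rewrite (eq_big_seq (fun j => j.+1 ^ m j * (m j)`!)%N) => [|j]; first by rewrite /=; lia.
by rewrite !inE => /andP[ji _]; rewrite cmupE eq_sym (negPf ji).
Qed.

Definition pform (x y : F) : C :=
  (mlin (fun m => (Num.conj y@_m * (pnorm m)%:R : C^o)) x : C^o).

Lemma pform_linl (k : C) x y z : pform (k *: x + y) z = k * pform x z + pform y z.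
Proof. by rewrite /pform mlin_lin. Qed.

Lemma pform_sym x y : pform y x = Num.conj (pform x y).
Proof.
rewrite /pform !(@mlinEw _ _ _ _ (msupp x `|` msupp y)%fset) ?fsubsetUl ?fsubsetUr //.
rewrite rmorph_sum; apply: eq_bigr => m _ /=.
rewrite /GRing.scale /= !rmorphM /= conjCK rmorph_nat; ring.
Qed.

Lemma pform_linr (k : C) x y z : pform z (k *: x + y) = Num.conj k * pform z x + pform z y.
Proof. by rewrite pform_sym pform_linl rmorphD rmorphM /= -!pform_sym. Qed.

Lemma pform0l x : pform 0 x = 0.
Proof. by rewrite /pform mlin0. Qed.

Lemma pform0r x : pform x 0 = 0.
Proof. by rewrite pform_sym pform0l conjC0. Qed.

Lemma pform_pos x : x != 0 -> 0 < pform x x.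
Proof.
move=> x0.
have pE : pform x x = \sum_(m <- msupp x) `|x@_m| ^+ 2 * (pnorm m)%:R.
  by apply: eq_bigr => m _; rewrite normCK -mulrA.
rewrite pE lt_def; apply/andP; split; last first.
  by apply: sumr_ge0 => m _; rewrite mulr_ge0 ?exprn_ge0 ?ler0n.
apply: contraNneq x0 => /eqP; rewrite psumr_eq0; last first.
  by move=> m _; rewrite mulr_ge0 ?exprn_ge0 ?ler0n.
move=> /allP z; rewrite -msupp_eq0; apply/eqP/fsetP => m; rewrite inE.
apply/negP => mx; have := z m mx; rewrite /= mulf_eq0 pnatr_eq0 -[pnorm m == _]negbK.
rewrite -lt0n pnorm_gt0 orbF expf_eq0 /= normr_eq0 => /eqP xm.
by rewrite -mcoeff_neq0 xm eqxx in mx.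
Qed.

Hypothesis c_real : Num.conj c = c.

Lemma pformUU m m' : pform (pmono C m) (pmono C m') = (m' == m)%:R * (pnorm m)%:R.
Proof.
rewrite pmono.unlock /pform mlinU scale1r mcoeffU1.
by rewrite rmorph_nat.
Qed.

Lemma pform_adj_pos (i : nat) x y : pform (pact i.+1%:Z x) y = pform x (pact (Negz i) y).
Proof.
move: x y; apply: pmono_ind.
  split=> [y|k x x' hx hx' y]; last by rewrite pact_lin !pform_linl hx hx'.
  by rewrite pact_0 !pform0l.
move=> m; apply: pmono_ind.
  split=> [|k y y' hy hy']; last by rewrite pact_lin !pform_linr hy hy'.
  by rewrite pact_0 !pform0r.
move=> m'; rewrite pact_pos pact_neg.
rewrite -[_ *: _]addr0 pform_linl pform0l addr0.
rewrite !pformUU; have [<-|ne] := eqVneq (cmup i m') m.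
  have -> : cmdn i (cmup i m') = m'.
    by apply: cm_eq => k; rewrite cmdnE cmupE addKn.
  by rewrite eqxx cmupE eqxx add1n pnormU !mul1r -natrM.
rewrite mul0r; have [-> |m_i] := posnP (m i); first by rewrite muln0 mul0r.
rewrite (_ : (m' == _) = false) ?mul0r ?mulr0 //; apply: contra_neqF ne => /eqP ->.
apply: cm_eq => k; rewrite cmupE cmdnE.
by have [<-|_] := eqVneq i k; rewrite /= ?add0n ?subn0 // subnKC.
Qed.

Lemma pform_adj n x y : pform (pact n x) y = pform x (pact (- n) y).
Proof.
case: n => [[|i]|i]; last 1 first.
- by rewrite pform_sym NegzE opprK -[- i.+1%:Z]NegzE -pform_adj_pos -pform_sym.
- rewrite oppr0 !pact0 -[_ *: x]addr0 -[_ *: y]addr0 pform_linl pform_linr c_real.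
  by rewrite pform0l pform0r.
by rewrite pform_adj_pos NegzE.
Qed.

End PolynomialModel.

(** * Invariance of the form *)

Section Invariance.
Variables (C : numClosedFieldType).
Local Notation bin := (zbin C).
Local Notation sbin := (sbin C).
Variables (V M : lmodType C) (vac : V) (alV : int -> V -> V) (alM : int -> M -> M).
Variables (YV : V -> int -> V -> V) (YM : V -> int -> M -> M).
Hypotheses (sfV : state_field vac alV alV YV) (sfM : state_field vac alV alM YM).
Hypothesis ann : forall i : nat, alV i%:Z vac = 0.
Hypothesis gen : generated_by vac alV.
Local Notation fV := (sf_boson sfV).
Local Notation fM := (sf_boson sfM).
Local Notation om := (2^-1 *: alV (-1) (alV (-1) vac)).
Local Notation L n := (YV om (n + 1)).
Local Notation mon := (monomial vac alV).
Variable phi : V -> V.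
Hypothesis phi_vac : phi vac = vac.
Hypothesis phi_anti : antilinear phi.
Hypothesis phi_al : forall n u, phi (alV n u) = - alV n (phi u).
Variable f : M -> M -> C.
Hypothesis herm : is_positive_hermitian f.
Hypothesis f_al : forall n x y, f (alM n x) y = f x (alM (- n) y).

Lemma herm0l y : f 0 y = 0.
Proof.
have := herm_linear herm 1 0 0 y; rewrite scaler0 addr0 mul1r => e.
by apply: (addrI (f 0 y)); rewrite addr0.
Qed.

Lemma herm0r x : f x 0 = 0.
Proof. by rewrite (herm_sym herm) herm0l conjC0. Qed.

Lemma hermDl x y z : f (x + y) z = f x z + f y z.
Proof. by rewrite -[x]scale1r (herm_linear herm) scale1r mul1r. Qed.

Lemma hermZl k x z : f (k *: x) z = k * f x z.
Proof. by rewrite -[k *: x]addr0 (herm_linear herm) herm0l addr0. Qed.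

Lemma hermBl x y z : f (x - y) z = f x z - f y z.
Proof. by rewrite hermDl -[- y]scaleN1r hermZl mulN1r. Qed.

Lemma hermDr x y z : f z (x + y) = f z x + f z y.
Proof. by rewrite ![f z _](herm_sym herm) hermDl rmorphD. Qed.

Lemma hermZr k x z : f z (k *: x) = Num.conj k * f z x.
Proof. by rewrite ![f z _](herm_sym herm) hermZl rmorphM. Qed.

Lemma hermBr x y z : f z (x - y) = f z x - f z y.
Proof. by rewrite ![f z _](herm_sym herm) hermBl rmorphB. Qed.

Lemma herm_nsuml g y : fs g -> f (nsum g) y = nsum (fun t => f (g t) y : C^o).
Proof.
by apply: (@raddf_nsum M C^o (fun x => f x y)); [exact: herm0l|move=> u v; exact: hermDl].
Qed.

Lemma herm_nsumr g x : fs g -> f x (nsum g) = nsum (fun t => f x (g t) : C^o).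
Proof.
by apply: (@raddf_nsum M C^o (f x)); [exact: herm0r|move=> u v; exact: hermDr].
Qed.

Lemma conj_sbin l t : Num.conj (sbin l t) = sbin l t.
Proof.
rewrite sbinE zbin.unlock /binz rmorphM rmorphXn rmorphN1 fmorph_div rmorph_nat.
by rewrite rmorph_prod; under eq_bigr do rewrite rmorph_int.
Qed.

Lemma conj_m1z (l : int) : Num.conj ((-1) ^ l) = (-1) ^ l :> C.
Proof. by rewrite fmorphXz rmorphN1. Qed.

Definition divided_L (i : nat) (u : V) : V := i`!%:R^-1 *: iter i (L 1) u.

Lemma divided_LS i u : i.+1%:R *: divided_L i.+1 u = L 1 (divided_L i u).
Proof.
rewrite /divided_L (fieldZ (sf_field sfV om)) iterS scalerA; congr (_ *: _).
by rewrite factS natrM invfM mulrA mulfV ?mul1r // pnatr_eq0.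
Qed.

(** The coefficient of z^i in e^(z L(1)) alpha(-p) = (sum over j of C(p, j) z^j alpha(-p + j)) e^(z
    L(1)). The induction writes i + 1 as (i + 1 - j) + j and uses that L(1) takes alpha(-p + j) to
    (p - j) alpha(-p + j + 1), with (p - j) C(p, j) = (j + 1) C(p, j + 1). *)
Lemma divided_L_alpha i p u : divided_L i (alV (- p%:Z) u) =
  \sum_(j < i.+1) 'C(p, j)%:R *: alV (- p%:Z + j%:Z) (divided_L (i - j) u).
Proof.
have fL := sf_field sfV om.
elim: i => [|i IH].
  by rewrite big_ord1 bin0 scale1r addr0 /divided_L fact0 invr1 !scale1r.
apply: (@scalerI _ _ i.+1%:R); first by rewrite pnatr_eq0.
rewrite divided_LS IH (field_sum fL).
transitivity (\sum_(j < i.+2) ((i.+1 - j)%:R * 'C(p, j)%:R) *: alV (- p%:Z + j%:Z)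
  (divided_L (i.+1 - j) u)
  + \sum_(j < i.+2) (j%:R * 'C(p, j)%:R) *: alV (- p%:Z + j%:Z) (divided_L (i.+1 - j) u));
    last first.
  rewrite -big_split scaler_sumr; apply: eq_bigr => -[j /=]; rewrite ltnS => le_j _.
  by rewrite scalerA -scalerDl -mulrDl -natrD subnK.
rewrite [X in _ = X + _]big_ord_recr [X in _ = _ + X]big_ord_recl /= subnn !mul0r !scale0r
  addr0 add0r.
rewrite -big_split; apply: eq_bigr => -[j /=]; rewrite ltnS => le_j _.
rewrite (fieldZ fL) (L_alpha sfV sfV ann gen) -divided_LS (fieldZ fV) subSn // subSS /bump
  add1n.
rewrite (_ : - p%:Z + j.+1%:Z = - p%:Z + j%:Z + 1); last by lia.
have -> : j.+1%:R * 'C(p, j.+1)%:R = 'C(p, j)%:R * - (- p%:Z + j%:Z)%:~R :> C.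
  rewrite -natrM mul_bin_left natrM mulrC; have [le_jp|lt_pj] := leqP j p.
    by congr (_ * _); rewrite natrB // rmorphD rmorphN /= opprD opprK.
  by rewrite bin_small // !mul0r.
set A := alV (- p%:Z + j%:Z) _; set B := alV (- p%:Z + j%:Z + 1) _.
by lmod C.
Qed.

Lemma L_bracket10 u : L 0 (L 1 u) = L 1 (L 0 u) - L 1 u.
Proof.
have e : L 0 (L 1 u) - L 1 (L 0 u) = (-1) *: L 1 u + 0 *: u.
  exact: (L_bracket sfV sfV ann gen 0 1 u).
by move/eqP: e; rewrite scale0r addr0 scaleN1r subr_eq => /eqP ->; apply: addrC.
Qed.

Hypothesis L0_highest0 : forall nu w, L 0 w = nu *: w ->
  w = 0 \/ exists i : nat, nu = i%:R.

Lemma divided_L_weight h i u : L 0 u = h%:R *: u ->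
  L 0 (divided_L i u) = (h%:R - i%:R) *: divided_L i u.
Proof.
move=> Lu; have fL := sf_field sfV om.
rewrite /divided_L (fieldZ fL).
suff -> : L 0 (iter i (L 1) u) = (h%:R - i%:R) *: iter i (L 1) u by lmod C.
elim: i => [|i IH]; first by rewrite subr0.
by rewrite iterS L_bracket10 IH (fieldZ fL) -natr1; lmod C.
Qed.

(** L(1)^i u would have the negative weight h - i. Thus e^(z L(1)) u has degree at most h in z, and
    bounds on i may be enlarged freely. *)
Lemma divided_L_vanish h i u : L 0 u = h%:R *: u -> (h < i)%N -> divided_L i u = 0.
Proof.
move=> Lu lt_hi; have [//|[k /eqP]] := L0_highest0 (divided_L_weight i Lu).
by rewrite subr_eq -natrD eqr_nat => /eqP; lia.
Qed.

(* For [u] of weight [h], the coefficient of z^(-q-1) in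
   Y_M(e^(z L(1)) (-z^-2)^L(0) u, z^-1). *)
Definition adjoint_mode (u : V) (h : nat) (q : int) (x : M) : M :=
  \sum_(i < h.+1) ((-1) ^+ h) *: YM (divided_L i u) (2 * h%:Z - i%:Z - q - 2) x.

Lemma adjoint_mode0 u h q : adjoint_mode u h q 0 = 0.
Proof.
by rewrite /adjoint_mode big1 // => i _; rewrite (field0 (sf_field sfM _)) scaler0.
Qed.

Lemma adjoint_mode_trunc u h x : exists N : int, forall q, q <= N -> adjoint_mode u h q x = 0.
Proof.
rewrite /adjoint_mode; elim: h.+1 => [|n [N hN]]; first by exists 0 => q _; rewrite big_ord0.
have [N' hN'] := field_trunc (sf_field sfM (divided_L n u)) x.
exists (Num.min N (2 * h%:Z - n%:Z - 2 - N')) => q; rewrite le_min => /andP[h1 h2].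
by rewrite big_ord_recr /= hN // hN' ?scaler0 ?addr0 //; lia.
Qed.

(** Term by term this is the adjoint of the iterate formula for the mode q of alpha(-p) u: the
    factors are reversed and alpha(n) becomes alpha(-n). The sign in front matches phi(alpha(-p) u)
    = -alpha(-p) phi(u). *)
Lemma adjoint_mode_alpha u h p q x : L 0 u = h%:R *: u ->
  adjoint_mode (alV (- p%:Z) u) (h + p) q x =
  - nsum (fun t : nat => sbin (- p%:Z) t *:
      (adjoint_mode u h (q + t%:Z) (alM (p%:Z + t%:Z) x)
       - (-1) ^ (- p%:Z) *: alM (- t%:Z) (adjoint_mode u h (q - p%:Z - t%:Z) x))).
Proof.
move=> Lu.
have La : L 0 (alV (- p%:Z) u) = (h + p)%N%:R *: alV (- p%:Z) u.
  by rewrite (L_alpha sfV sfV ann gen) Lu (fieldZ fV) addr0 rmorphN /= natrD; lmod C.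
pose D' := adjoint_mode u h.
(* In [X] the mode of alpha acts after the adjoint mode of u, in [Y] before it. The indices are
   normalised so that the sums for different j below run over the same two families. *)
pose X (s : nat) : M := alM (- s%:Z) (D' (q - p%:Z - s%:Z) x).
pose Y (t : nat) : M := D' (q - p%:Z + t%:Z) (alM t%:Z x).
have fX : fs X.
  have [N hN] := adjoint_mode_trunc u h x.
  by exists (absz (q - p%:Z - N)%R) => s hs; rewrite /X /D' hN ?(field0 fM) //; lia.
have fY : fs Y.
  have [N hN] := field_trunc_nat fM x.
  by exists N => t ht; rewrite /Y /D' hN ?adjoint_mode0 // lez_nat.
have fbin (l : int) (g : nat -> M) : fs g -> fs (fun t => sbin l t *: g t) by apply: fsZ.
have E1 : adjoint_mode (alV (- p%:Z) u) (h + p) q x =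
  (-1) ^+ p *: \sum_(j < p.+1) 'C(p, j)%:R *:
    (nsum (fun t : nat => sbin (- p%:Z + j%:Z) t *: X (p - j + t)%N)
     - (-1) ^ (- p%:Z + j%:Z) *: nsum (fun t : nat => sbin (- p%:Z + j%:Z) t *: Y t)).
  (* j powers of L(1) fall on alpha(-p) and k on u. The sum over j + k <= h + p becomes one over a
     rectangle, since C(p, j) = 0 for j > p and L(1)^k u = 0 for k > h. *)
  pose G (j k : nat) : M := 'C(p, j)%:R *:
    YM (alV (- p%:Z + j%:Z) (divided_L k u)) (2 * (h + p)%N%:Z - (j + k)%N%:Z - q - 2) x.
  have fG : fs2 G.
    exists (maxn p.+1 h.+1) => j k; rewrite !geq_max => /orP[/andP[lt_pj _]|/andP[_ lt_hk]].
      by rewrite /G bin_small // scale0r.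
    by rewrite /G (divided_L_vanish Lu) // (field0 fV) (sf0 sfM) scaler0.
  have -> : adjoint_mode (alV (- p%:Z) u) (h + p) q x = (-1) ^+ (h + p) *: nsum (fun j =>
    nsum (G j)).
    rewrite /adjoint_mode -scaler_sumr; congr (_ *: _).
    rewrite -(nsumE (f := fun i : nat => YM (divided_L i (alV (- p%:Z) u)) (2 * (h +
      p)%N%:Z - i%:Z - q - 2) x)); last first.
      by move=> i lt_i; rewrite (divided_L_vanish La) // (sf0 sfM).
    rewrite nsum_diag //; apply: eq_nsum => i; rewrite divided_L_alpha (sf_sum sfM).
    apply: eq_bigr => -[j /=]; rewrite ltnS => le_ji _.
    by rewrite (sfZ sfM) /G subnKC.
  rewrite (nsumE (N := p.+1)) => [|j lt_pj]; last first.
    by apply: nsum0 => k; rewrite /G bin_small // scale0r.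
  rewrite addnC exprD -scalerA; congr (_ *: _).
  rewrite scaler_sumr; apply: eq_bigr => -[j /=]; rewrite ltnS => le_jp _.
  rewrite (nsumE (N := h.+1)) => [|k lt_hk]; last first.
    by rewrite /G (divided_L_vanish Lu) // (field0 fV) (sf0 sfM) scaler0.
  rewrite /G -scaler_sumr scalerA mulrC -scalerA; congr (_ *: _).
  rewrite (eq_bigr (fun k : 'I_h.+1 => nsum (fun t : nat => sbin (- p%:Z + j%:Z) t *:
     (alM (- p%:Z + j%:Z - t%:Z) (YM (divided_L k u) (2 * (h + p)%N%:Z - (j + k)%N%:Z - q -
       2 + t%:Z) x)
      - (-1) ^ (- p%:Z + j%:Z) *: YM (divided_L k u) (2 * (h + p)%N%:Z - (j + k)%N%:Z - q -
        2 + (- p%:Z + j%:Z) - t%:Z) (alM t%:Z x)))));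
    last by move=> k _; rewrite (sf_alpha sfM).
  rewrite -nsum_sum => [|k]; last exact: (fs_prod _ _ _ fM (sf_field sfM _)).
  have f1 : fs (fun t : nat => sbin (- p%:Z + j%:Z) t *: X (p - j + t)%N).
    by apply: fbin; apply: fs_shift.
  have f2 := fbin (- p%:Z + j%:Z) Y fY.
  rewrite (scaler_nsum _ f2) -(nsumB f1 (fsZ (fun=> _) f2)) scaler_nsum; last first.
    by apply: fs_sum => k; exact: (fs_prod _ _ _ fM (sf_field sfM _)).
  apply: eq_nsum => t; rewrite /X /Y /D' /adjoint_mode (field_sum fM).
  rewrite 3!scaler_sumr scaler_sumr -sumrB; apply: eq_bigr => k _.
  rewrite (fieldZ fM).
  have -> : 2 * h%:Z - k%:Z - (q - p%:Z - (p - j + t)%N%:Z) - 2 = 2 * (h + p)%N%:Z - (j +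
    k)%N%:Z - q - 2 + t%:Z by lia.
  have -> : - (p - j + t)%N%:Z = - p%:Z + j%:Z - t%:Z by lia.
  have -> : 2 * h%:Z - k%:Z - (q - p%:Z + t%:Z) - 2 = 2 * (h + p)%N%:Z - (j + k)%N%:Z - q -
    2 + (- p%:Z + j%:Z) - t%:Z by lia.
  by lmod C.
rewrite {}E1.
(* Reversing j and shifting by j brings the coefficient of X s into the form of [sbin_compl_sum]
   with c = 0. *)
have E2 : \sum_(j < p.+1) 'C(p, j)%:R *: nsum (fun t : nat => sbin (- p%:Z + j%:Z) t *: X
  (p - j + t)%N) =
    nsum (fun s : nat => sbin (- p%:Z) s *: X s).
  transitivity (\sum_(j < p.+1) nsum (fun s : nat => ('C(p, j)%:R * zb (sbin (- j%:Z))
    (s%:Z - j%:Z)) *: X s)).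
    rewrite (reindex_inj rev_ord_inj); apply: eq_bigr => -[j /=]; rewrite ltnS => le_jp _.
    rewrite !subSS bin_sub // subKn // (_ : - p%:Z + (p - j)%N%:Z = - j%:Z); last by lia.
    rewrite [RHS](nsum_shift (i := j)); last first.
    - by move=> s lt_sj; rewrite zb_neg ?mulr0 ?scale0r //; lia.
    - exact: fsZ.
    rewrite scaler_nsum; last by apply: fbin; apply: fs_shift.
    apply: eq_nsum => s; rewrite scalerA (@zb_pos _ _ _ s) //; lia.
  rewrite -nsum_sum => [|j]; last exact: fsZ.
  apply: eq_nsum => s; rewrite -scaler_suml; congr (_ *: _).
  have := sbin_compl_sum C 0 p s; rewrite sub0r => <-.
  by apply: eq_bigr => j _; rewrite sub0r.
(* The alternating sign turns the sum over j into a p-th difference, which [sbin_difference]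
   evaluates; its shift by p is the one in Y (p + t). *)
have E3 : \sum_(j < p.+1) ((-1) ^+ j * 'C(p, j)%:R) *: nsum (fun t : nat => sbin (- p%:Z +
  j%:Z) t *: Y t) =
    nsum (fun t : nat => sbin (- p%:Z) t *: Y (p + t)%N).
  transitivity (nsum (fun t : nat => zb (sbin (- p%:Z)) (t%:Z - p%:Z) *: Y t)).
    transitivity (\sum_(j < p.+1) nsum (fun t : nat => ((-1) ^+ j * 'C(p, j)%:R * sbin (-
      p%:Z + j%:Z) t) *: Y t)).
      apply: eq_bigr => j _; rewrite scaler_nsum; last exact: fbin.
      by apply: eq_nsum => t; rewrite scalerA.
    rewrite -nsum_sum => [|j]; last exact: fsZ.
    apply: eq_nsum => t; rewrite -scaler_suml; congr (_ *: _).
    by have := sbin_difference C 0 p t; rewrite sub0r.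
  rewrite (nsum_shift (i := p)); last first.
  - by move=> s lt_sj; rewrite zb_neg ?scale0r //; lia.
  - exact: fsZ.
  by apply: eq_nsum => s; rewrite (@zb_pos _ _ _ s) //; lia.
have fX' := fbin (- p%:Z) X fX.
have fY' := fbin (- p%:Z) (fun t => Y (p + t)%N) (fs_shift p fY).
have -> : nsum (fun t : nat => sbin (- p%:Z) t *:
      (adjoint_mode u h (q + t%:Z) (alM (p%:Z + t%:Z) x)
       - (-1) ^ (- p%:Z) *: alM (- t%:Z) (adjoint_mode u h (q - p%:Z - t%:Z) x))) =
   nsum (fun t : nat => sbin (- p%:Z) t *: Y (p + t)%N) - (-1) ^+ p *: nsum (fun t => sbin
     (- p%:Z) t *: X t).
  rewrite (scaler_nsum _ fX') -(nsumB fY' (fsZ (fun=> _) fX')); apply: eq_nsum => t.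
  rewrite /Y /X /D' m1zN PoszD (_ : q - p%:Z + (p%:Z + t%:Z) = q + t%:Z); last by lia.
  by lmod C.
rewrite -E2 -E3 opprB !scaler_sumr -sumrB; apply: eq_bigr => j _.
set P := nsum _; set Q := nsum _.
have -> : (-1) ^ (- p%:Z + j%:Z) = (-1) ^+ p * (-1) ^+ j :> C by rewrite m1zD m1zN.
transitivity (((-1) ^+ p * 'C(p, j)%:R) *: P - ((-1) ^+ p * (-1) ^+ p * (-1) ^+ j * 'C(p,
  j)%:R) *: Q).
  by lmod C.
by rewrite -expr2 sqrr_sign mul1r; lmod C.
Qed.

Lemma L0_mon s : L 0 (mon s) = (sumn s)%:R *: mon s.
Proof.
elim: s => [|p s IH] /=; first by rewrite scale0r (L_vac sfV ann gen).
by rewrite (L_alpha sfV sfV ann gen) IH (fieldZ fV) addr0 rmorphN /= natrD; lmod C.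
Qed.

Lemma invariant_vac q x y : f (adjoint_mode vac 0 q x) y = f x (YM (phi vac) q y).
Proof.
rewrite phi_vac /adjoint_mode big_ord1 scale1r /divided_L fact0 invr1 scale1r !(sf_vac sfM) /=.
have -> : (2 * 0%N%:Z - 0%N%:Z - q - 2 == -1) = (q == -1) by apply/eqP/eqP; lia.
by case: ifP => // _; rewrite herm0l herm0r.
Qed.

(** In each term of [adjoint_mode_alpha] both factors can be moved to the other argument; their
    order is reversed once more, the coefficients are real, and the iterate formula for
    phi(alpha(-p) u) appears. *)
Lemma invariant_alpha u h (p : nat) : L 0 u = h%:R *: u ->
  (forall q x y, f (adjoint_mode u h q x) y = f x (YM (phi u) q y)) ->
  forall q x y, f (adjoint_mode (alV (- p%:Z) u) (p + h) q x) y = f x (YM (phi (alV (-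
    p%:Z) u)) q y).
Proof.
move=> Lu IH q x y; rewrite addnC adjoint_mode_alpha // phi_al (sfN sfM) (sf_alpha sfM) /prod.
rewrite -[- nsum _]scaleN1r hermZl -[- nsum _]scaleN1r hermZr rmorphN rmorph1; congr (_ * _).
have fD1 : fs (fun t : nat => adjoint_mode u h (q + t%:Z) (alM (p%:Z + t%:Z) x)).
  have [N hN] := field_trunc_nat fM x.
  by exists N => t ht; rewrite hN ?adjoint_mode0 //; lia.
have fD2 : fs (fun t : nat => alM (- t%:Z) (adjoint_mode u h (q - p%:Z - t%:Z) x)).
  have [N hN] := adjoint_mode_trunc u h x.
  by exists (absz (q - p%:Z - N)%R) => s hs; rewrite hN ?(field0 fM) //; lia.
rewrite herm_nsuml; last by apply: fsZ; apply: (fsB fD1 (fsZ (fun=> _) fD2)).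
rewrite herm_nsumr; last exact: (fs_prod _ _ _ fM (sf_field sfM _)).
apply: eq_nsum => t; rewrite hermZl hermZr conj_sbin; congr (_ * _).
rewrite hermBl hermBr hermZl hermZr conj_m1z !f_al !IH f_al opprD !opprK.
by [].
Qed.

Lemma invariant_monomial s q x y :
  f (adjoint_mode (mon s) (sumn s) q x) y = f x (YM (phi (mon s)) q y).
Proof.
elim: s q x y => [|p s IH]; first exact: invariant_vac.
by apply: invariant_alpha => //; exact: L0_mon.
Qed.

Lemma divided_L_lin i (k : C) u v :
  divided_L i (k *: u + v) = k *: divided_L i u + divided_L i v.
Proof.
rewrite /divided_L.
suff -> : iter i (L 1) (k *: u + v) = k *: iter i (L 1) u + iter i (L 1) v by lmod C.
by elim: i => //= i ->; rewrite (field_lin (sf_field sfV om)).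
Qed.

Lemma invariant_spanned h u : spanned (is_monomial_of vac alV h) u ->
  forall q x y, f (adjoint_mode u h q x) y = f x (YM (phi u) q y).
Proof.
move=> hu; pattern u; apply: hu => /= [|_ [s [_ <- ->]] q x y]; last exact: invariant_monomial.
split=> [q x y|k {}u v hu hv q x y].
  have phi0 : phi 0 = 0.
    have := phi_anti 1 0 0; rewrite scaler0 addr0 conjC1 scale1r => e.
    by apply: (addrI (phi 0)); rewrite addr0.
  rewrite phi0 (sf0 sfM) herm0r /adjoint_mode big1 ?herm0l // => i _.
  have -> : divided_L i 0 = 0.
    have := divided_L_lin i 1 0 0; rewrite scaler0 addr0 scale1r => e.
    by apply: (addrI (divided_L i 0)); rewrite addr0.
  by rewrite (sf0 sfM) scaler0.
have -> : adjoint_mode (k *: u + v) h q x = k *: adjoint_mode u h q x + adjoint_mode v h q x.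
  rewrite /adjoint_mode scaler_sumr -big_split; apply: eq_bigr => i _ /=.
  by rewrite divided_L_lin (sf_linear sfM); lmod C.
by rewrite (herm_linear herm) hu hv phi_anti (sf_linear sfM) hermDr hermZr conjCK.
Qed.

Lemma invariant_form_state_field :
  (forall (h : nat) u, L 0 u = h%:R *: u -> u = 0 \/ spanned (is_monomial_of vac alV h) u) ->
  invariant_form YV om phi YM f.
Proof.
move=> wt h u Lu q x y.
have su : spanned (is_monomial_of vac alV h) u.
  by have [->|//] := wt h u Lu; exact: (spanned_subspace _).1.
rewrite -(invariant_spanned su); congr (f _ y); apply: eq_bigr => i _.
by rewrite /divided_L (sfZ sfM) scalerA.
Qed.

End Invariance.

(** * The Heisenberg vertex operator algebra and its modules *)

Section Assembly.
Variables (C : numClosedFieldType).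
Local Notation bin := (zbin C).
Local Notation sbin := (sbin C).
Variables (V M : lmodType C) (vac : V) (alV : int -> V -> V).
Variables (vacM : M) (alM : int -> M -> M) (c : C).
Variables (YV : V -> int -> V -> V) (YM : V -> int -> M -> M).
Hypotheses (sfV : state_field vac alV alV YV) (sfM : state_field vac alV alM YM).
Hypothesis ann : forall i : nat, alV i%:Z vac = 0.
Hypothesis gen : generated_by vac alV.
Hypothesis genM : generated_by vacM alM.
Hypothesis al_vacM : forall n : nat, alM n.+1%:Z vacM = 0.
Hypothesis al0_vacM : alM 0 vacM = c *: vacM.
Local Notation fV := (sf_boson sfV).
Local Notation fM := (sf_boson sfM).
Local Notation om := (2^-1 *: alV (-1) (alV (-1) vac)).
Local Notation L n := (YM om (n + 1)).
Local Notation h := (2^-1 * (c * c)).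
Local Notation monM := (is_monomial_of vacM alM).

Lemma mod_L0_lin (k : C) x y : L 0 (k *: x + y) = k *: L 0 x + L 0 y.
Proof. exact: field_lin (sf_field sfM om) _ _ _ _. Qed.

Lemma mod_L0_al (t : int) w : L 0 (alM t w) = alM t (L 0 w) - t%:~R *: alM t w.
Proof. by rewrite (L_alpha sfV sfM ann gen) addr0. Qed.

Lemma mod_L0_singular w : (forall n : nat, alM n.+1%:Z w = 0) ->
  alM 0 w = c *: w -> L 0 w = h *: w.
Proof.
move=> hw w0; rewrite (L0_highest sfM hw) w0 (fieldZ fM) w0; lmod C.
Qed.

Lemma mod_weight nu w : L 0 w = nu *: w ->
  w = 0 \/ exists i : nat, nu = h + i%:R /\ spanned (monM i) w.
Proof.
exact: (L0_eigen fM (sf_heis sfM) genM al_vacM al0_vacM mod_L0_lin mod_L0_al mod_L0_singular).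
Qed.

Lemma mod_finite_weight nu : finite_dimensional (weight_space YM om nu).
Proof.
have [[i ei]|no] := pselect (exists i : nat, nu = h + i%:R).
  have [d [e he]] := spanned_finite vacM alM i; exists d, e => w /mod_weight [->|].
    by exists (fun=> 0); rewrite big1 // => j _; rewrite scale0r.
  move=> [i' [ei' sw]]; apply: he; suff -> : i = i' by [].
  by move: ei; rewrite ei' => /addrI /eqP; rewrite eqr_nat => /eqP ->.
exists 0%N, (fun=> 0) => w /mod_weight [->|[i [ei _]]]; last by case: no; exists i.
by exists (fun=> 0); rewrite big_ord0.
Qed.

Lemma mod_graded w : exists (d : nat) (p : nat -> M),
  (forall i, weight_space YM om (h + i%:R) (p i)) /\ w = \sum_(i < d) p i.
Proof.
have [d [p [hp ->]]] := graded fM (sf_heis sfM) genM al_vacM al0_vacM w.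
exists d, p; split=> // i.
exact: (L0_spanned fM al_vacM al0_vacM mod_L0_lin mod_L0_al mod_L0_singular (hp i)).
Qed.

Lemma state_field_module : is_ordinary_module YV vac om YM.
Proof.
split.
- split; first by move=> k a b n w; exact: (sf_linear sfM).
  by move=> a n k w x; exact: (field_lin (sf_field sfM a)).
- by move=> a w; exact: (field_trunc (sf_field sfM a)).
- by move=> n w; exact: (sf_vac sfM).
- exact: (state_field_jacobi_identity sfV sfM ann gen).
- move=> w; have [d [p [hp ->]]] := mod_graded w.
  by exists d, (fun i : 'I_d => h + i%:R), (fun i : 'I_d => p i).
- exact: mod_finite_weight.
(* All weights lie in h + nat: for nu = h + i nothing is left below after i + 1 steps, and if nu is
   outside this set then so is every nu - n. *)
move=> nu; have [[i ei]|no] := pselect (exists i : nat, nu = h + i%:R).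
  exists i.+1 => n lt_in w /mod_weight [//|[j [ej _]]].
  move/eqP: ej; rewrite subr_eq ei -addrA (inj_eq (addrI h)) -natrD eqr_nat; lia.
exists 0%N => n _ w /mod_weight [//|[j [ej _]]]; case: no; exists (j + n)%N.
by rewrite natrD addrA -ej subrK.
Qed.

Lemma state_field_irreducible : vacM != 0 -> irreducible YM.
Proof.
move=> v0; split; first by exists vacM.
move=> P sP Pmod.
apply: (submodule_full fM (sf_heis sfM) genM al_vacM al0_vacM mod_L0_lin mod_L0_al
  mod_L0_singular sP).
by move=> n w Pw; rewrite -(alpha_state sfM); apply: Pmod.
Qed.

(** With m = 0 the Jacobi identity for alpha(-1) 1 and v has one term on the left and becomes the
    iterate formula. So the value of [YM'] at alpha(l) v is determined by its value at v, and
    induction from the vacuum applies. *)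
Lemma state_field_unique (Y' : vertex_map V V) (YM' : vertex_map V M) :
  bilinear_modes YM' -> (forall n w, YM' vac n w = if n == -1 then w else 0) ->
  jacobi_identity Y' YM' ->
  (forall n v, Y' (alV (-1) vac) n v = alV n v) ->
  (forall n w, YM' (alV (-1) vac) n w = alM n w) ->
  YM = YM'.
Proof.
move=> [lin' _] vac' jac' a' aM'; apply/funext => u.
pattern u; apply: gen u => /=; first split.
- apply/funext => n; apply/funext => w; rewrite (sf0 sfM).
  have := lin' 1 0 0 n w; rewrite scaler0 addr0 scale1r => e.
  by apply: (addrI (YM' 0 n w)); rewrite addr0.
- move=> k x y hx hy; apply/funext => n; apply/funext => w.
  by rewrite (sf_linear sfM) lin' hx hy.
- by apply/funext => n; apply/funext => w; rewrite (sf_vac sfM) vac'.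
move=> l v hv; apply/funext => n; apply/funext => w.
rewrite (sf_alpha sfM) hv.
have jac := jac' (alV (-1) vac) v w l 0 n.
have E : nsum (fun j : nat => binz C 0 j *: YM' (Y' (alV (-1) vac) (l + j%:Z) v) (0 + n -
  j%:Z) w) = prod alM (YM' v) l n w.
  rewrite /nsum jac; apply: eq_fsbigr => j _.
  by rewrite sbinE zbin.unlock !aM' !add0r.
rewrite -E (@nsum1 _ 0).
  have -> : binz C 0 0 = 1 by rewrite -(binz0 C 0) zbin.unlock.
  by rewrite scale1r a' addr0 add0r subr0.
case=> [|j] // _; have -> : binz C 0 j.+1 = zbin C 0%N%:Z j.+1 by rewrite zbin.unlock.
by rewrite binz_nat bin0n scale0r.
Qed.

End Assembly.

Section VertexAlgebra.
Variables (C : numClosedFieldType).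
Variables (V : lmodType C) (vac : V) (alV : int -> V -> V).
Variables (YV : V -> int -> V -> V).
Hypotheses (sfV : state_field vac alV alV YV).
Hypothesis ann : forall i : nat, alV i%:Z vac = 0.
Hypothesis gen : generated_by vac alV.
Hypothesis vac_neq0 : vac != 0.
Local Notation fV := (sf_boson sfV).
Local Notation om := (2^-1 *: alV (-1) (alV (-1) vac)).
Local Notation mon := (monomial vac alV).

Lemma ann0 : alV 0 vac = (0 : C) *: vac.
Proof. by rewrite scale0r (ann 0). Qed.

Lemma ann_pos (n : nat) : alV n.+1%:Z vac = 0.
Proof. exact: ann. Qed.

Lemma voa_weight nu w : weight_space YV om nu w ->
  w = 0 \/ exists i : nat, nu = i%:R /\ spanned (is_monomial_of vac alV i) w.
Proof.
move=> /(mod_weight sfV sfV ann gen gen ann_pos ann0) [->|[i [ei sw]]]; first by left.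
by right; exists i; rewrite ei !mulr0 add0r.
Qed.

Lemma voa_weight_nat (i : nat) w : weight_space YV om i%:R w ->
  w = 0 \/ spanned (is_monomial_of vac alV i) w.
Proof.
move=> /voa_weight [->|[j [/eqP]]]; first by left.
by rewrite eqr_nat => /eqP ->; right.
Qed.

Lemma state_field_voa : is_voa YV vac om.
Proof.
have modV := state_field_module sfV sfV ann gen gen ann_pos ann0.
split.
- exact: mod_bilinear modV.
- exact: mod_truncated modV.
- exact: mod_vacuum modV.
- exact: (creation sfV ann gen).
- exact: mod_jacobi modV.
- exists 1 => m n b; exact: (L_bracket sfV sfV ann gen m n b).
- move=> a n b; exact: (L_derivative sfV sfV ann gen a n b).
- move=> b; have [d [p [hp ->]]] := mod_graded sfV sfV ann gen gen ann_pos ann0 b.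
  by exists d, p; split=> // i; have := hp i; rewrite !mulr0 add0r.
- by move=> i; exact: mod_finite modV _.
- exact: vac_neq0.
move=> b /(voa_weight_nat (i := 0)) [->|]; first by exists 0; rewrite scale0r.
exact: spanned0.
Qed.

Variable phi : V -> V.
Hypothesis phi_vac : phi vac = vac.
Hypothesis phi_anti : antilinear phi.
Hypothesis phi_al : forall n u, phi (alV n u) = - alV n (phi u).

Lemma anti0 (psi : V -> V) : antilinear psi -> psi 0 = 0.
Proof.
move=> psi_anti; have := psi_anti 1 0 0; rewrite scaler0 addr0 conjC1 scale1r => e.
by apply: (addrI (psi 0)); rewrite addr0.
Qed.

Lemma antiZ (psi : V -> V) (k : C) u : antilinear psi -> psi (k *: u) = Num.conj k *: psi u.
Proof. by move=> pa; rewrite -[k *: u]addr0 pa anti0 ?addr0. Qed.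

Lemma antiN (psi : V -> V) u : antilinear psi -> psi (- u) = - psi u.
Proof. by move=> pa; rewrite -scaleN1r antiZ // rmorphN1 scaleN1r. Qed.

Lemma antiB (psi : V -> V) u v : antilinear psi -> psi (u - v) = psi u - psi v.
Proof.
by move=> pa; rewrite addrC -scaleN1r pa rmorphN1 scaleN1r addrC.
Qed.

Lemma anti_nsum (psi : V -> V) g : antilinear psi -> fs g ->
  psi (nsum g) = nsum (fun t => psi (g t)).
Proof.
move=> pa; apply: raddf_nsum; first exact: anti0.
by move=> u v; rewrite -[u]scale1r pa conjC1 !scale1r.
Qed.

Lemma anti_monomial s : phi (mon s) = (-1) ^+ size s *: mon s.
Proof.
elim: s => [|n s IH] /=; first by rewrite phi_vac scale1r.
by rewrite phi_al IH (fieldZ fV) exprS; lmod C.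
Qed.

(** Each term of the iterate formula contains one mode of alpha, hence changes sign once under phi,
    as alpha(l) u does; the coefficients are real, so conjugation fixes them. *)
Lemma anti_modes u n v : phi (YV u n v) = YV (phi u) n (phi v).
Proof.
move: n v; pattern u; apply: gen u => /=; first split.
- by move=> n v; rewrite (anti0 phi_anti) !(sf0 sfV) anti0.
- by move=> k x y hx hy n v; rewrite (sf_linear sfV) !phi_anti (sf_linear sfV) hx hy.
- by move=> n v; rewrite phi_vac !(sf_vac sfV); case: ifP => // _; exact: anti0.
move=> l u IH n v; rewrite (sf_alpha sfV) phi_al (sfN sfV) (sf_alpha sfV) /prod.
have f1 := fs_prod l n v fV (sf_field sfV u).
have f2 := fs_prod l n (phi v) fV (sf_field sfV (phi u)).
rewrite anti_nsum // -scaleN1r (scaler_nsum _ f2); apply: eq_nsum => t.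
rewrite 2!(antiZ _ _ phi_anti, antiB _ _ phi_anti) conj_sbin (antiZ _ _ phi_anti) conj_m1z
  phi_al !IH phi_al.
by rewrite -[- alV t%:Z _]scaleN1r (fieldZ (sf_field sfV _)); lmod C.
Qed.

Lemma anti_involutive u : phi (phi u) = u.
Proof.
pattern u; apply: gen u => /=; first split.
- by rewrite !(anti0 phi_anti).
- by move=> k x y hx hy; rewrite !phi_anti conjCK hx hy.
- by rewrite !phi_vac.
by move=> n u IH; rewrite phi_al (antiN _ phi_anti) phi_al opprK IH.
Qed.

Lemma state_field_involution : is_antilinear_involution YV vac om phi.
Proof.
have c2 : Num.conj (2^-1 : C) = 2^-1 by rewrite fmorphV rmorph_nat.
split=> //.
- exact: anti_involutive.
(* If alpha(-1) 1 were fixed by phi, then 2 alpha(-1) 1 = 0, and applying alpha(1) would give 1 =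
   0. *)
- exists (alV (-1) vac); rewrite phi_al phi_vac => /eqP.
  rewrite eq_sym -subr_eq0 opprK -mulr2n -scaler_nat scaler_eq0 pnatr_eq0 /= => /eqP e.
  have := sf_heis sfV 1 (-1) vac; rewrite e (ann 1) !(field0 fV) subrr /= scale1r => v0.
  by case/eqP: vac_neq0.
- by rewrite (antiZ _ _ phi_anti) c2 !phi_al phi_vac -[- alV _ vac]scaleN1r (fieldZ fV)
  scaleN1r opprK.
exact: anti_modes.
Qed.

Lemma monomial_insert s1 n s2 : (0 < n)%N -> all (leq 1) s1 ->
  mon (s1 ++ n :: s2) = mon (n :: s1 ++ s2).
Proof.
move=> n0; elim: s1 => //= m s1 IH /andP[m0 /IH ->] /=.
have /eqP := sf_heis sfV (- m%:Z) (- n%:Z) (mon (s1 ++ s2)).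
rewrite (_ : (_ + _ == 0) = false); last by apply/eqP; lia.
by rewrite scale0r subr_eq0 => /eqP.
Qed.

Lemma monomial_perm s s' : perm_eq s s' -> all (leq 1) s -> mon s = mon s'.
Proof.
elim: s s' => [|n s IH] s'; first by rewrite perm_sym => /perm_nilP ->.
move=> p; rewrite (perm_all _ p) => s'1.
have ns' : n \in s' by rewrite -(perm_mem p) mem_head.
case/splitPr: s' / ns' p s'1 => s1 s2 p; rewrite all_cat /= => /and3P[a1 n1 a2].
rewrite monomial_insert //= (IH (s1 ++ s2)) ?all_cat ?a1 ?a2 //.
  by move: p; rewrite perm_sym -cat1s perm_catCA perm_sym perm_cons.
have : perm_eq s (s1 ++ s2).
  by move: p; rewrite perm_sym -cat1s perm_catCA perm_sym perm_cons.
by move=> /perm_all ->; rewrite all_cat a1.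
Qed.

(** [psi] is prescribed on sorted monomials; since creation modes commute, every monomial equals a
    sorted one. *)
Lemma involution_unique (psi : V -> V) : antilinear psi ->
  (forall s, sorted geq s -> all (leq 1) s -> psi (mon s) = (-1) ^+ size s *: mon s) ->
  phi = psi.
Proof.
move=> psi_anti psi_mon; apply/funext => u; pattern u.
apply: (PBW_span fV (sf_heis sfV) gen ann_pos ann0) => /=.
  split; first by rewrite (anti0 phi_anti) (anti0 psi_anti).
  by move=> k x y hx hy; rewrite phi_anti psi_anti hx hy.
move=> _ [s [s1 ->]]; rewrite anti_monomial.
have p : perm_eq s (sort geq s) by rewrite perm_sym perm_sort.
rewrite (monomial_perm p s1) psi_mon ?size_sort -?(perm_all _ p) //.
by apply: sort_sorted => m n; apply: leq_total.
Qed.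

End VertexAlgebra.

(** * The complex conjugate space and antilinear maps *)

Section ConjugateModule.
Variables (C : numClosedFieldType) (V : lmodType C).

(** The same group with conjugated scalars: linear maps into it are the antilinear maps into V, so
    the universal property yields antilinear maps too. *)
Definition conjmod : Type := V.
HB.instance Definition _ := GRing.Zmodule.on conjmod.
Definition conj_scale (k : C) (v : conjmod) : conjmod := Num.conj k *: (v : V).

Fact conj_scaleA a b v : conj_scale a (conj_scale b v) = conj_scale (a * b) v.
Proof. by rewrite /conj_scale scalerA rmorphM. Qed.
Fact conj_scale1 : left_id 1 conj_scale.
Proof. by move=> v; rewrite /conj_scale conjC1 scale1r. Qed.
Fact conj_scaleDr : right_distributive conj_scale +%R.
Proof. by move=> k u v; rewrite /conj_scale scalerDr. Qed.
Fact conj_scaleDl v : {morph conj_scale^~ v : a b / a + b}.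
Proof. by move=> a b; rewrite /conj_scale rmorphD scalerDl. Qed.
HB.instance Definition _ := GRing.Zmodule_isLmodule.Build C conjmod
  conj_scaleA conj_scale1 conj_scaleDr conj_scaleDl.

Lemma conjmod_scaleE (k : C) (v : conjmod) : k *: v = Num.conj k *: (v : V).
Proof. by []. Qed.

End ConjugateModule.

Lemma pullback_form (C : numClosedFieldType) (M F : lmodType C) (al : int -> M -> M)
  (act : int -> F -> F) (pf : F -> F -> C) (Phi : M -> F) :
  (forall w, Phi w = 0 -> w = 0) ->
  (forall k x y, Phi (k *: x + y) = k *: Phi x + Phi y) ->
  (forall n x, Phi (al n x) = act n (Phi x)) ->
  (forall k x y z, pf (k *: x + y) z = k * pf x z + pf y z) ->
  (forall x y, pf y x = Num.conj (pf x y)) ->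
  (forall x, x != 0 -> 0 < pf x x) ->
  (forall n x y, pf (act n x) y = pf x (act (- n) y)) ->
  exists f : M -> M -> C, is_positive_hermitian f /\
    forall n x y, f (al n x) y = f x (al (- n) y).
Proof.
move=> inj Phi_lin Phi_al pf_lin pf_sym pf_pos pf_adj.
exists (fun x y => pf (Phi x) (Phi y)); split; last first.
  by move=> n x y; rewrite !Phi_al pf_adj.
split=> [k x y z|x y|x x0].
- by rewrite Phi_lin pf_lin.
- exact: pf_sym.
by apply: pf_pos; apply: contraNneq x0 => /inj ->.
Qed.

Section Existence.
Variables (C : numClosedFieldType).
Local Notation V := (M1 C).

Lemma M1_isfield : isfield (@M1_alpha C).
Proof. exact: fock_isfield. Qed.

Lemma M1_heis (m n : int) (w : V) : M1_alpha m (M1_alpha n w) - M1_alpha n (M1_alpha m w) =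
  (if m + n == 0 then m%:~R else 0) *: w.
Proof. exact: fock_alpha_heis. Qed.

Lemma M1_generated : generated_by (vacuum C) (@M1_alpha C).
Proof. exact: fock_generated. Qed.

Lemma antilinear_map_exists (W : lmodType C) (w0 : W) (al : int -> W -> W) :
  isfield al ->
  (forall (m n : int) w, al m (al n w) - al n (al m w) =
    (if m + n == 0 then m%:~R else 0) *: w) ->
  (forall n : nat, al n%:Z w0 = 0) ->
  exists phi : V -> W, [/\ phi (vacuum C) = w0,
    forall k x y, phi (k *: x + y) = Num.conj k *: phi x + phi y
    & forall n u, phi (M1_alpha n u) = - al n (phi u)].
Proof.
move=> fal heis ann.
(* The sign enters a commutator twice and the central scalars are integers, so -alpha(n) on the
   conjugate space satisfies the same relations. *)
pose A (n : int) (w : conjmod W) : conjmod W := - al n (w : W).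
have S_sub : @subspace C (conjmod W) (fun=> True) by split.
have A_lin n (k : C) (w x : conjmod W) : True -> True ->
    A n (k *: w + x) = k *: A n w + A n x.
  move=> _ _; rewrite !conjmod_scaleE /A (field_lin fal) opprD.
  by rewrite -(scalerN (Num.conj k)).
have A_heis (m n : int) (w : conjmod W) : True ->
    A m (A n w) - A n (A m w) = (if m + n == 0 then m%:~R else 0) *: w.
  move=> _; rewrite conjmod_scaleE /A !(fieldN fal) !opprK heis.
  by case: ifP => _; rewrite ?conjC0 ?rmorph_int.
have A_pos (n : nat) : A n.+1%:Z w0 = 0 by rewrite /A ann oppr0.
have A_zero : A 0 w0 = cform (alpha C) (0 : cartan C) *: (w0 : conjmod W).
  by rewrite /A (ann 0%N) oppr0 /cform mulr0 scale0r.
have [phi [pv pl pa _]] := fock_universal S_sub (fun _ _ _ => I) A_lin A_heis I A_pos A_zero.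
by exists phi; split.
Qed.

Variable lam : cartan C.
Local Notation M := (fock lam).
Local Notation F := {malg C[{cmonom nat}]}.
Local Notation c := (cform (alpha C) lam).

Lemma fock_to_polynomials : exists Phi : M -> F, [/\ Phi (fock_vac lam) = pmono C (onecm nat),
  forall k x y, Phi (k *: x + y) = k *: Phi x + Phi y
  & forall n x, Phi (fock_alpha n x) = pact c n (Phi x)].
Proof.
have S_sub : @subspace C F (fun=> True) by split.
have A_lin n (k : C) (w x : F) : True -> True -> pact c n (k *: w + x) = k *: pact c n w +
  pact c n x.
  by move=> _ _; exact: pact_lin.
have A_heis (m n : int) (w : F) : True -> pact c m (pact c n w) - pact c n (pact c m w) =
    (if m + n == 0 then m%:~R else 0) *: w by move=> _; exact: pact_heis.
have A_pos (n : nat) : pact c n.+1%:Z (pmono C (onecm nat)) = 0.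
  by rewrite pact_pos onecmE muln0 scale0r.
have A_zero : pact c 0 (pmono C (onecm nat)) = c *: pmono C (onecm nat) by rewrite pact0.
have [Phi [pv pl pa _]] := fock_universal S_sub (fun _ _ _ => I) A_lin A_heis I A_pos A_zero.
by exists Phi; split.
Qed.

Lemma pmono_neq0 m : pmono C m != 0.
Proof. by rewrite pmono.unlock monalgU_eq0 oner_eq0. Qed.

(** J_lam is a proper left ideal because the polynomial model realises its relations with the vacuum
    sent to the constant polynomial 1. *)
Lemma fock_vac_neq0 : fock_vac lam != 0.
Proof.
have [Phi [pv pl pa]] := fock_to_polynomials.
have := pmono_neq0 (onecm nat); rewrite -pv; apply: contraNneq => ->.
have := pl 1 0 0; rewrite scaler0 addr0 scale1r => e.
by apply/eqP; apply: (addrI (Phi 0)); rewrite addr0.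
Qed.

Variables (YV : V -> int -> V -> V) (YM : V -> int -> M -> M).
Hypotheses (sfV : state_field (vacuum C) (@M1_alpha C) (@M1_alpha C) YV).
Hypotheses (sfM : state_field (vacuum C) (@M1_alpha C) (@fock_alpha C lam) YM).

Lemma fock_form_exists : Num.conj c = c -> exists f : M -> M -> C,
  is_positive_hermitian f /\
  forall n x y, f (fock_alpha n x) y = f x (fock_alpha (- n) y).
Proof.
move=> c_real; have [Phi [Phi_vac Phi_lin Phi_al]] := fock_to_polynomials.
have inj : forall w, Phi w = 0 -> w = 0.
  apply: (intertwiner_injective (sf_boson sfM) (sf_heis sfM) (@fock_generated C lam)
    (@fock_alpha_vac C lam) (@fock_alpha0_vac C lam) (mod_L0_lin sfM)
    (mod_L0_al sfV sfM (@M1_ann C) M1_generated) (mod_L0_singular sfM) Phi_lin Phi_al).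
    by move=> n; exact: pact_0.
  by rewrite Phi_vac pmono_neq0.
exact: (pullback_form inj Phi_lin Phi_al (@pform_linl C) (@pform_sym C) (@pform_pos C)
  (pform_adj c_real)).
Qed.

End Existence.

(** * Uniqueness, irreducibility and unitarity for M(1,0) and M(1,lambda) *)

Section HeisenbergVertexAlgebra.
Variable C : numClosedFieldType.
Local Notation V := (M1 C).
Local Notation vac := (vacuum C).
Local Notation om := (conformal C).
Local Notation al := (@M1_alpha C).
Local Notation ann := (@M1_ann C).
Local Notation gen := (@M1_generated C).

Section Module.
Variables (lam : cartan C) (YV : vertex_map V V) (YM : vertex_map V (fock lam)).
Hypotheses (sfV : state_field vac al al YV).
Hypotheses (sfM : state_field vac al (@fock_alpha C lam) YM).

Lemma heisenberg_module_unique : unique (heisenberg_module YV (lam := lam)) YM.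
Proof.
split.
  split; last by move=> n w; exact: (alpha_state sfM).
  exact: (state_field_module sfV sfM ann gen (@fock_generated C lam)
    (@fock_alpha_vac C lam) (@fock_alpha0_vac C lam)).
move=> YM' [mod' al'].
exact: (state_field_unique sfM gen (mod_bilinear mod') (mod_vacuum mod')
  (mod_jacobi mod') (alpha_state sfV) al').
Qed.

Lemma heisenberg_module_irreducible : irreducible YM.
Proof.
exact: (state_field_irreducible sfV sfM ann gen (@fock_generated C lam)
    (@fock_alpha_vac C lam) (@fock_alpha0_vac C lam) (fock_vac_neq0 lam)).
Qed.

Variable phi : V -> V.
Hypothesis phi_vac : phi vac = vac.
Hypothesis phi_anti : antilinear phi.
Hypothesis phi_al : forall n u, phi (M1_alpha n u) = - M1_alpha n (phi u).

Lemma heisenberg_invariant_form : Num.conj (cform (alpha C) lam) = cform (alpha C) lam ->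
  exists f : fock lam -> fock lam -> C,
    is_positive_hermitian f /\ invariant_form YV om phi YM f.
Proof.
move=> c_real; have [f [herm f_al]] := fock_form_exists sfV sfM c_real.
exists f; split=> //.
apply: (invariant_form_state_field sfV sfM ann gen phi_vac phi_anti phi_al herm f_al).
  by move=> nu w /(voa_weight sfV ann gen) [->|[i [-> _]]]; [left|right; exists i].
by move=> h u; exact: (voa_weight_nat sfV ann gen).
Qed.

End Module.

Lemma heisenberg_voa_unique (Y : vertex_map V V) : state_field vac al al Y ->
  unique (@heisenberg_voa C) Y.
Proof.
move=> sfV; split.
  split; last by move=> n b; exact: (alpha_state sfV).
  exact: (state_field_voa sfV ann gen (fock_vac_neq0 0)).
move=> Y' [voa' al'].
exact: (state_field_unique sfV gen (voa_bilinear voa') (voa_vacuum voa')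
  (voa_jacobi voa') al' al').
Qed.

Lemma heisenberg_unitary : exists (Y : vertex_map V V) (phi : V -> V),
  [/\ unique (@heisenberg_voa C) Y,
      unique (@heisenberg_involution C) phi,
      is_unitary_voa Y vac om phi
    & forall lam : cartan C, 0 <= cform (alpha C) lam ->
        exists YM : vertex_map V (fock lam),
          [/\ unique (heisenberg_module Y (lam := lam)) YM,
              irreducible YM
            & is_unitary_module Y vac om phi YM]].
Proof.
have [Y sfV] : exists Y : vertex_map V V, state_field vac al al Y.
  exact: state_field_exists (M1_isfield C) (@M1_heis C).
have [phi [phi_vac phi_anti phi_al]] :=
  antilinear_map_exists (M1_isfield C) (@M1_heis C) ann.
exists Y, phi; split.
- exact: heisenberg_voa_unique.
- split.
    split=> // s _ _; exact: (anti_monomial sfV phi_vac phi_al s).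
  move=> psi [psi_anti psi_mon].
  exact: (involution_unique sfV ann gen (fock_vac_neq0 0) phi_vac phi_anti phi_al
    psi_anti psi_mon).
- split.
  + exact: (state_field_voa sfV ann gen (fock_vac_neq0 0)).
  + exact: (state_field_involution sfV ann gen (fock_vac_neq0 0) phi_vac phi_anti phi_al).
  (* M(1,0) is the Fock module of weight 0, so its own form is the case lam = 0 with both
     state-field maps equal. *)
  apply: (heisenberg_invariant_form sfV (lam := 0) sfV phi_vac phi_anti phi_al).
  by rewrite /cform mulr0 conjC0.
move=> lam lam_ge0.
have [YM sfM] := state_field_exists (fock_isfield lam) (@fock_alpha_heis C lam).
exists YM; split.
- exact: heisenberg_module_unique.
- exact: (heisenberg_module_irreducible sfV sfM).
split; first by case: (heisenberg_module_unique sfV sfM) => -[].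
apply: (heisenberg_invariant_form sfV sfM phi_vac phi_anti phi_al).
(* In the order of C a nonnegative element is real, and this makes alpha(0) self-adjoint. *)
by rewrite conj_Creal // ger0_real.
Qed.

End HeisenbergVertexAlgebra.

Theorem proposition4p9 (R : realType) :
  exists (Y : vertex_map (M1 R[i]) (M1 R[i])) (phi : M1 R[i] -> M1 R[i]),
    [/\ unique (@heisenberg_voa R[i]) Y,
        unique (@heisenberg_involution R[i]) phi,
        is_unitary_voa Y (vacuum R[i]) (conformal R[i]) phi
      & forall lam : cartan R[i], 0 <= cform (alpha R[i]) lam ->
          exists YM : vertex_map (M1 R[i]) (fock lam),
            [/\ unique (heisenberg_module Y (lam := lam)) YM,
                irreducible YM
              & is_unitary_module Y (vacuum R[i]) (conformal R[i]) phi YM]].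
Proof. exact: heisenberg_unitary. Qed.
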